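(* Let $f \in L^2[0,2\pi]$ and let $f^*$ be the $2\pi$-periodic extension of $f$. Let $V$ be a real-valued piecewise $C^2$ potential (in the sense of the context), and let $u(t,x)$ be the solution of the periodic Schr\''odinger equation $\mathrm{i}\,u_t = -u_{xx} + V u$, $u(0,x)=f(x)$, with periodic boundary conditions $u(t,0)=u(t,2\pi)$, $u_x(t,0)=u_x(t,2\pi)$. For coprime $q, r \in \mathbb{N}$ (positive integers), define $$\psi\left(2\pi \frac{q}{r}, x\right) = \frac{1}{r}\, e^{-2\pi \mathrm{i} \langle V\rangle q/r} \sum_{k,m=0}^{r-1} e^{2\pi \mathrm{i}\left(mk/r - m^2 q/r\right)} f^*\left(x - 2\pi\frac{k}{r}\right).$$ Then, at the rational time $t_0 = 2\pi \frac{q}{r}$, there exists a function $w(t_0,x)$, continuous in $x$, such that in $L^2[0,2\pi]$ $$u(t_0,x) = w(t_0,x) + \psi(t_0,x).$$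
   Context: $\mathrm{i}=\sqrt{-1}$ and $\langle V\rangle = \frac{1}{2\pi}\int_0^{2\pi} V(x)\,dx$. Solution: let $L = -\frac{d^2}{dx^2} + V$ be the self-adjoint operator on $L^2[0,2\pi]$ with domain $D(L)=\{\psi\in H^2[0,2\pi] : \psi(0)=\psi(2\pi),\ \psi'(0)=\psi'(2\pi)\}$. The solution is the mild solution $u(t,\cdot) = e^{-\mathrm{i}tL} f \in L^2[0,2\pi]$; identities involving $u$ are understood almost everywhere in $x$. Piecewise $C^2$ potential: there exist finitely many points $0=x_0<x_1<\dots<x_N<x_{N+1}=2\pi$ such that $V$ is bounded and $2\pi$-periodic; $V\in C^2(x_i,x_{i+1})$ for all $0\le i\le N$; and $V, V', V''$ have finite right and left limits at the points $x_i$. Potentials that agree almost everywhere are identified. *)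

(* Defs.v *)
From HB Require Import structures.
From mathcomp Require Import all_boot all_order all_algebra complex.
From mathcomp Require Import all_classical all_reals all_analysis.
Set Implicit Arguments.
Unset Strict Implicit.
Unset Printing Implicit Defensive.
Import Order.TTheory GRing.Theory Num.Theory.
Import numFieldNormedType.Exports.
Local Open Scope classical_set_scope.
Local Open Scope ring_scope.
Local Open Scope complex_scope.

Section Defs.
Context {R : realType}.
Implicit Types (V : R -> R) (f g u v phi : R -> R[i]).

Local Notation mu := (@lebesgue_measure R).

(* Elements of L^2[0,2pi] are represented by functions on R, of which only the
   restriction to [0,2pi] up to null sets is relevant. *)
Definition itv2pi : set R := `[0, 2 * pi].

Definition ae_equal f g := ae_eq mu itv2pi f g.

Definition L2sqnorm f : \bar R :=
  (\int[mu]_(x in itv2pi) (ComplexField.Normc.normc (f x) ^+ 2)%:E)%E.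

Definition L2 f : Prop :=
  [/\ measurable_fun itv2pi (fun x => complex.Re (f x)),
      measurable_fun itv2pi (fun x => complex.Im (f x))
    & (L2sqnorm f < +oo)%E].

Definition cintegral (A : set R) f : R[i] :=
  (\int[mu]_(x in A) complex.Re (f x)) +i* (\int[mu]_(x in A) complex.Im (f x)).

Definition cis (theta : R) : R[i] := cos theta +i* sin theta.

Definition is_primitive phi dphi : Prop :=
  forall x, x \in itv2pi -> phi x = phi 0 + cintegral `[0, x] dphi.

(* H^2[0,2pi] consists of the C^1 functions phi whose derivative is absolutely
   continuous with phi'' in L^2[0,2pi]; absolute continuity is expressed by
   phi and phi' being the indefinite integrals of phi' and phi''. *)
Definition H2_periodic phi dphi d2phi : Prop :=
  [/\ L2 d2phi, is_primitive dphi d2phi, is_primitive phi dphi,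
      phi 0 = phi (2 * pi) & dphi 0 = dphi (2 * pi)].

(* The graph of L = -d^2/dx^2 + V: the class of f lies in D(L), with image the
   class of g. *)
Definition schrodinger_op V f g : Prop :=
  exists phi dphi d2phi : R -> R[i],
    [/\ H2_periodic phi dphi d2phi, ae_equal f phi
      & ae_equal g (fun x => - d2phi x + (V x)%:C * phi x)].

(* A strongly continuous one-parameter unitary group on L^2[0,2pi]; the group
   law makes the isometries U t surjective, and linearity with isometry makes
   them compatible with almost everywhere equality. *)
Record unitary_group (U : R -> (R -> R[i]) -> (R -> R[i])) : Prop := {
  ugroup_L2 : forall t f, L2 f -> L2 (U t f);
  ugroup_linear : forall t (a : R[i]) f g, L2 f -> L2 g ->
    ae_equal (U t (fun x => a * f x + g x))
             (fun x => a * U t f x + U t g x);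
  ugroup_isometry : forall t f, L2 f -> L2sqnorm (U t f) = L2sqnorm f;
  ugroup0 : forall f, L2 f -> ae_equal (U 0 f) f;
  ugroupD : forall s t f, L2 f -> ae_equal (U (s + t) f) (U s (U t f));
  ugroup_cvg : forall f, L2 f ->
    L2sqnorm (fun x => U h f x - f x) @[h --> (0 : R)] --> 0%E }.

(* By Stone's theorem, exp(-itL) is the unique unitary group with infinitesimal
   generator -iL: f is in D(L) with L f = g if and only if
   i (U h f - f) / h --> g in L^2[0,2pi] as h --> 0. *)
Definition schrodinger_group V (U : R -> (R -> R[i]) -> (R -> R[i])) : Prop :=
  unitary_group U /\
  forall f g, L2 f -> L2 g ->
    schrodinger_op V f g <->
    L2sqnorm (fun x => 'i%C * (h^-1)%:C * (U h f x - f x) - g x)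
      @[h --> 0^'] --> 0%E.

Definition mild_solution V f (u : R -> R -> R[i]) : Prop :=
  exists2 U, schrodinger_group V U & forall t, ae_equal (u t) (U t f).

Definition C2_on (a b : R) V : Prop :=
  [/\ {in `]a, b[, forall x, derivable V x 1},
      {in `]a, b[, forall x, derivable (derive1n 1 V) x 1}
    & {in `]a, b[, continuous (derive1n 2 V)}].

Definition piecewise_C2 V : Prop :=
  [/\ exists M : R, forall x, `|V x| <= M,
      periodic V (2 * pi)
    & exists (N : nat) (p : nat -> R),
      [/\ p 0%N = 0, p N.+1 = 2 * pi,
          forall i, (i <= N)%N -> p i < p i.+1,
          forall i, (i <= N)%N -> C2_on (p i) (p i.+1) V
        & forall i k, (i <= N.+1)%N -> (k <= 2)%N ->
          cvg (derive1n k V x @[x --> (p i)^'-]) /\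
          cvg (derive1n k V x @[x --> (p i)^'+])]].

Definition mean V : R := (2 * pi)^-1 * \int[mu]_(x in itv2pi) V x.

Definition periodic_ext f : R -> R[i] :=
  fun x => f (x - 2 * pi * (Num.floor (x / (2 * pi)))%:~R).

Definition rational_time (q r : nat) : R := 2 * pi * (q%:R / r%:R).

Definition revival V f (q r : nat) (x : R) : R[i] :=
  r%:R^-1 * cis (- (2 * pi * mean V * q%:R / r%:R)) *
  \sum_(k < r) \sum_(m < r)
    cis (2 * pi * (m%:R * k%:R / r%:R - m%:R ^+ 2 * q%:R / r%:R)) *
    periodic_ext f (x - 2 * pi * (k%:R / r%:R)).

End Defs.

(* Main.v *)
(* Let e_n = exp(i n x).  Subtracting from e_n a correction that solves
   - y'' - n^2 y = (V - <V>) e_n up to its resonant part gives a quasimode d_n in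
   D(L) with L d_n = (n^2 + <V>) d_n + R_n.  The corrections and the R_n are so small
   that, by Bessel's inequality, the sums of |<v, e_n - d_n>| and of |<v, R_n>| over n
   are bounded in terms of the L^2 norm of v only.  Differentiating
   <u(t), exp(-i t (n^2 + <V>)) d_n> in t, one finds that the Fourier coefficients of
   u(t) differ from exp(-i t (n^2 + <V>)) <f, e_n> by a summable sequence.  At
   t = 2 pi q / r the factor exp(-i t n^2) depends on n modulo r only, and the finite
   Fourier transform identifies exp(-i t (n^2 + <V>)) <f, e_n> with the coefficients of
   psi.  Hence u - psi has absolutely summable Fourier coefficients, so it agrees almost
   everywhere with a continuous function.
   Complex integrals are handled through the real inner product
   ip f g = Re <f, g>; modulating e_n by arbitrary g_n with |g_n| <= 1 recovers the
   moduli of the complex coefficients. *)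
Require Import Defs.
From mathcomp Require Import all_boot all_order all_algebra complex.
From mathcomp Require Import all_classical all_reals all_analysis.
From mathcomp Require Import measurable_realfun ring lra.
Set Implicit Arguments.
Unset Strict Implicit.
Unset Printing Implicit Defensive.
Import Order.TTheory GRing.Theory Num.Theory.
Import numFieldNormedType.Exports.
Local Open Scope classical_set_scope.
Local Open Scope ring_scope.
Local Open Scope complex_scope.

Section BoundedMeasurable.
Context {R : realType}.
Implicit Types (a b k : R -> R).

Local Notation mu := (@lebesgue_measure R).
Local Notation D := (@itv2pi R).

Definition bdd_measurable a :=
  measurable_fun D a /\ exists M : R, forall x, D x -> `|a x| <= M.

Definition Dintegrable a := mu.-integrable D (EFin \o a).

Lemma measurable_itv2pi : measurable D.
Proof. exact: measurable_itv. Qed.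
Hint Resolve measurable_itv2pi : core.

Lemma twopi_gt0 : 0 < 2 * pi :> R.
Proof. by rewrite mulr_gt0 ?pi_gt0. Qed.

Lemma in_itv2pi x : D x <-> 0 <= x <= 2 * pi.
Proof. by rewrite /itv2pi /= in_itv. Qed.

Lemma itv2pi0 : D 0.
Proof. by apply/in_itv2pi; rewrite lexx ltW ?twopi_gt0. Qed.

Lemma itv2pi_twopi : D (2 * pi).
Proof. by apply/in_itv2pi; rewrite lexx ltW ?twopi_gt0. Qed.

Lemma mu_itv2pi : mu D = (2 * pi)%:E.
Proof. by rewrite /itv2pi lebesgue_measure_itv /= lte_fin twopi_gt0 oppr0 adde0. Qed.

Lemma bdd_measurable_cst c : bdd_measurable (fun=> c).
Proof. by split; [exact: measurable_cst | exists `|c| => x _]. Qed.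

Lemma bdd_measurableD a b :
  bdd_measurable a -> bdd_measurable b -> bdd_measurable (fun x => a x + b x).
Proof.
move=> [ma [M aM]] [mb [N bN]]; split; first exact: measurable_funD.
exists (M + N) => x Dx; rewrite (le_trans (ler_normD _ _))// lerD//.
  exact: aM.
exact: bN.
Qed.

Lemma bdd_measurableM a b :
  bdd_measurable a -> bdd_measurable b -> bdd_measurable (fun x => a x * b x).
Proof.
move=> [ma [M aM]] [mb [N bN]]; split; first exact: measurable_funM.
by exists (M * N) => x Dx; rewrite normrM ler_pM// ?aM ?bN.
Qed.

Lemma bdd_measurableN a : bdd_measurable a -> bdd_measurable (fun x => - a x).
Proof.
move=> [ma [M aM]]; split; first exact: measurableT_comp.
by exists M => x Dx; rewrite normrN aM.
Qed.

Lemma bdd_measurableB a b :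
  bdd_measurable a -> bdd_measurable b -> bdd_measurable (fun x => a x - b x).
Proof. by move=> ha hb; apply: bdd_measurableD => //; exact: bdd_measurableN. Qed.

Lemma eq_bdd_measurable a b :
  {in D, a =1 b} -> bdd_measurable a -> bdd_measurable b.
Proof.
move=> ab [ma [M aM]]; split; first exact: eq_measurable_fun ma.
by exists M => x Dx; rewrite -ab ?inE// aM.
Qed.

Lemma bdd_boundedP a : bdd_measurable a -> [bounded a x | x in D].
Proof.
move=> [_ [M aM]]; exists M; split; first exact: num_real.
by move=> N MN x Dx; rewrite /= (le_trans (aM _ Dx))// ltW.
Qed.

Lemma Dintegrable_bdd a : bdd_measurable a -> Dintegrable a.
Proof.
move=> ha; apply: measurable_bounded_integrable => //.
- by rewrite [X in (X < _)%E]mu_itv2pi ltry.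
- by case: ha.
- exact: bdd_boundedP.
Qed.

Lemma DintegrableMbdd k a :
  bdd_measurable k -> Dintegrable a -> Dintegrable (fun x => k x * a x).
Proof.
move=> hk ia; have mD : measurable D by [].
by have := @integrableMr _ _ R mu D mD k (EFin \o a) hk.1 (bdd_boundedP hk) ia.
Qed.

Lemma DintegrableD a b :
  Dintegrable a -> Dintegrable b -> Dintegrable (fun x => a x + b x).
Proof. by move=> ia ib; exact: (integrableD _ ia ib). Qed.

Lemma DintegrableN a : Dintegrable a -> Dintegrable (fun x => - a x).
Proof. by move=> ia; have := integrableN ia. Qed.

Lemma DintegrableB a b :
  Dintegrable a -> Dintegrable b -> Dintegrable (fun x => a x - b x).
Proof. by move=> ia ib; apply: DintegrableD => //; exact: DintegrableN. Qed.

Lemma DintegrableZ c a : Dintegrable a -> Dintegrable (fun x => c * a x).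
Proof. by move=> ia; apply: DintegrableMbdd => //; exact: bdd_measurable_cst. Qed.

Lemma Dintegrable_norm a : Dintegrable a -> Dintegrable (fun x => `|a x|).
Proof. exact: integrable_norm. Qed.

Lemma Dintegrable_measurable a : Dintegrable a -> measurable_fun D a.
Proof. by move=> /integrableP[/measurable_EFinP]. Qed.

Lemma le_Dintegrable a b : measurable_fun D a ->
  (forall x, D x -> `|a x| <= b x) -> Dintegrable b -> Dintegrable a.
Proof.
move=> ma ab; apply: le_integrable => //; first exact/measurable_EFinP.
move=> x Dx /=; by rewrite lee_fin (le_trans (ab _ Dx))// ler_norm.
Qed.

Lemma Dintegrable_mul a b : measurable_fun D a -> measurable_fun D b ->
  Dintegrable (fun x => a x ^+ 2) -> Dintegrable (fun x => b x ^+ 2) ->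
  Dintegrable (fun x => a x * b x).
Proof.
move=> ma mb ia ib.
apply: (@le_Dintegrable _ (fun x => a x ^+ 2 + b x ^+ 2)).
- exact: measurable_funM.
- by move=> x _; rewrite ler_norml; apply/andP; split; nra.
- exact: DintegrableD.
Qed.

Lemma Rintegral_bound M a : bdd_measurable a ->
  (forall x, D x -> `|a x| <= M) ->
  `|\int[mu]_(x in D) a x| <= M * (2 * pi).
Proof.
move=> ha aM; have ia := Dintegrable_bdd ha.
rewrite (le_trans (le_normr_Rintegral _ ia))//.
have -> : 2 * pi = fine (mu D) by rewrite [X in fine X]mu_itv2pi.
rewrite -(Rintegral_cst mu)//; apply: le_Rintegral => //.
- exact: Dintegrable_norm.
- by apply: Dintegrable_bdd; exact: bdd_measurable_cst.
Qed.

End BoundedMeasurable.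
#[export] Hint Extern 0 (measurable _) => solve [exact: measurable_itv2pi] : core.

Section Primitive.
Context {R : realType}.
Implicit Types (a b k F K : R -> R).

Local Notation mu := (@lebesgue_measure R).
Local Notation D := (@itv2pi R).

Definition primitive F a := forall x, D x -> F x = F 0 + \int[mu]_(t in `[0, x]) a t.

Lemma itv_sub2pi (b1 b2 : bool) (x y : R) : 0 <= x -> y <= 2 * pi ->
  [set` Interval (BSide b1 x) (BSide b2 y)] `<=` D.
Proof.
move=> x0 y2 t /=; rewrite itv_boundlr => /andP[/= h1 h2].
apply/in_itv2pi; apply/andP; split.
  by apply: (le_trans x0); move: h1; case: b1; rewrite bnd_simp // => /ltW.
by apply: le_trans y2; move: h2; case: b2; rewrite bnd_simp // => /ltW.
Qed.

Lemma integrable_sub_itv (b1 b2 : bool) (x y : R) a : 0 <= x -> y <= 2 * pi ->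
  Dintegrable a ->
  mu.-integrable [set` Interval (BSide b1 x) (BSide b2 y)] (EFin \o a).
Proof.
by move=> x0 y2 ia; apply: integrableS ia => //; exact: itv_sub2pi.
Qed.

Lemma Rintegral_itv_bound x y M a : 0 <= x -> x <= y -> y <= 2 * pi ->
  Dintegrable a -> (forall t, x < t -> t <= y -> `|a t| <= M) ->
  `|\int[mu]_(t in `]x, y]) a t| <= M * (y - x).
Proof.
move=> x0 xy y2 ia aM.
have iaxy : mu.-integrable `]x, y] (EFin \o a) by exact: integrable_sub_itv.
rewrite (le_trans (le_normr_Rintegral _ iaxy))//.
have -> : y - x = fine (mu `]x, y]).
  rewrite lebesgue_measure_itv /= lte_fin; case: ltP => // yx.
  by apply/eqP; rewrite subr_eq0 eq_le yx xy.
rewrite -(Rintegral_cst mu)//; apply: le_Rintegral => //.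
- exact: integrable_norm.
- apply: integrable_sub_itv => //.
  by apply: Dintegrable_bdd; exact: bdd_measurable_cst.
- by move=> t /=; rewrite in_itv/= => /andP[xt ty]; exact: aM.
Qed.

Lemma primitive_increment F a x y : primitive F a -> Dintegrable a ->
  0 <= x -> x <= y -> y <= 2 * pi ->
  F y - F x = \int[mu]_(t in `]x, y]) a t.
Proof.
move=> Fa ia x0 xy y2.
rewrite (Fa y) ?(Fa x); last 2 first.
- by apply/in_itv2pi; rewrite x0 (le_trans xy).
- by apply/in_itv2pi; rewrite y2 (le_trans x0).
rewrite opprD addrACA subrr add0r Rintegral_itvB//.
exact: integrable_sub_itv.
Qed.

Lemma bdd_primitive F a : primitive F a -> bdd_measurable a -> bdd_measurable F.
Proof.
move=> Fa ha; have ia := Dintegrable_bdd ha; split.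
  apply: (@eq_measurable_fun _ _ _ _ _ (fun x => F 0 + parameterized_integral mu 0 x a)).
    by move=> x /[!inE] Dx; rewrite (Fa x Dx).
  apply: measurable_funD; first exact: measurable_cst.
  apply: subspace_continuous_measurable_fun => //.
  by apply: parameterized_integral_continuous => //; rewrite ltW ?twopi_gt0.
have [ma [M aM]] := ha.
exists (`|F 0| + M * (2 * pi)) => x /[dup] Dx /in_itv2pi/andP[x0 x2].
have -> : F x = F 0 + (F x - F 0) by ring.
rewrite (le_trans (ler_normD _ _))// lerD2l.
rewrite (primitive_increment Fa)//.
have M0 : 0 <= M by rewrite (le_trans (normr_ge0 (a x)))// aM.
rewrite (le_trans (@Rintegral_itv_bound 0 x M a _ _ _ _ _))//.
  by move=> t t0 tx; apply: aM; apply/in_itv2pi; rewrite (ltW t0) (le_trans tx).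
by rewrite subr0 ler_wpM2l.
Qed.

Lemma primitive_integral a c :
  primitive (fun x => c + \int[mu]_(t in `[0, x]) a t) a.
Proof. by move=> x Dx; rewrite set_itv1 Rintegral_set1 addr0. Qed.

Lemma primitive_cst c : primitive (fun=> c) (fun=> 0).
Proof. by move=> x Dx; rewrite Rintegral_cst// mul0r addr0. Qed.

Lemma primitiveD F a K b : primitive F a -> primitive K b ->
  bdd_measurable a -> bdd_measurable b ->
  primitive (fun x => F x + K x) (fun x => a x + b x).
Proof.
move=> Fa Kb /Dintegrable_bdd ia /Dintegrable_bdd ib x /[dup] Dx /in_itv2pi/andP[x0 x2].
rewrite (Fa x Dx) (Kb x Dx) RintegralD//; first by ring.
all: exact: integrable_sub_itv.
Qed.

Lemma quadratic_increments_cst (C : R) F :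
  (forall x y : R, 0 <= x -> x <= y -> y <= 2 * pi -> `|F y - F x| <= C * (y - x) ^+ 2) ->
  forall x, D x -> F x = F 0.
Proof.
move=> FC x /in_itv2pi/andP[x0 x2].
have step (n : nat) : `|F x - F 0| * n.+1%:R <= C * x ^+ 2.
  have n0 : 0 < n.+1%:R :> R by [].
  have incr (k : nat) : (k <= n.+1)%N ->
      `|F (k%:R * (x / n.+1%:R)) - F 0| <= k%:R * (C * (x / n.+1%:R) ^+ 2).
    elim: k => [|k IH] kn; first by rewrite !mul0r subrr normr0.
    have -> : F (k.+1%:R * (x / n.+1%:R)) - F 0 =
      (F (k.+1%:R * (x / n.+1%:R)) - F (k%:R * (x / n.+1%:R))) +
      (F (k%:R * (x / n.+1%:R)) - F 0) by ring.
    rewrite (le_trans (ler_normD _ _))//.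
    have xn : 0 <= x / n.+1%:R by rewrite divr_ge0.
    have -> : k.+1%:R * (C * (x / n.+1%:R) ^+ 2) =
      C * (x / n.+1%:R) ^+ 2 + k%:R * (C * (x / n.+1%:R) ^+ 2).
      by rewrite -natr1; ring.
    apply: lerD; last exact/IH/ltnW.
    have := FC (k%:R * (x / n.+1%:R)) (k.+1%:R * (x / n.+1%:R)).
    have -> : k.+1%:R * (x / n.+1%:R) - k%:R * (x / n.+1%:R) = x / n.+1%:R.
      by rewrite -natr1; ring.
    apply.
    - by rewrite mulr_ge0.
    - by rewrite ler_wpM2r// ler_nat.
    - rewrite (le_trans _ x2)// mulrCA ler_piMr// ler_pdivrMr// mul1r ler_nat//.
  have := incr n.+1 (leqnn _).
  rewrite mulrC divfK ?gt_eqF// => /(ler_wpM2r (ltW n0)) /le_trans; apply.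
  have -> : n.+1%:R * (C * (x / n.+1%:R) ^+ 2) * n.+1%:R = C * x ^+ 2.
    by field; rewrite addrC natr1 gt_eqF.
  exact: lexx.
apply/eqP; rewrite -subr_eq0 -normr_eq0; apply/negPn/negP => Fx.
have Fx0 : 0 < `|F x - F 0| by rewrite lt_def Fx normr_ge0.
have := Num.Theory.truncnS_gt (C * x ^+ 2 / `|F x - F 0|).
by rewrite ltr_pdivrMr// [X in _ < X]mulrC ltNge step.
Qed.

(* No Fubini is needed: F K minus the right-hand side has quadratic increments. *)
Lemma primitiveM F a K b : primitive F a -> primitive K b ->
  bdd_measurable a -> bdd_measurable b ->
  primitive (fun x => F x * K x) (fun x => a x * K x + F x * b x).
Proof.
move=> Fa Kb ha hb.
have hF := bdd_primitive Fa ha; have hK := bdd_primitive Kb hb.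
have [[ma [M0 aM0]] [mb [N0 bN0]]] := (ha, hb).
pose M := M0 + N0.
have aM x : D x -> `|a x| <= M.
  by move=> Dx; rewrite (le_trans (aM0 _ Dx))// lerDl (le_trans _ (bN0 _ Dx)).
have bM x : D x -> `|b x| <= M.
  by move=> Dx; rewrite (le_trans (bN0 _ Dx))// lerDr (le_trans _ (aM0 _ Dx)).
have M_ge0 : 0 <= M by rewrite (le_trans _ (aM _ itv2pi0)).
pose G x := F x * K x - \int[mu]_(t in `[0, x]) (a t * K t + F t * b t).
have iaK : Dintegrable (fun x => a x * K x + F x * b x).
  by apply: Dintegrable_bdd; apply: bdd_measurableD; exact: bdd_measurableM.
have inc (x y : R) P p : primitive P p -> bdd_measurable p ->
    (forall t, D t -> `|p t| <= M) ->
    0 <= x -> x <= y -> y <= 2 * pi -> `|P y - P x| <= M * (y - x).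
  move=> Pp hp pM x0 xy y2; rewrite (primitive_increment Pp)//; last exact: Dintegrable_bdd.
  apply: Rintegral_itv_bound => //; first exact: Dintegrable_bdd.
  move=> t xt ty; apply: pM; apply/in_itv2pi.
  by rewrite (le_trans x0 (ltW xt)) (le_trans ty).
have key (x y : R) : 0 <= x -> x <= y -> y <= 2 * pi ->
    `|G y - G x| <= 3 * M ^+ 2 * (y - x) ^+ 2.
  move=> x0 xy y2.
  have Dt t : x < t -> t <= y -> D t.
    by move=> xt ty; apply/in_itv2pi; rewrite (le_trans x0 (ltW xt)) (le_trans ty).
  have sub c d : bdd_measurable c -> bdd_measurable d ->
     mu.-integrable `]x, y] (EFin \o (fun t => c t * d t)).
    by move=> hc hd; apply: integrable_sub_itv => //; apply: Dintegrable_bdd; exact: bdd_measurableM.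
  have intE : \int[mu]_(t in `]x, y]) (a t * K t + F t * b t) =
     \int[mu]_(t in `]x, y]) (a t * (K t - K x)) + K x * (F y - F x) +
     (\int[mu]_(t in `]x, y]) ((F t - F x) * b t) + F x * (K y - K x)).
    rewrite RintegralD//; [|exact: sub|exact: sub].
    rewrite (primitive_increment Fa)//; last exact: Dintegrable_bdd.
    rewrite (primitive_increment Kb)//; last exact: Dintegrable_bdd.
    have hKx : bdd_measurable (fun t => K t - K x).
      by apply: bdd_measurableB => //; exact: bdd_measurable_cst.
    have hFx : bdd_measurable (fun t => F t - F x).
      by apply: bdd_measurableB => //; exact: bdd_measurable_cst.
    have iL p : bdd_measurable p -> mu.-integrable `]x, y] (EFin \o p).
      by move=> hp; apply: integrable_sub_itv => //; exact: Dintegrable_bdd.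
    congr (_ + _).
      rewrite -RintegralZl//; last exact: iL.
      rewrite -RintegralD//; [|exact: sub|apply: sub => //; exact: bdd_measurable_cst].
      by apply: eq_Rintegral => t _; ring.
    rewrite -RintegralZl//; last exact: iL.
    rewrite -RintegralD//; [|exact: sub|apply: sub => //; exact: bdd_measurable_cst].
    by apply: eq_Rintegral => t _; ring.
  have -> : G y - G x = (F y - F x) * (K y - K x) -
     \int[mu]_(t in `]x, y]) (a t * (K t - K x)) -
     \int[mu]_(t in `]x, y]) ((F t - F x) * b t).
    rewrite /G.
    have := @primitive_increment _ _ x y (primitive_integral (fun t => a t * K t + F t * b t) 0) iaK x0 xy y2.
    rewrite !add0r intE => /eqP; rewrite subr_eq => /eqP ->; ring.
  have yx : 0 <= y - x by rewrite subr_ge0.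
  have -> : 3 * M ^+ 2 * (y - x) ^+ 2 = M * (y - x) * (M * (y - x)) +
     M * (M * (y - x)) * (y - x) + M * (y - x) * M * (y - x) by ring.
  rewrite (le_trans (ler_normB _ _))// lerD//; last first.
    apply: Rintegral_itv_bound => //.
      apply: Dintegrable_bdd; apply: bdd_measurableM => //.
      by apply: bdd_measurableB => //; exact: bdd_measurable_cst.
    move=> t xt ty; rewrite normrM ler_pM// ?bM//; last exact: Dt.
    rewrite (le_trans (inc x t _ _ Fa ha aM _ _ _))// ?(ltW xt)//.
      by rewrite (le_trans ty).
    by rewrite ler_wpM2l// lerB.
  rewrite (le_trans (ler_normB _ _))// lerD//.
    by rewrite normrM ler_pM//; [exact: (inc x y F a)|exact: (inc x y K b)].
  apply: Rintegral_itv_bound => //.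
    apply: Dintegrable_bdd; apply: bdd_measurableM => //.
    by apply: bdd_measurableB => //; exact: bdd_measurable_cst.
  move=> t xt ty; rewrite normrM ler_pM// ?aM//; first exact: Dt.
  rewrite (le_trans (inc x t _ _ Kb hb bM _ _ _))// ?(ltW xt)//.
    by rewrite (le_trans ty).
  by rewrite ler_wpM2l// lerB.
move=> x Dx; have := quadratic_increments_cst key Dx.
by rewrite /G set_itv1 Rintegral_set1 subr0 => <-; rewrite subrK.
Qed.

Lemma primitiveN F a : primitive F a -> bdd_measurable a ->
  primitive (fun x => - F x) (fun x => - a x).
Proof.
move=> Fa /Dintegrable_bdd ia x /[dup] Dx /in_itv2pi/andP[x0 x2].
have i0 : mu.-integrable `[0, x] (EFin \o a) by exact: integrable_sub_itv.
rewrite (Fa x Dx) opprD; congr (_ + _).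
rewrite -mulN1r -RintegralZl//.
by apply: eq_Rintegral => t _; rewrite mulN1r.
Qed.

Lemma primitiveB F a K b : primitive F a -> primitive K b ->
  bdd_measurable a -> bdd_measurable b ->
  primitive (fun x => F x - K x) (fun x => a x - b x).
Proof.
move=> Fa Kb ha hb; apply: primitiveD => //; last exact: bdd_measurableN.
exact: primitiveN.
Qed.

Lemma eq_primitive F a K b : {in D, F =1 K} -> {in D, a =1 b} ->
  primitive F a -> primitive K b.
Proof.
move=> FK ab Fa x /[dup] Dx /in_itv2pi/andP[x0 x2].
rewrite -FK ?inE// -FK ?inE//; last exact: itv2pi0.
rewrite (Fa _ Dx); congr (_ + _); apply: eq_Rintegral => t.
by rewrite !inE => /= tx; apply: ab; rewrite inE; apply: itv_sub2pi tx.
Qed.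

Lemma primitive_derive (F f : R -> R) : (forall x : R, is_derive x 1 F (f x)) ->
  continuous f -> primitive F f.
Proof.
move=> dF cf x /in_itv2pi/andP[x0 _].
move: x0; rewrite le_eqVlt => /predU1P[<-|x0]; first by rewrite set_itv1 Rintegral_set1 addr0.
have cF : continuous F.
  by move=> y; apply: differentiable_continuous; apply/derivable1_diffP; have [] := dF y.
rewrite /Rintegral (@continuous_FTC2 _ f F 0 x x0).
- by rewrite /= addrCA subrr addr0.
- exact: continuous_subspaceT.
- split.
  + by move=> y _; have [] := dF y.
  + by apply: cvg_at_right_filter; exact: cF.
  + by apply: cvg_at_left_filter; exact: cF.
- by move=> y _; rewrite derive1E; have [_ ->] := dF y.
Qed.

Lemma bdd_continuous (f : R -> R) : continuous f -> bdd_measurable f.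
Proof.
move=> cf; split.
  by apply: measurable_funTS; exact: continuous_measurable_fun.
have : compact (f @` D).
  apply: continuous_compact; last exact: segment_compact.
  exact: continuous_subspaceT.
move=> /compact_bounded[M [_ hM]]; exists (`|M| + 1) => x Dx.
apply: hM; last by exists x.
by rewrite ltr_pwDr// ler_norm.
Qed.

End Primitive.

Section ComplexParts.
Context {R : realType}.
Implicit Types z w : R[i].

Lemma Re_add z w : complex.Re (z + w) = complex.Re z + complex.Re w.
Proof. by case: z; case: w. Qed.

Lemma Im_add z w : complex.Im (z + w) = complex.Im z + complex.Im w.
Proof. by case: z; case: w. Qed.

Lemma Re_opp z : complex.Re (- z) = - complex.Re z.
Proof. by case: z. Qed.

Lemma Im_opp z : complex.Im (- z) = - complex.Im z.
Proof. by case: z. Qed.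

Lemma Re_mul z w :
  complex.Re (z * w) = complex.Re z * complex.Re w - complex.Im z * complex.Im w.
Proof. by case: z; case: w. Qed.

Lemma Im_mul z w :
  complex.Im (z * w) = complex.Re z * complex.Im w + complex.Im z * complex.Re w.
Proof. by case: z; case: w. Qed.

Lemma Re_conj z : complex.Re z^*%C = complex.Re z.
Proof. by case: z. Qed.

Lemma Im_conj z : complex.Im z^*%C = - complex.Im z.
Proof. by case: z. Qed.

Definition ReImE := (Re_add, Im_add, Re_opp, Im_opp, Re_mul, Im_mul, Re_conj, Im_conj).

Lemma complex_parts_eq z w : complex.Re z = complex.Re w -> complex.Im z = complex.Im w -> z = w.
Proof. by case: z; case: w => /= ? ? ? ? -> ->. Qed.

Definition nrm2 z : R := complex.Re z ^+ 2 + complex.Im z ^+ 2.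

Lemma sqr_normcE z : ComplexField.Normc.normc z ^+ 2 = nrm2 z.
Proof. by case: z => a b; rewrite /= sqr_sqrtr// addr_ge0// sqr_ge0. Qed.

Lemma nrm2_ge0 z : 0 <= nrm2 z.
Proof. by rewrite addr_ge0// sqr_ge0. Qed.

Lemma nrm2M z w : nrm2 (z * w) = nrm2 z * nrm2 w.
Proof. by rewrite /nrm2 !ReImE; ring. Qed.

Lemma nrm2_cis (t : R) : nrm2 (cis t) = 1.
Proof. by rewrite /nrm2 /= cos2Dsin2. Qed.

Lemma cisD (s t : R) : cis (s + t) = cis s * cis t.
Proof. by rewrite /cis cosD sinD; apply: complex_parts_eq; rewrite !ReImE /=; ring. Qed.

Lemma cis0 : cis (0 : R) = 1.
Proof. by rewrite /cis cos0 sin0. Qed.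

Lemma cisN (t : R) : cis (- t) = (cis t)^*%C.
Proof. by rewrite /cis cosN sinN. Qed.

Lemma cis_2pi_int (n : int) : cis (n%:~R * (2 * pi) : R) = 1.
Proof.
have hn (m : nat) : cis (m%:R * (2 * pi) : R) = 1.
  elim: m => [|m IH]; first by rewrite mul0r cis0.
  by rewrite -natr1 mulrDl mul1r cisD IH mul1r mulr_natl /cis cos2pi sin2pi.
case: n => m; first exact: hn.
by rewrite NegzE mulrNz mulNr cisN hn; apply: complex_parts_eq; rewrite /= ?oppr0.
Qed.

End ComplexParts.

Section L2Space.
Context {R : realType}.
Implicit Types (f g h k : R -> R[i]) (a b : R -> R).

Local Notation mu := (@lebesgue_measure R).
Local Notation D := (@itv2pi R).

Definition ip f g : R := \int[mu]_(x in D)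
  (complex.Re (f x) * complex.Re (g x) + complex.Im (f x) * complex.Im (g x)).

Definition cbdd k : Prop :=
  bdd_measurable (fun x => complex.Re (k x)) /\ bdd_measurable (fun x => complex.Im (k x)).

Definition sq_integrable a := measurable_fun D a /\ Dintegrable (fun x => a x ^+ 2).

Lemma sq_integrableD a b :
  sq_integrable a -> sq_integrable b -> sq_integrable (fun x => a x + b x).
Proof.
move=> [ma ia] [mb ib]; split; first exact: measurable_funD.
apply: (@le_Dintegrable _ _ (fun x => 2 * (a x ^+ 2 + b x ^+ 2))).
- by apply: measurable_funX; exact: measurable_funD.
- by move=> x _; rewrite ger0_norm ?sqr_ge0// -subr_ge0 (_ : _ - _ = (a x - b x) ^+ 2) ?sqr_ge0//; ring.
- by apply: DintegrableZ; exact: DintegrableD.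
Qed.

Lemma sq_integrableM a b :
  bdd_measurable a -> sq_integrable b -> sq_integrable (fun x => a x * b x).
Proof.
move=> ha [mb ib]; split; first by apply: measurable_funM => //; exact: ha.1.
under eq_fun do rewrite exprMn expr2.
by apply: DintegrableMbdd => //; exact: bdd_measurableM.
Qed.

Lemma sq_integrableN a : sq_integrable a -> sq_integrable (fun x => - a x).
Proof.
move=> [ma ia]; split; first exact: measurable_funN.
by under eq_fun do rewrite sqrrN.
Qed.

Lemma sq_integrable_bdd a : bdd_measurable a -> sq_integrable a.
Proof.
move=> ha; split; first exact: ha.1.
under eq_fun do rewrite expr2.
by apply: Dintegrable_bdd; exact: bdd_measurableM.
Qed.

Lemma L2E f : L2 f <-> sq_integrable (fun x => complex.Re (f x)) /\
                       sq_integrable (fun x => complex.Im (f x)).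
Proof.
have nE : L2sqnorm f = (\int[mu]_(x in D)
   (complex.Re (f x) ^+ 2 + complex.Im (f x) ^+ 2)%:E)%E.
  by apply: eq_integral => x _; rewrite sqr_normcE.
split.
  move=> [mr mi]; rewrite nE => ioo.
  have i2 : Dintegrable (fun x => complex.Re (f x) ^+ 2 + complex.Im (f x) ^+ 2).
    apply/integrableP; split.
      by apply/measurable_EFinP; apply: measurable_funD; exact: measurable_funX.
    apply: le_lt_trans ioo; apply: ge0_le_integral => //.
    - apply: measurableT_comp => //.
      by apply/measurable_EFinP; apply: measurable_funD; exact: measurable_funX.
    - by apply/measurable_EFinP; apply: measurable_funD; exact: measurable_funX.
    - by move=> x _ /=; rewrite lee_fin ger0_norm// addr_ge0 ?sqr_ge0.
  split; split=> //; apply: le_Dintegrable i2.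
  - exact: measurable_funX.
  - by move=> x _; rewrite ger0_norm ?sqr_ge0// lerDl sqr_ge0.
  - exact: measurable_funX.
  - by move=> x _; rewrite ger0_norm ?sqr_ge0// lerDr sqr_ge0.
move=> [[mr ir] [mi ii]]; split => //; rewrite nE.
by have /integrable_lty := DintegrableD ir ii; apply.
Qed.

Lemma L2D f g : L2 f -> L2 g -> L2 (fun x => f x + g x).
Proof.
move=> /L2E[fr fi] /L2E[gr gi]; apply/L2E.
by split; under eq_fun do rewrite !ReImE; exact: sq_integrableD.
Qed.

Lemma L2N f : L2 f -> L2 (fun x => - f x).
Proof.
move=> /L2E[fr fi]; apply/L2E.
by split; under eq_fun do rewrite !ReImE; exact: sq_integrableN.
Qed.

Lemma L2B f g : L2 f -> L2 g -> L2 (fun x => f x - g x).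
Proof. by move=> hf hg; apply: L2D => //; exact: L2N. Qed.

Lemma L2M k f : cbdd k -> L2 f -> L2 (fun x => k x * f x).
Proof.
move=> [kr ki] /L2E[fr fi]; apply/L2E; split; under eq_fun do rewrite !ReImE.
  by apply: sq_integrableD; [|apply: sq_integrableN]; exact: sq_integrableM.
by apply: sq_integrableD; exact: sq_integrableM.
Qed.

Lemma L2_cbdd k : cbdd k -> L2 k.
Proof. by move=> [kr ki]; apply/L2E; split; exact: sq_integrable_bdd. Qed.

Lemma cbdd_cst z : cbdd (fun=> z).
Proof. by split; exact: bdd_measurable_cst. Qed.

Lemma cbddD f g : cbdd f -> cbdd g -> cbdd (fun x => f x + g x).
Proof.
move=> [fr fi] [gr gi].
by split; under eq_fun do rewrite !ReImE; exact: bdd_measurableD.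
Qed.

Lemma cbddN f : cbdd f -> cbdd (fun x => - f x).
Proof.
move=> [fr fi].
by split; under eq_fun do rewrite !ReImE; exact: bdd_measurableN.
Qed.

Lemma cbddB f g : cbdd f -> cbdd g -> cbdd (fun x => f x - g x).
Proof. by move=> hf hg; apply: cbddD => //; exact: cbddN. Qed.

Lemma cbddM f g : cbdd f -> cbdd g -> cbdd (fun x => f x * g x).
Proof.
move=> [fr fi] [gr gi]; split; under eq_fun do rewrite !ReImE.
  by apply: bdd_measurableB; exact: bdd_measurableM.
by apply: bdd_measurableD; exact: bdd_measurableM.
Qed.

Lemma cbdd_real a : bdd_measurable a -> cbdd (fun x => (a x)%:C).
Proof. by move=> ha; split => //=; exact: bdd_measurable_cst. Qed.

Lemma cbdd_cis (c : R) : cbdd (fun x => cis (c * x)).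
Proof.
split; apply: bdd_continuous => x /=.
  by apply: continuous_comp; [exact: mulrl_continuous|exact: continuous_cos].
by apply: continuous_comp; [exact: mulrl_continuous|exact: continuous_sin].
Qed.

Lemma L2Z z f : L2 f -> L2 (fun x => z * f x).
Proof. by move=> hf; apply: L2M => //; exact: cbdd_cst. Qed.

Lemma L2_0 : L2 (fun=> 0 : R[i]).
Proof. exact: (L2_cbdd (cbdd_cst 0)). Qed.

Lemma ip_Dintegrable f g : L2 f -> L2 g -> Dintegrable (fun x =>
  complex.Re (f x) * complex.Re (g x) + complex.Im (f x) * complex.Im (g x)).
Proof.
move=> /L2E[[? ?] [? ?]] /L2E[[? ?] [? ?]].
by apply: DintegrableD; exact: Dintegrable_mul.
Qed.

Lemma L2sqnormE f : L2 f -> L2sqnorm f = (ip f f)%:E.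
Proof.
move=> hf; rewrite /ip /Rintegral fineK; last first.
  by apply: integrable_fin_num => //; exact: (ip_Dintegrable hf hf).
by apply: eq_integral => x _; rewrite sqr_normcE -!expr2.
Qed.

Lemma ipC f g : ip f g = ip g f.
Proof. by apply: eq_Rintegral => x _; ring. Qed.

Lemma ipDl f g h : L2 f -> L2 g -> L2 h ->
  ip (fun x => f x + g x) h = ip f h + ip g h.
Proof.
move=> hf hg hh; rewrite /ip -RintegralD//; last 2 first.
- exact: ip_Dintegrable.
- exact: ip_Dintegrable.
by apply: eq_Rintegral => x _; rewrite !ReImE; ring.
Qed.

Lemma ipDr f g h : L2 f -> L2 g -> L2 h ->
  ip h (fun x => f x + g x) = ip h f + ip h g.
Proof. by move=> hf hg hh; rewrite ipC ipDl// !(ipC h). Qed.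

Lemma ip_cl (c : R) f g : L2 f -> L2 g -> ip (fun x => c%:C * f x) g = c * ip f g.
Proof.
move=> hf hg; rewrite /ip -RintegralZl//; last exact: ip_Dintegrable.
by apply: eq_Rintegral => x _; rewrite !ReImE /=; ring.
Qed.

Lemma ip_cr (c : R) f g : L2 f -> L2 g -> ip g (fun x => c%:C * f x) = c * ip g f.
Proof. by move=> hf hg; rewrite ipC ip_cl// ipC. Qed.

Lemma eq_ip f f' g g' : {in D, f =1 f'} -> {in D, g =1 g'} -> ip f g = ip f' g'.
Proof. by move=> ff gg; apply: eq_Rintegral => x xD; rewrite ff// gg. Qed.

Lemma ipNl f g : L2 f -> L2 g -> ip (fun x => - f x) g = - ip f g.
Proof.
move=> hf hg; rewrite -mulN1r -ip_cl//; apply: eq_ip => // x _.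
by apply: complex_parts_eq; rewrite !ReImE /=; ring.
Qed.

Lemma ipBl f g h : L2 f -> L2 g -> L2 h ->
  ip (fun x => f x - g x) h = ip f h - ip g h.
Proof. by move=> hf hg hh; rewrite ipDl// ?ipNl//; exact: L2N. Qed.

Lemma ipBr f g h : L2 f -> L2 g -> L2 h ->
  ip h (fun x => f x - g x) = ip h f - ip h g.
Proof. by move=> hf hg hh; rewrite ipC ipBl// !(ipC h). Qed.

Lemma ipM f g k : ip (fun x => k x * f x) g = ip f (fun x => (k x)^*%C * g x).
Proof. by apply: eq_Rintegral => x _; rewrite !ReImE; ring. Qed.

Lemma ip_ge0 f : 0 <= ip f f.
Proof. by apply: Rintegral_ge0 => x _; rewrite -!expr2 addr_ge0 ?sqr_ge0. Qed.

Lemma ip_le f g : L2 f -> L2 g -> `|ip f g| <= (ip f f + ip g g) / 2.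
Proof.
move=> hf hg.
have h1 := ip_ge0 (fun x => f x - g x); have h2 := ip_ge0 (fun x => f x + g x).
move: h1 h2; rewrite ipBl ?ipBr ?ipDl ?ipDr//; try exact: L2B; try exact: L2D.
by rewrite (ipC g f) => h1 h2; rewrite ler_norml; apply/andP; split; lra.
Qed.

Lemma ip_le_scaled (c : R) f g : 0 < c -> L2 f -> L2 g ->
  `|ip f g| <= (c * ip f f + c^-1 * ip g g) / 2.
Proof.
move=> c0 hf hg; pose s := Num.sqrt c.
have s0 : 0 < s by rewrite sqrtr_gt0.
have s2 : s ^+ 2 = c by rewrite sqr_sqrtr// ltW.
have /(_ _ _)/= := @ip_le (fun x => s%:C * f x) (fun x => s^-1%:C * g x).
rewrite !ip_cl ?ip_cr//; try exact: L2Z.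
rewrite mulVKf ?gt_eqF// !mulrA -!expr2 s2 exprVn s2 => h.
exact: h (L2Z _ hf) (L2Z _ hg).
Qed.

Lemma ae_equal_ip f f' g : L2 f -> L2 f' -> L2 g -> ae_equal f f' -> ip f g = ip f' g.
Proof.
move=> hf hf' hg ff; rewrite /ip /Rintegral; congr fine.
apply: ae_eq_integral => //.
- by apply: (@measurable_int _ _ _ mu); exact: (ip_Dintegrable hf hg).
- by apply: (@measurable_int _ _ _ mu); exact: (ip_Dintegrable hf' hg).
by apply: filterS ff => x h Dx; rewrite h.
Qed.

End L2Space.

Section Fourier.
Context {R : realType}.
Implicit Types (f g h k : R -> R[i]) (n m : int) (z w : R[i]).

Local Notation mu := (@lebesgue_measure R).
Local Notation D := (@itv2pi R).

Definition expi n (x : R) : R[i] := cis (n%:~R * x).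

Lemma expiD n m x : expi (n + m) x = expi n x * expi m x.
Proof. by rewrite /expi intrD mulrDl cisD. Qed.

Lemma expi_add n x y : expi n (x + y) = expi n x * expi n y.
Proof. by rewrite /expi mulrDr cisD. Qed.

Lemma expiN n x : (expi n x)^*%C = expi (- n) x.
Proof. by rewrite /expi mulrNz mulNr cisN. Qed.

Lemma expi0x x : expi 0 x = 1.
Proof. by rewrite /expi mul0r cis0. Qed.

Lemma expi_0 n : expi n 0 = 1.
Proof. by rewrite /expi mulr0 cis0. Qed.

Lemma expi_2pi n : expi n (2 * pi) = 1.
Proof. by rewrite /expi cis_2pi_int. Qed.

Lemma expiNM n x : expi (- n) x * expi n x = 1.
Proof. by rewrite -expiD addNr expi0x. Qed.

Lemma expiMN n x : expi n x * expi (- n) x = 1.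
Proof. by rewrite mulrC expiNM. Qed.

Lemma nrm2_expi n x : nrm2 (expi n x) = 1.
Proof. exact: nrm2_cis. Qed.

Lemma cbdd_expi n : cbdd (expi n).
Proof. exact: cbdd_cis. Qed.

Lemma is_derive_sinM (c x : R) : is_derive x 1 (fun y => sin (c * y)) (c * cos (c * x)).
Proof.
have h : is_derive x 1 (fun y : R => c * y) c.
  by apply: is_derive_eq; rewrite /GRing.scale /=; ring.
by apply: is_derive_eq; rewrite /GRing.scale /=; ring.
Qed.

Lemma is_derive_cosM (c x : R) : is_derive x 1 (fun y => cos (c * y)) (- c * sin (c * x)).
Proof.
have h : is_derive x 1 (fun y : R => c * y) c.
  by apply: is_derive_eq; rewrite /GRing.scale /=; ring.
by apply: is_derive_eq; rewrite /GRing.scale /=; ring.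
Qed.

Lemma continuous_sinM (c : R) : continuous (fun y : R => sin (c * y)).
Proof.
move=> x; apply: continuous_comp; [exact: mulrl_continuous|exact: continuous_sin].
Qed.

Lemma continuous_cosM (c : R) : continuous (fun y : R => cos (c * y)).
Proof.
move=> x; apply: continuous_comp; [exact: mulrl_continuous|exact: continuous_cos].
Qed.

Lemma primitive_sinM (c : R) : primitive (fun y => sin (c * y)) (fun y => c * cos (c * y)).
Proof.
apply: primitive_derive; first exact: is_derive_sinM.
by move=> x; apply: continuousM; [exact: cvg_cst|exact: continuous_cosM].
Qed.

Lemma primitive_cosM (c : R) : primitive (fun y => cos (c * y)) (fun y => - c * sin (c * y)).
Proof.
apply: primitive_derive; first exact: is_derive_cosM.
by move=> x; apply: cvgM; [exact: cvg_cst|exact: continuous_sinM].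
Qed.

Lemma integral_expi n : n != 0 -> \int[mu]_(x in D) cos (n%:~R * x) = 0 /\
  \int[mu]_(x in D) sin (n%:~R * x) = 0.
Proof.
move=> n0; have n0' : n%:~R != 0 :> R by rewrite intr_eq0.
have := expi_2pi n; rewrite /expi /cis => -[c2 s2].
split.
  have := primitive_sinM (n%:~R) itv2pi_twopi.
  rewrite s2 mulr0 sin0 add0r RintegralZl//; last first.
    by apply: Dintegrable_bdd; apply: bdd_continuous; exact: continuous_cosM.
  by move/esym/eqP; rewrite mulf_eq0 (negbTE n0') /= => /eqP.
have := primitive_cosM (n%:~R) itv2pi_twopi.
rewrite c2 mulr0 cos0 RintegralZl//; last first.
  by apply: Dintegrable_bdd; apply: bdd_continuous; exact: continuous_sinM.
move/eqP; rewrite -subr_eq0 opprD addrA subrr add0r oppr_eq0 mulf_eq0 oppr_eq0.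
by rewrite (negbTE n0') /= => /eqP.
Qed.

Lemma L2_expi z n : L2 (fun x => z * expi n x).
Proof. by apply: L2_cbdd; apply: cbddM; [exact: cbdd_cst|exact: cbdd_expi]. Qed.

Lemma ip_expi_neq z w n m : n != m ->
  ip (fun x => z * expi n x) (fun x => w * expi m x) = 0.
Proof.
move=> nm; pose u := z * w^*%C.
have nm0 : n - m != 0 by rewrite subr_eq0.
have [c0 s0] := integral_expi nm0.
transitivity (\int[mu]_(x in D) (complex.Re u * cos ((n - m)%:~R * x)
   - complex.Im u * sin ((n - m)%:~R * x))).
  apply: eq_Rintegral => x _.
  have -> : complex.Re (z * expi n x) * complex.Re (w * expi m x) +
    complex.Im (z * expi n x) * complex.Im (w * expi m x) =
    complex.Re ((z * expi n x) * (w * expi m x)^*%C) by rewrite !ReImE; ring.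
  have -> : (z * expi n x) * (w * expi m x)^*%C = u * expi (n - m) x.
    by rewrite expiD -expiN /u rmorphM /=; ring.
  by rewrite Re_mul.
rewrite RintegralB//; last 2 first.
- apply: Dintegrable_bdd; apply: bdd_measurableM; first exact: bdd_measurable_cst.
  by apply: bdd_continuous; exact: continuous_cosM.
- apply: Dintegrable_bdd; apply: bdd_measurableM; first exact: bdd_measurable_cst.
  by apply: bdd_continuous; exact: continuous_sinM.
rewrite !RintegralZl//; last 2 first.
- by apply: Dintegrable_bdd; apply: bdd_continuous; exact: continuous_sinM.
- by apply: Dintegrable_bdd; apply: bdd_continuous; exact: continuous_cosM.
by rewrite c0 s0 !mulr0 subr0.
Qed.

Lemma ip_expi_eq z n : ip (fun x => z * expi n x) (fun x => z * expi n x) = 2 * pi * nrm2 z.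
Proof.
have -> : 2 * pi = fine (mu D) by rewrite [X in fine X]mu_itv2pi.
rewrite mulrC -(Rintegral_cst mu)//; apply: eq_Rintegral => x _.
by rewrite -!expr2 -/(nrm2 _) nrm2M nrm2_expi mulr1.
Qed.

Definition coef2 f n : R := ip f (expi n) ^+ 2 + ip f (fun x => 'i%C * expi n x) ^+ 2.

Lemma coef2_ge0 f n : 0 <= coef2 f n.
Proof. by rewrite addr_ge0 ?sqr_ge0. Qed.

Lemma ip_expiE f z n : L2 f -> ip f (fun x => z * expi n x) =
  complex.Re z * ip f (expi n) + complex.Im z * ip f (fun x => 'i%C * expi n x).
Proof.
move=> hf.
have he : L2 (expi n) by apply: L2_cbdd; exact: cbdd_expi.
rewrite -ip_cr// -ip_cr//; last exact: L2_expi.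
rewrite -ipDr//; last 2 first.
- exact: L2Z.
- exact/L2Z/L2_expi.
by apply: eq_ip => // x _; apply: complex_parts_eq; rewrite !ReImE /=; ring.
Qed.

Lemma ip_expi_sqr f z n : L2 f ->
  ip f (fun x => z * expi n x) ^+ 2 <= nrm2 z * coef2 f n.
Proof.
move=> hf; rewrite ip_expiE// /nrm2 /coef2.
set a := ip f _; set b := ip f _.
rewrite -subr_ge0 [X in 0 <= X](_ : _ = (complex.Re z * b - complex.Im z * a) ^+ 2).
  exact: sqr_ge0.
ring.
Qed.

Lemma bessel_seq f (s : seq int) : L2 f -> uniq s ->
  \sum_(n <- s) coef2 f n <= 2 * pi * ip f f.
Proof.
elim: s f => [|n s IH] f hf /=.
  by rewrite big_nil mulr_ge0 ?ip_ge0// ltW ?twopi_gt0.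
move=> /andP[ns us]; rewrite big_cons.
pose z : R[i] := ((2 * pi)^-1 * ip f (expi n)) +i* ((2 * pi)^-1 * ip f (fun x => 'i%C * expi n x)).
have hz := L2_expi z n.
have hg : L2 (fun x => f x - z * expi n x) by exact: L2B.
have := IH _ hg us.
rewrite (eq_big_seq (coef2 f)); last first.
  move=> m ms; have nm : n != m by apply: contraNneq ns => ->.
  rewrite /coef2 !ipBl//; [|exact: L2_expi|by apply: L2_cbdd; exact: cbdd_expi].
  rewrite ip_expi_neq//.
  have -> : ip (fun x : R => z * expi n x) (expi m) = 0.
    rewrite -(ip_expi_neq z 1 nm); apply: eq_ip => // x _; by rewrite mul1r.
  by rewrite !subr0.
rewrite !ipBl ?ipBr// ip_expi_eq (ipC _ f) ip_expiE// /z /nrm2 /coef2 /=.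
set a := ip f (expi n); set b := ip f (fun x => 'i%C * expi n x) => h.
have p0 := @twopi_gt0 R; set t := 2 * pi in h p0 *.
have tV : t * t^-1 = 1 by rewrite mulfV ?gt_eqF.
suff -> : t * ip f f = t * (ip f f - (t^-1 * a * a + t^-1 * b * b) -
  (t^-1 * a * a + t^-1 * b * b - t * ((t^-1 * a) ^+ 2 + (t^-1 * b) ^+ 2)))
   + (a ^+ 2 + b ^+ 2) by lra.
by field; rewrite gt_eqF.
Qed.

End Fourier.

Section ComplexPrimitive.
Context {R : realType}.
Implicit Types (f g F K k : R -> R[i]) (n m : int) (z w : R[i]).

Local Notation mu := (@lebesgue_measure R).
Local Notation D := (@itv2pi R).

Definition cprimitive F f := primitive (fun x => complex.Re (F x)) (fun x => complex.Re (f x)) /\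
  primitive (fun x => complex.Im (F x)) (fun x => complex.Im (f x)).

Lemma cprimitive_is_primitive F f : cprimitive F f -> is_primitive F f.
Proof.
move=> [Fr Fi] x; rewrite inE => Dx; apply: complex_parts_eq; rewrite !ReImE /=.
  exact: Fr.
exact: Fi.
Qed.

Lemma cbdd_cprimitive F f : cprimitive F f -> cbdd f -> cbdd F.
Proof. by move=> [Fr Fi] [fr fi]; split; [exact: bdd_primitive fr|exact: bdd_primitive fi]. Qed.

Lemma eq_cprimitive F f K k : {in D, F =1 K} -> {in D, f =1 k} ->
  cprimitive F f -> cprimitive K k.
Proof.
move=> FK fk [Fr Fi].
by split; [apply: eq_primitive Fr|apply: eq_primitive Fi] => x xD; rewrite ?FK ?fk.
Qed.

Lemma cprimitive_cst z : cprimitive (fun=> z) (fun=> 0).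
Proof. by split; exact: primitive_cst. Qed.

Lemma cprimitive_cintegral f : cprimitive (fun x => cintegral `[0, x] f) f.
Proof.
split; [have := primitive_integral (fun x => complex.Re (f x)) 0
       |have := primitive_integral (fun x => complex.Im (f x)) 0];
  by apply: eq_primitive => // x _; rewrite add0r.
Qed.

Lemma cprimitiveD F f K k : cprimitive F f -> cprimitive K k -> cbdd f -> cbdd k ->
  cprimitive (fun x => F x + K x) (fun x => f x + k x).
Proof.
move=> [Fr Fi] [Kr Ki] [fr fi] [kr ki].
by split; [have := primitiveD Fr Kr fr kr|have := primitiveD Fi Ki fi ki];
  apply: eq_primitive => x _; rewrite !ReImE.
Qed.

Lemma cprimitiveM F f K k : cprimitive F f -> cprimitive K k -> cbdd f -> cbdd k ->
  cprimitive (fun x => F x * K x) (fun x => f x * K x + F x * k x).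
Proof.
move=> [Fr Fi] [Kr Ki] [fr fi] [kr ki].
have hFr := bdd_primitive Fr fr; have hFi := bdd_primitive Fi fi.
have hKr := bdd_primitive Kr kr; have hKi := bdd_primitive Ki ki.
have hb (a b c d : R -> R) : bdd_measurable a -> bdd_measurable b ->
  bdd_measurable c -> bdd_measurable d -> bdd_measurable (fun x => a x * b x + c x * d x).
  by move=> ????; apply: bdd_measurableD; exact: bdd_measurableM.
split.
  have := primitiveB (primitiveM Fr Kr fr kr) (primitiveM Fi Ki fi ki)
    (hb _ _ _ _ fr hKr hFr kr) (hb _ _ _ _ fi hKi hFi ki).
  by apply: eq_primitive => x _; rewrite !ReImE //; ring.
have := primitiveD (primitiveM Fr Ki fr ki) (primitiveM Fi Kr fi kr)
    (hb _ _ _ _ fr hKi hFr ki) (hb _ _ _ _ fi hKr hFi kr).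
by apply: eq_primitive => x _; rewrite !ReImE //; ring.
Qed.

Lemma cprimitiveZ z F f : cprimitive F f -> cbdd f ->
  cprimitive (fun x => z * F x) (fun x => z * f x).
Proof.
move=> Ff hf; have := cprimitiveM (cprimitive_cst z) Ff (cbdd_cst 0) hf.
by apply: eq_cprimitive => x _ //; rewrite mul0r add0r.
Qed.

Lemma cprimitiveB F f K k : cprimitive F f -> cprimitive K k -> cbdd f -> cbdd k ->
  cprimitive (fun x => F x - K x) (fun x => f x - k x).
Proof.
move=> Ff Kk hf hk.
have := cprimitiveD Ff (cprimitiveZ (-1) Kk hk) hf (cbddM (cbdd_cst (-1)) hk).
by apply: eq_cprimitive => x _; rewrite mulN1r.
Qed.

Lemma cbddZ z k : cbdd k -> cbdd (fun x => z * k x).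
Proof. by move=> hk; apply: cbddM => //; exact: cbdd_cst. Qed.

Lemma cprimitive_expi n : cprimitive (expi n) (fun x => ('i%C * n%:~R) * expi n x).
Proof.
have nE : (n%:~R : R[i]) = (n%:~R : R)%:C by rewrite rmorph_int.
split.
  have := @primitive_cosM R n%:~R.
  by apply: eq_primitive => x _ //; rewrite nE !ReImE /=; ring.
have := @primitive_sinM R n%:~R.
by apply: eq_primitive => x _ //; rewrite nE !ReImE /=; ring.
Qed.

Lemma cprimitive_id : cprimitive (fun x => x%:C) (fun=> 1).
Proof.
split => /=; last exact: primitive_cst.
have c1 : continuous (fun _ : R => 1 : R) by move=> x; exact: cvg_cst.
exact: (@primitive_derive R id (fun=> 1) (fun x => is_derive_id x 1) c1).
Qed.

Lemma mul_ii : 'i%C * 'i%C = -1 :> R[i].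
Proof. by apply: complex_parts_eq; rewrite !ReImE /=; ring. Qed.

End ComplexPrimitive.

Section ApproximateEigenfunctions.
Context {R : realType}.
Variable V : R -> R.
Hypothesis V_bdd : bdd_measurable V.
Implicit Types (f g F K k : R -> R[i]) (n m : int) (z w : R[i]).

Local Notation mu := (@lebesgue_measure R).
Local Notation D := (@itv2pi R).

Definition osc x : R := V x - mean V.
Definition osc_prim x : R := \int[mu]_(t in `[0, x]) osc t.
Definition osc_hat n x : R[i] := cintegral `[0, x] (fun t => (osc t)%:C * expi (n + n) t).
Definition res_coef n : R[i] := ((2 * pi)^-1)%:C * osc_hat n (2 * pi).

Let in2 n : R[i] := 2 * ('i%C * n%:~R).

(* The forcing term without its resonant modes e_n and e_{-n}, for which
   - y'' - n^2 y = forcing n  has a periodic solution, namely corr n below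
   (variation of constants). *)
Definition forcing n x : R[i] := (osc x)%:C * expi n x - res_coef n * expi (- n) x.

Definition modeA n x : R[i] :=
  (osc_prim x)%:C - res_coef n * (- (in2 n)^-1 * (expi (- (n + n)) x - 1)).
Definition modeB n x : R[i] := osc_hat n x - res_coef n * x%:C.
Definition corr n x : R[i] :=
  - (in2 n)^-1 * (expi n x * modeA n x - expi (- n) x * modeB n x).
Definition quasimode n x : R[i] := expi n x - corr n x.
Definition dquasimode n x : R[i] := 'i%C * n%:~R * expi n x +
  2^-1 * (expi n x * modeA n x + expi (- n) x * modeB n x).
Definition d2quasimode n x : R[i] := - (n%:~R * n%:~R) * quasimode n x + forcing n x.
Definition remainder n x : R[i] := res_coef n * expi (- n) x - (osc x)%:C * corr n x.
Definition freq n : R := n%:~R ^+ 2 + mean V.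

Lemma osc_bdd : bdd_measurable osc.
Proof. by apply: bdd_measurableB => //; exact: bdd_measurable_cst. Qed.

Lemma osc_cbdd : cbdd (fun x => (osc x)%:C).
Proof. exact: cbdd_real osc_bdd. Qed.

Lemma forcing_cbdd n : cbdd (forcing n).
Proof.
apply: cbddB; first exact: cbddM osc_cbdd (cbdd_expi n).
exact: cbddZ (cbdd_expi _).
Qed.

Lemma osc_prim_primitive : primitive osc_prim osc.
Proof.
have := primitive_integral osc 0.
by apply: eq_primitive => // x _; rewrite add0r.
Qed.

Lemma osc_prim_bdd : bdd_measurable osc_prim.
Proof. exact: bdd_primitive osc_prim_primitive osc_bdd. Qed.

Lemma osc_expi_cbdd n : cbdd (fun t => (osc t)%:C * expi (n + n) t).
Proof. exact: cbddM osc_cbdd (cbdd_expi _). Qed.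

Lemma osc_hat_cbdd n : cbdd (osc_hat n).
Proof. exact: cbdd_cprimitive (cprimitive_cintegral _) (osc_expi_cbdd n). Qed.

Lemma in2_neq0 n : n != 0 -> in2 n != 0.
Proof.
move=> n0; rewrite !mulf_neq0 ?intr_eq0 ?pnatr_eq0//.
by rewrite eq_complex /= eqxx oner_eq0.
Qed.

Lemma modeA_primitive n : n != 0 ->
  cprimitive (modeA n) (fun x => expi (- n) x * forcing n x).
Proof.
move=> n0; have i0 := in2_neq0 n0.
have Q : cprimitive (fun x => (osc_prim x)%:C) (fun x => (osc x)%:C).
  by split => /=; [exact: osc_prim_primitive|exact: primitive_cst].
have e := cprimitive_expi (R := R) (- (n + n)).
have he : cbdd (fun x : R => 'i%C * (- (n + n))%:~R * expi (- (n + n)) x).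
  exact: cbddZ (cbdd_expi _).
have q := cprimitiveZ (res_coef n * - (in2 n)^-1) (cprimitiveB e (cprimitive_cst 1) he (cbdd_cst 0))
  (cbddB he (cbdd_cst 0)).
have := cprimitiveB Q q osc_cbdd (cbddZ _ (cbddB he (cbdd_cst 0))).
apply: eq_cprimitive => x _; first by rewrite /modeA mulrA.
have -> : expi (- n) x * forcing n x = (osc x)%:C * (expi (- n) x * expi n x) -
  res_coef n * (expi (- n) x * expi (- n) x) by rewrite /forcing; ring.
rewrite expiNM mulr1 -expiD -opprD subr0.
have -> : 'i%C * (- (n + n))%:~R = - in2 n by rewrite mulrNz intrD /in2; ring.
by field.
Qed.

Lemma modeB_primitive n : cprimitive (modeB n) (fun x => expi n x * forcing n x).
Proof.
have := cprimitiveB (cprimitive_cintegral (fun t => (osc t)%:C * expi (n + n) t))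
  (cprimitiveZ (res_coef n) cprimitive_id (cbdd_cst 1)) (osc_expi_cbdd n)
  (cbddZ _ (cbdd_cst 1)).
apply: eq_cprimitive => x _ //.
rewrite /forcing mulrBr expiD; congr (_ - _); first by ring.
by rewrite mulrCA expiMN.
Qed.

Lemma expi_forcing_cbdd m n : cbdd (fun x => expi m x * forcing n x).
Proof. exact: cbddM (cbdd_expi _) (forcing_cbdd n). Qed.

Lemma modeA_cbdd n : n != 0 -> cbdd (modeA n).
Proof. by move=> n0; apply: cbdd_cprimitive (modeA_primitive n0) (expi_forcing_cbdd _ _). Qed.

Lemma modeB_cbdd n : cbdd (modeB n).
Proof. exact: cbdd_cprimitive (modeB_primitive n) (expi_forcing_cbdd _ _). Qed.

Lemma corr_cbdd n : n != 0 -> cbdd (corr n).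
Proof.
move=> n0; apply: cbddZ; apply: cbddB; apply: cbddM; try exact: cbdd_expi.
  exact: modeA_cbdd.
exact: modeB_cbdd.
Qed.

Lemma quasimode_cbdd n : n != 0 -> cbdd (quasimode n).
Proof. by move=> n0; apply: cbddB; [exact: cbdd_expi|exact: corr_cbdd]. Qed.

Lemma remainder_cbdd n : n != 0 -> cbdd (remainder n).
Proof.
move=> n0; apply: cbddB; first exact: cbddZ (cbdd_expi _).
exact: cbddM osc_cbdd (corr_cbdd n0).
Qed.

Let dA n x : R[i] := 'i%C * n%:~R * expi n x * modeA n x + expi n x * (expi (- n) x * forcing n x).
Let dB n x : R[i] := 'i%C * (- n)%:~R * expi (- n) x * modeB n x + expi (- n) x * (expi n x * forcing n x).

Let dA_cbdd n : n != 0 -> cbdd (dA n).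
Proof.
move=> n0; apply: cbddD.
  exact: cbddM (cbddZ _ (cbdd_expi _)) (modeA_cbdd n0).
exact: cbddM (cbdd_expi _) (expi_forcing_cbdd _ _).
Qed.

Let dB_cbdd n : cbdd (dB n).
Proof.
apply: cbddD.
  exact: cbddM (cbddZ _ (cbdd_expi _)) (modeB_cbdd n).
exact: cbddM (cbdd_expi _) (expi_forcing_cbdd _ _).
Qed.

Let eA_primitive n : n != 0 -> cprimitive (fun x => expi n x * modeA n x) (dA n).
Proof.
move=> n0; apply: cprimitiveM (cprimitive_expi n) (modeA_primitive n0) _ _.
  exact: cbddZ (cbdd_expi _).
exact: expi_forcing_cbdd.
Qed.

Let eB_primitive n : cprimitive (fun x => expi (- n) x * modeB n x) (dB n).
Proof.
apply: cprimitiveM (cprimitive_expi (- n)) (modeB_primitive n) _ _.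
  exact: cbddZ (cbdd_expi _).
exact: expi_forcing_cbdd.
Qed.

Lemma quasimode_primitive n : n != 0 -> cprimitive (quasimode n) (dquasimode n).
Proof.
move=> n0; have i0 := in2_neq0 n0.
have he : cbdd (fun x : R => 'i%C * n%:~R * expi n x) by exact: cbddZ (cbdd_expi _).
have hAB := cbddB (dA_cbdd n0) (dB_cbdd n).
have := cprimitiveB (cprimitive_expi n)
  (cprimitiveZ (- (in2 n)^-1) (cprimitiveB (eA_primitive n0) (eB_primitive n) (dA_cbdd n0) (dB_cbdd n)) hAB)
  he (cbddZ _ hAB).
apply: eq_cprimitive => x _ //.
rewrite /dquasimode; congr (_ + _); rewrite mulNr opprK /dA /dB !mulrA expiMN expiNM mulrNz.
have -> : 2^-1 = (in2 n)^-1 * ('i%C * n%:~R).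
  have j0 : 'i%C * n%:~R != 0 :> R[i] by move: i0; rewrite mulf_eq0 => /norP[].
  by rewrite /in2; move: ('i%C * n%:~R) j0 => j j0; field.
by ring.
Qed.

Lemma dquasimode_primitive n : n != 0 -> cprimitive (dquasimode n) (d2quasimode n).
Proof.
move=> n0; have i0 := in2_neq0 n0.
have he : cbdd (fun x : R => 'i%C * n%:~R * expi n x) by exact: cbddZ (cbdd_expi _).
have hAB := cbddD (dA_cbdd n0) (dB_cbdd n).
have := cprimitiveD (cprimitiveZ ('i%C * n%:~R) (cprimitive_expi n) he)
  (cprimitiveZ 2^-1 (cprimitiveD (eA_primitive n0) (eB_primitive n) (dA_cbdd n0) (dB_cbdd n)) hAB)
  (cbddZ _ he) (cbddZ _ hAB).
apply: eq_cprimitive => x _ //.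
rewrite /d2quasimode /quasimode /corr /dA /dB !mulrA expiMN expiNM mulrNz.
set e := expi n x; set e' := expi (- n) x; set A := modeA n x; set B := modeB n x.
have n1 : n%:~R != 0 :> R[i] by rewrite intr_eq0.
have ii := @mul_ii R.
have key : (n%:~R * n%:~R) * (in2 n)^-1 = - (2^-1 * ('i%C * n%:~R)) :> R[i].
  have j0 : 'i%C * n%:~R != 0 :> R[i] by move: i0; rewrite mulf_eq0 => /norP[].
  have -> : n%:~R * n%:~R = - (('i%C * n%:~R) * ('i%C * n%:~R)) :> R[i].
    by rewrite mulrACA ii mulN1r opprK.
  by rewrite /in2; move: ('i%C * n%:~R) j0 => j j0; field.
have -> : 'i%C * n%:~R * 'i%C * n%:~R * e = ('i%C * 'i%C) * (n%:~R * n%:~R) * e by ring.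
rewrite ii.
have -> : - (n%:~R * n%:~R) * (e - - (in2 n)^-1 * (e * A - e' * B)) =
  - (n%:~R * n%:~R) * e - ((n%:~R * n%:~R) * (in2 n)^-1) * (e * A - e' * B) by ring.
by rewrite key; field.
Qed.

Lemma osc_prim_2pi : osc_prim (2 * pi) = 0.
Proof.
rewrite /osc_prim -[X in [set` X]]/(`[0, 2 * pi]) -/(@itv2pi R) RintegralB//; last 2 first.
- exact: Dintegrable_bdd.
- by apply: Dintegrable_bdd; exact: bdd_measurable_cst.
rewrite Rintegral_cst// [X in fine X]mu_itv2pi /mean /=.
by rewrite mulrC mulrA mulfV ?mul1r ?subrr// gt_eqF// twopi_gt0.
Qed.

Lemma modeA_0 n : modeA n 0 = 0.
Proof.
rewrite /modeA expi_0 subrr !mulr0 subr0 /osc_prim set_itv1 Rintegral_set1.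
by apply: complex_parts_eq.
Qed.

Lemma modeA_2pi n : modeA n (2 * pi) = 0.
Proof.
by rewrite /modeA expi_2pi subrr !mulr0 subr0 osc_prim_2pi; apply: complex_parts_eq.
Qed.

Lemma modeB_0 n : modeB n 0 = 0.
Proof.
rewrite /modeB /osc_hat /cintegral set_itv1 !Rintegral_set1.
by apply: complex_parts_eq; rewrite !ReImE /=; ring.
Qed.

Lemma modeB_2pi n : modeB n (2 * pi) = 0.
Proof.
rewrite /modeB /res_coef mulrAC -rmorphM /= mulVf ?gt_eqF ?twopi_gt0//.
by rewrite mul1r subrr.
Qed.

Lemma quasimode_op n : n != 0 -> schrodinger_op V (quasimode n)
  (fun x => (freq n)%:C * quasimode n x + remainder n x).
Proof.
move=> n0; exists (quasimode n), (dquasimode n), (d2quasimode n); split.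
- split.
  + apply: L2_cbdd; apply: cbddD; last exact: forcing_cbdd.
    exact: cbddZ (quasimode_cbdd n0).
  + exact/cprimitive_is_primitive/dquasimode_primitive.
  + exact/cprimitive_is_primitive/quasimode_primitive.
  + by rewrite /quasimode /corr modeA_0 modeB_0 modeA_2pi modeB_2pi expi_0 expi_2pi !mulr0.
  + by rewrite /dquasimode modeA_0 modeB_0 modeA_2pi modeB_2pi expi_0 expi_2pi !mulr0.
- by apply: aeW.
- apply: aeW => x _; rewrite /remainder /d2quasimode /forcing /quasimode /freq /osc.
  rewrite rmorphB rmorphD rmorphXn /= rmorph_int; ring.
Qed.

End ApproximateEigenfunctions.

Section Summability.
Context {R : realType}.
Implicit Types (u f : R -> R[i]) (n m : int) (z w : R[i]).

Local Notation mu := (@lebesgue_measure R).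
Local Notation D := (@itv2pi R).

Definition nonzero_ints (N : nat) : seq int :=
  [seq Posz k.+1 | k <- iota 0 N] ++ [seq Negz k | k <- iota 0 N].

Lemma nonzero_ints_uniq N : uniq (nonzero_ints N).
Proof.
rewrite cat_uniq !map_inj_uniq ?iota_uniq//; last 2 first.
- by move=> x y [].
- by move=> x y [].
rewrite andbT /=; apply/hasPn => x /mapP[k _ ->].
by apply/negP => /mapP[l _].
Qed.

Lemma nonzero_ints_neq0 N n : n \in nonzero_ints N -> n != 0.
Proof. by rewrite mem_cat => /orP[] /mapP[k _ ->]. Qed.

Lemma sum_inv_sqr_le N : \sum_(n <- nonzero_ints N) (n%:~R ^- 2 : R) <= 4.
Proof.
have half : \sum_(k <- iota 0 N) ((k.+1%:R : R) ^- 2) <= 2.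
  case: N => [|N]; first by rewrite big_nil.
  suff h : \sum_(k <- iota 0 N.+1) ((k.+1%:R : R) ^- 2) <= 2 - N.+1%:R^-1.
    by rewrite (le_trans h)// gerBl invr_ge0.
  elim: N => [|N IH]; first by rewrite /= big_seq1 expr1n invr1; lra.
  rewrite -addn1 iotaD big_cat /= big_seq1 add0n.
  rewrite (le_trans (lerD IH (lexx _)))//.
  have a0 : 0 < N.+1%:R :> R by [].
  rewrite natrD -[N.+2%:R]natr1; set a := N.+1%:R in a0 *.
  rewrite -subr_ge0.
  have -> : 2 - (a + 1)^-1 - (2 - a^-1 + (a + 1) ^- 2) = (a * (a + 1) ^+ 2)^-1.
    by field; rewrite !gt_eqF// addr_gt0.
  by rewrite invr_ge0 mulr_ge0 ?sqr_ge0// ltW.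
rewrite big_cat !big_map /=.
have -> : \sum_(k <- iota 0 N) ((Negz k)%:~R ^- 2 : R) = \sum_(k <- iota 0 N) ((k.+1%:R : R) ^- 2).
  by apply: eq_bigr => k _; rewrite NegzE mulrNz sqrrN.
by have := half; lra.
Qed.

Lemma normr_le_sqr (y z : R) : 0 <= z -> y ^+ 2 <= z ^+ 2 -> `|y| <= z.
Proof.
by move=> z0 yz; rewrite -(@ler_pXn2r _ 2) ?nnegrE// real_normK ?num_real.
Qed.

Lemma normr_le_amgm (y a b : R) : 0 <= a -> 0 <= b -> y ^+ 2 <= a * b ->
  `|y| <= (a + b) / 2.
Proof.
move=> a0 b0 yab; apply: normr_le_sqr; first by rewrite divr_ge0// addr_ge0.
rewrite (le_trans yab)// -subr_ge0 (_ : _ - _ = ((a - b) / 2) ^+ 2) ?sqr_ge0//.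
by field.
Qed.

Lemma nrm2D z w : nrm2 (z + w) <= 2 * (nrm2 z + nrm2 w).
Proof.
rewrite /nrm2 !ReImE -subr_ge0.
set a := complex.Re z; set b := complex.Im z; set c := complex.Re w; set d := complex.Im w.
have -> : 2 * (a ^+ 2 + b ^+ 2 + (c ^+ 2 + d ^+ 2)) - ((a + c) ^+ 2 + (b + d) ^+ 2) =
  (a - c) ^+ 2 + (b - d) ^+ 2 by ring.
by rewrite addr_ge0 ?sqr_ge0.
Qed.

Lemma nrm2N z : nrm2 (- z) = nrm2 z.
Proof. by rewrite /nrm2 !ReImE !sqrrN. Qed.

Lemma nrm2B z w : nrm2 (z - w) <= 2 * (nrm2 z + nrm2 w).
Proof. by rewrite -(nrm2N w); exact: nrm2D. Qed.

Lemma nrm2_real (a : R) : nrm2 (a%:C) = a ^+ 2.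
Proof. by rewrite /nrm2 /= expr0n addr0. Qed.

Lemma nrm2V z : nrm2 z^-1 = (nrm2 z)^-1.
Proof.
have [->|z0] := eqVneq z 0; first by rewrite invr0 /nrm2 /= expr0n addr0 invr0.
have h : nrm2 z * nrm2 z^-1 = 1.
  by rewrite -nrm2M mulfV// /nrm2 /= expr1n expr0n addr0.
have n0 : nrm2 z != 0 by apply: contra_eq_neq h => ->; rewrite mul0r eq_sym oner_eq0.
by apply: (mulfI n0); rewrite h mulfV.
Qed.

Lemma nrm2_int n : nrm2 (n%:~R : R[i]) = n%:~R ^+ 2.
Proof.
have -> : (n%:~R : R[i]) = (n%:~R : R)%:C by rewrite rmorph_int.
exact: nrm2_real.
Qed.

Lemma nrm2_i : nrm2 ('i%C : R[i]) = 1.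
Proof. by rewrite /nrm2 /= expr1n expr0n add0r. Qed.

Lemma nrm2_measurable f : cbdd f -> bdd_measurable (fun x => nrm2 (f x)).
Proof.
move=> [fr fi]; apply: (@eq_bdd_measurable _ (fun x =>
  complex.Re (f x) * complex.Re (f x) + complex.Im (f x) * complex.Im (f x))).
  by move=> x _; rewrite /nrm2 !expr2.
by apply: bdd_measurableD; exact: bdd_measurableM.
Qed.

Lemma nrm2_Dintegrable u : L2 u -> Dintegrable (fun x => nrm2 (u x)).
Proof. by move=> /L2E[[_ ur] [_ ui]]; exact: DintegrableD. Qed.

Lemma ip_nrm2 u : ip u u = \int[mu]_(x in D) nrm2 (u x).
Proof. by apply: eq_Rintegral => x _; rewrite /nrm2 !expr2. Qed.

Lemma Rintegral_big (s : seq int) (F : int -> R -> R) :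
  (forall n, Dintegrable (F n)) ->
  Dintegrable (fun x => \sum_(n <- s) F n x) /\
  \int[mu]_(x in D) (\sum_(n <- s) F n x) = \sum_(n <- s) \int[mu]_(x in D) F n x.
Proof.
move=> iF; elim: s => [|n s [is_ IH]].
  split.
    under eq_fun do rewrite big_nil.
    by apply: Dintegrable_bdd; exact: bdd_measurable_cst.
  by under eq_Rintegral do rewrite big_nil; rewrite big_nil Rintegral_cst// mul0r.
split.
  by under eq_fun do rewrite big_cons; exact: DintegrableD.
under eq_Rintegral do rewrite big_cons.
rewrite big_cons -IH.
exact: (@RintegralD _ _ R mu D (F n) (fun x => \sum_(j <- s) F j x) measurable_itv2pi (iF n) is_).
Qed.

Lemma ip_mul_real_le (a : R -> R) (K : R) u : bdd_measurable a ->
  (forall x, D x -> `|a x| <= K) -> L2 u ->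
  ip (fun x => (a x)%:C * u x) (fun x => (a x)%:C * u x) <= K ^+ 2 * ip u u.
Proof.
move=> ha aK hu; rewrite !ip_nrm2 -RintegralZl//; last exact: nrm2_Dintegrable.
apply: le_Rintegral => //.
- by apply: nrm2_Dintegrable; apply: L2M => //; exact: cbdd_real.
- exact/DintegrableZ/nrm2_Dintegrable.
- move=> x Dx; rewrite nrm2M nrm2_real ler_wpM2r ?nrm2_ge0//.
  have h := aK x Dx; rewrite -[a x ^+ 2]real_normK ?num_real//.
  by rewrite ler_pXn2r ?nnegrE// (le_trans _ h).
Qed.

(* The integrand t * |u| is weakened to t * (1 + |u|^2): the right-hand side is
   then linear in t, hence in the squared moduli that Bessel's inequality controls. *)
Lemma ip_le_weighted u f (t : R -> R) : L2 u -> cbdd f -> bdd_measurable t ->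
  (forall x, D x -> 0 <= t x) -> (forall x, D x -> nrm2 (f x) <= t x ^+ 2) ->
  `|ip u f| <= \int[mu]_(x in D) (t x * (1 + nrm2 (u x))).
Proof.
move=> hu hf ht t0 ft.
have i1 := ip_Dintegrable hu (L2_cbdd hf).
rewrite (le_trans (le_normr_Rintegral _ i1))//; apply: le_Rintegral => //.
- exact: Dintegrable_norm.
- apply: DintegrableMbdd => //; apply: DintegrableD; last exact: nrm2_Dintegrable.
  by apply: Dintegrable_bdd; exact: bdd_measurable_cst.
- move=> x Dx; have u0 := nrm2_ge0 (u x); apply: normr_le_sqr.
    by rewrite mulr_ge0 ?t0// addr_ge0.
  apply: (@le_trans _ _ (nrm2 (u x) * nrm2 (f x))).
    rewrite -subr_ge0 [X in 0 <= X](_ : _ = (complex.Re (u x) * complex.Im (f x)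
     - complex.Im (u x) * complex.Re (f x)) ^+ 2) ?sqr_ge0// /nrm2; ring.
  rewrite (le_trans (ler_wpM2l u0 (ft x Dx)))// exprMn mulrC ler_wpM2l ?sqr_ge0//.
  nra.
Qed.

Lemma ip_expi_sqr_le u z n (a : R) : L2 u -> nrm2 z <= a ->
  `|ip u (fun x => z * expi n x)| <= (a + coef2 u n) / 2.
Proof.
move=> hu za; apply: normr_le_amgm.
- exact: le_trans (nrm2_ge0 z) za.
- exact: coef2_ge0.
- by rewrite (le_trans (ip_expi_sqr _ _ hu))// ler_wpM2r// coef2_ge0.
Qed.

End Summability.

Section QuasimodeBounds.
Context {R : realType}.
Variable V : R -> R.
Hypothesis V_bdd : bdd_measurable V.
Implicit Types (u f : R -> R[i]) (n m : int) (z w : R[i]).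

Local Notation mu := (@lebesgue_measure R).
Local Notation D := (@itv2pi R).
Local Notation osc := (osc V).
Local Notation osc_prim := (osc_prim V).
Local Notation osc_hat := (osc_hat V).
Local Notation res_coef := (res_coef V).
Local Notation corr := (corr V).
Local Notation remainder := (remainder V).

Let chop (x : R) : R -> R := (\1_(`[0, x]%classic) : R -> R) \* osc.

Lemma chop_bdd x : bdd_measurable (chop x).
Proof.
apply: bdd_measurableM; last exact: osc_bdd.
split; first by apply: measurable_funTS; exact: measurable_indic.
by exists 1 => t _; rewrite indicE; case: (_ \in _); rewrite ?normr1 ?normr0.
Qed.

Lemma osc_hat_coef2 n x : D x ->
  nrm2 (osc_hat n x) = coef2 (fun t => (chop x t)%:C) (n + n).
Proof.
move=> /in_itv2pi/andP[x0 x2].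
have cut (a : R -> R) :
    \int[mu]_(t in `[0, x]) (osc t * a t) = \int[mu]_(t in D) (chop x t * a t).
  have -> : `[0, x]%classic = D `&` `[0, x]%classic.
    by apply/esym/setIidr; exact: itv_sub2pi.
  rewrite Rintegral_mkcondr; apply: eq_Rintegral => t _.
  rewrite /chop /= patchE indicE; case: (_ \in _); by rewrite ?mul1r ?mul0r.
rewrite /nrm2 /coef2 /osc_hat /cintegral; congr (_ ^+ 2 + _).
  under eq_Rintegral do rewrite !ReImE /= mul0r subr0.
  by rewrite cut; apply: eq_Rintegral => t _; rewrite /= mul0r addr0.
transitivity ((\int[mu]_(t in `[0, x]) (osc t * sin ((n + n)%:~R * t))) ^+ 2).
  by congr (_ ^+ 2); apply: eq_Rintegral => t _; rewrite !ReImE /= mul0r addr0.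
rewrite cut -[LHS]sqrrN -mulN1r -RintegralZl//; last first.
  apply: Dintegrable_bdd; apply: bdd_measurableM; first exact: chop_bdd.
  by have [] := cbdd_expi (R := R) (n + n).
by congr (_ ^+ 2); apply: eq_Rintegral => t _; rewrite !ReImE /=; ring.
Qed.

Lemma osc_hat_bessel : exists2 C : R, 0 <= C & forall x, D x -> forall N,
  \sum_(n <- nonzero_ints N) nrm2 (osc_hat n x) <= C.
Proof.
have [mo [M oM]] := osc_bdd V_bdd.
have M0 : 0 <= M by rewrite (le_trans _ (oM _ itv2pi0)).
exists (2 * pi * (M ^+ 2 * (2 * pi))).
  by rewrite !mulr_ge0 ?sqr_ge0// ltW ?pi_gt0.
move=> x Dx N; under eq_bigr do rewrite osc_hat_coef2//.
have hc : L2 (fun t => (chop x t)%:C) by apply: L2_cbdd; apply: cbdd_real; exact: chop_bdd.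
rewrite -(big_map (fun n => n + n) xpredT (coef2 _)).
rewrite (le_trans (bessel_seq hc _))//.
  rewrite map_inj_uniq ?nonzero_ints_uniq// => a b.
  by rewrite -!mulr2n => /eqP; rewrite eqr_pMn2r// => /eqP.
rewrite ler_pM2l ?twopi_gt0// ip_nrm2 (le_trans (ler_norm _))//.
apply: Rintegral_bound; first by apply: nrm2_measurable; apply: cbdd_real; exact: chop_bdd.
move=> t Dt; rewrite nrm2_real ger0_norm ?sqr_ge0// -[X in X <= _]real_normK ?num_real//.
rewrite ler_pXn2r ?nnegrE//; rewrite /chop /= normrM indicE.
by case: (_ \in _); rewrite ?normr1 ?normr0 ?mul1r ?mul0r ?oM.
Qed.

Lemma nrm2_res_coef n : nrm2 (res_coef n) = (2 * pi) ^- 2 * nrm2 (osc_hat n (2 * pi)).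
Proof. by rewrite /res_coef nrm2M nrm2_real exprVn. Qed.

Lemma res_coef_bessel : exists2 C : R, 0 <= C & forall N,
  \sum_(n <- nonzero_ints N) nrm2 (res_coef n) <= C.
Proof.
have [C C0 hC] := osc_hat_bessel.
exists ((2 * pi) ^- 2 * C); first by rewrite mulr_ge0 ?invr_ge0 ?sqr_ge0.
move=> N; under eq_bigr do rewrite nrm2_res_coef.
by rewrite -mulr_sumr ler_wpM2l ?invr_ge0 ?sqr_ge0// hC//; exact: itv2pi_twopi.
Qed.

Lemma corr_sum_le : exists2 C : R, 0 <= C & forall u N (g : int -> R[i]), L2 u ->
  (forall n, nrm2 (g n) <= 1) ->
  \sum_(n <- nonzero_ints N) `|ip u (fun x => g n * corr n x)| <= C * (1 + ip u u).
Proof.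
have [mQ [K QK]] := osc_prim_bdd V_bdd.
have [C1 C10 hC1] := osc_hat_bessel; have [C2 C20 hC2] := res_coef_bessel.
pose c : R := 1 + 2 * (2 * pi) ^+ 2.
have c0 : 0 <= c by rewrite addr_ge0// mulr_ge0// sqr_ge0.
pose C3 : R := 4 + c * C2 + C1.
have C30 : 0 <= C3 by rewrite !addr_ge0// mulr_ge0.
pose t n x : R := n%:~R ^- 2 + c * nrm2 (res_coef n) + nrm2 (osc_hat n x).
have t_ge0 n x : 0 <= t n x.
  apply: addr_ge0 (nrm2_ge0 _); apply: addr_ge0 (mulr_ge0 c0 (nrm2_ge0 _)).
  by rewrite invr_ge0 sqr_ge0.
have t_bdd n : bdd_measurable (t n).
  apply: bdd_measurableD; first exact: bdd_measurable_cst.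
  by apply: nrm2_measurable; exact: osc_hat_cbdd.
pose k n : R[i] := - (2 * ('i%C * n%:~R))^-1.
pose F n x : R[i] := corr n x - (osc_prim x)%:C * (k n * expi n x).
have nk n : nrm2 (k n) = n%:~R ^- 2 / 4.
  rewrite /k nrm2N nrm2V !nrm2M nrm2_i nrm2_int mul1r.
  have -> : nrm2 (2 : R[i]) = 4 by rewrite (nrm2_int 2); ring.
  by rewrite invfM mulrC.
have int1 n : n != 0 -> n%:~R ^- 2 <= 1 :> R.
  move=> n0; rewrite invf_le1; last by rewrite exprn_even_gt0//= intr_eq0.
  rewrite -[n%:~R ^+ 2]real_normK ?num_real// exprn_ege1// -intr_norm ler1z.
  by rewrite -gtz0_ge1 normr_gt0.
have F_bdd n : n != 0 -> cbdd (F n).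
  move=> n0; apply: cbddB; first exact: corr_cbdd.
  by apply: cbddM; [apply: cbdd_real; exact: osc_prim_bdd|exact: cbddZ (cbdd_expi _)].
have F_le n x : n != 0 -> D x -> nrm2 (F n x) <= t n x ^+ 2.
  move=> n0 /in_itv2pi/andP[x0 x2].
  have FE : F n x = k n * (- (res_coef n * (k n * (expi (- (n + n)) x - 1)) * expi n x)
     - expi (- n) x * (osc_hat n x - res_coef n * x%:C)).
    by rewrite /F /corr /modeA /modeB -/(k n); ring.
  set p := nrm2 (res_coef n); set P := nrm2 (osc_hat n x).
  have p0 : 0 <= p by exact: nrm2_ge0.
  have P0 : 0 <= P by exact: nrm2_ge0.
  have j0 : 0 <= n%:~R ^- 2 :> R by rewrite invr_ge0 sqr_ge0.
  have b1 : nrm2 (- (res_coef n * (k n * (expi (- (n + n)) x - 1)) * expi n x)) <= p.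
    rewrite nrm2N (nrm2M (_ * _)) nrm2_expi mulr1 nrm2M -/p ler_piMr// nrm2M nk.
    have := nrm2B (expi (- (n + n)) x) 1; rewrite nrm2_expi.
    have -> : nrm2 (1 : R[i]) = 1 by rewrite (nrm2_int 1) expr1n.
    have := nrm2_ge0 (expi (- (n + n)) x - 1); have := int1 n n0.
    set X := nrm2 _; set Y := _ ^- 2; move=> ???.
    have : Y * X <= 1 * 4 by rewrite ler_pM//; lra.
    by lra.
  have b2 : nrm2 (expi (- n) x * (osc_hat n x - res_coef n * x%:C)) <=
      2 * (P + p * (2 * pi) ^+ 2).
    rewrite nrm2M nrm2_expi mul1r (le_trans (nrm2B _ _))// ler_pM2l// lerD2l.
    rewrite nrm2M nrm2_real ler_wpM2l// ler_pXn2r ?nnegrE//.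
    by rewrite ltW// twopi_gt0.
  rewrite FE nrm2M nk.
  apply: (@le_trans _ _ (n%:~R ^- 2 / 4 * (2 * (p + 2 * (P + p * (2 * pi) ^+ 2))))).
    rewrite ler_wpM2l ?divr_ge0// (le_trans (nrm2B _ _))// ler_pM2l//.
    exact: lerD.
  rewrite /t -/p -/P /c; move: j0; set j := _ ^- 2 => j0.
  have s0 : 0 <= (2 * pi) ^+ 2 :> R by exact: sqr_ge0.
  set s := (2 * pi) ^+ 2 in s0 *.
  have h1 : 0 <= j * p by exact: mulr_ge0.
  have h2 : 0 <= j * P by exact: mulr_ge0.
  have h3 : 0 <= j * (p * s) by exact: mulr_ge0 j0 (mulr_ge0 p0 s0).
  clearbody p P j s.
  have h4 : 0 <= (j + (1 + 2 * s) * p + P) ^+ 2 - 2 * j * ((1 + 2 * s) * p + P).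
    have -> : (j + (1 + 2 * s) * p + P) ^+ 2 - 2 * j * ((1 + 2 * s) * p + P) =
      j ^+ 2 + ((1 + 2 * s) * p + P) ^+ 2 by ring.
    by rewrite addr_ge0 ?sqr_ge0.
  rewrite -subr_ge0.
  have -> : (j + (1 + 2 * s) * p + P) ^+ 2 - j / 4 * (2 * (p + 2 * (P + p * s))) =
    ((j + (1 + 2 * s) * p + P) ^+ 2 - 2 * j * ((1 + 2 * s) * p + P)) +
    ((3 / 2) * (j * p) + j * P + 3 * (j * (p * s))) by field.
  by rewrite addr_ge0// !addr_ge0// mulr_ge0.
exists (4 + 2 * pi * K ^+ 2 + C3 * (2 * pi + 1)).
  have p0 := ltW (@twopi_gt0 R).
  apply: addr_ge0; first by apply: addr_ge0 => //; exact: mulr_ge0 p0 (sqr_ge0 K).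
  by apply: mulr_ge0 => //; exact: addr_ge0.
move=> u N g hu hg.
have hQu : L2 (fun x => (osc_prim x)%:C * u x).
  by apply: L2M => //; apply: cbdd_real; exact: osc_prim_bdd.
have term n : n != 0 -> `|ip u (fun x => g n * corr n x)| <=
   (n%:~R ^- 2 + coef2 (fun x => (osc_prim x)%:C * u x) n) / 2 +
   \int[mu]_(x in D) (t n x * (1 + nrm2 (u x))).
  move=> n0.
  have -> : ip u (fun x => g n * corr n x) =
      ip (fun x => (osc_prim x)%:C * u x) (fun x => (g n * k n) * expi n x) +
      ip u (fun x => g n * F n x).
    have -> : ip (fun x => (osc_prim x)%:C * u x) (fun x => (g n * k n) * expi n x) =
      ip u (fun x => (osc_prim x)%:C * ((g n * k n) * expi n x)).
      rewrite ipM; apply: eq_ip => // x _; congr (_ * _).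
      by apply: complex_parts_eq; rewrite !ReImE /= ?oppr0.
    rewrite -ipDr//; last 2 first.
    - apply: L2M; first by apply: cbdd_real; exact: osc_prim_bdd.
      exact: L2_expi.
    - by apply/L2Z/L2_cbdd; exact: F_bdd.
    by apply: eq_ip => // x _; rewrite /F; ring.
  rewrite (le_trans (ler_normD _ _))// lerD//.
    apply: ip_expi_sqr_le => //; rewrite nrm2M nk.
    have := hg n; have := nrm2_ge0 (g n).
    have : 0 <= n%:~R ^- 2 :> R by rewrite invr_ge0 sqr_ge0.
    by move=> ???; nra.
  apply: ip_le_weighted => //; first by apply: cbddZ; exact: F_bdd.
  by move=> x Dx; rewrite nrm2M (le_trans _ (F_le n x n0 Dx))// ler_piMl// nrm2_ge0.
apply: (@le_trans _ _ (\sum_(n <- nonzero_ints N)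
   ((n%:~R ^- 2 + coef2 (fun x => (osc_prim x)%:C * u x) n) / 2 +
   \int[mu]_(x in D) (t n x * (1 + nrm2 (u x)))))).
  by rewrite !big_seq; apply: ler_sum => n /nonzero_ints_neq0; exact: term.
have i1u : Dintegrable (fun x => 1 + nrm2 (u x)).
  apply: DintegrableD; last exact: nrm2_Dintegrable.
  by apply: Dintegrable_bdd; exact: bdd_measurable_cst.
have itu n : Dintegrable (fun x => t n x * (1 + nrm2 (u x))) by exact: DintegrableMbdd.
have [isum sumE] := Rintegral_big (nonzero_ints N) itu.
rewrite big_split -sumE /= -mulr_suml big_split /=.
have int_le : \int[mu]_(x in D) (\sum_(n <- nonzero_ints N) t n x * (1 + nrm2 (u x))) <=
   C3 * (2 * pi + ip u u).
  apply: (@le_trans _ _ (\int[mu]_(x in D) (C3 * (1 + nrm2 (u x))))).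
    apply: le_Rintegral => //; first exact: DintegrableZ.
    move=> x Dx; rewrite -mulr_suml ler_wpM2r//.
      exact: addr_ge0 ler01 (nrm2_ge0 _).
    rewrite /t /C3 big_split big_split /= -mulr_sumr.
    apply: lerD (hC1 x Dx N); apply: lerD; first exact: sum_inv_sqr_le.
    exact: ler_wpM2l.
  rewrite RintegralZl// RintegralD//; last 2 first.
  - by apply: Dintegrable_bdd; exact: bdd_measurable_cst.
  - exact: nrm2_Dintegrable.
  by rewrite Rintegral_cst// mul1r [X in fine X]mu_itv2pi ip_nrm2.
have b1 := sum_inv_sqr_le (R := R) N.
have b2 := bessel_seq hQu (nonzero_ints_uniq N).
have b3 := ip_mul_real_le (osc_prim_bdd V_bdd) QK hu.
have p0 := pi_ge0 R; have u0 := ip_ge0 u; have K0 := sqr_ge0 K.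
set S1 := \sum_(n <- _) _ in b1 *; set S2 := \sum_(n <- _) _ in b2 *.
have b4 : 2 * pi * ip (fun x => (osc_prim x)%:C * u x) (fun x => (osc_prim x)%:C * u x) <=
   2 * pi * K ^+ 2 * ip u u by rewrite -[leRHS]mulrA ler_wpM2l// mulr_ge0.
have h1 : 0 <= pi * K ^+ 2 by rewrite mulr_ge0.
have h2 : 0 <= pi * K ^+ 2 * ip u u by rewrite mulr_ge0.
have h3 : 0 <= C3 * pi by rewrite mulr_ge0.
have h4 : 0 <= C3 * pi * ip u u by rewrite mulr_ge0.
rewrite (le_trans (lerD (lexx _) int_le))//.
apply: (@le_trans _ _ ((4 + 2 * pi * K ^+ 2 * ip u u) / 2 + C3 * (2 * pi + ip u u))).
  by rewrite lerD2r ler_wpM2r// lerD// (le_trans b2).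
rewrite -subr_ge0.
have -> : (4 + 2 * pi * K ^+ 2 + C3 * (2 * pi + 1)) * (1 + ip u u) -
   ((4 + 2 * pi * K ^+ 2 * ip u u) / 2 + C3 * (2 * pi + ip u u)) =
   2 + 4 * ip u u + 2 * (pi * K ^+ 2) + pi * K ^+ 2 * ip u u +
   C3 + 2 * (C3 * pi * ip u u) by field.
by rewrite !addr_ge0// mulr_ge0.
Qed.

Lemma remainder_sum_le : exists2 C : R, 0 <= C & forall u N (g : int -> R[i]), L2 u ->
  (forall n, nrm2 (g n) <= 1) ->
  \sum_(n <- nonzero_ints N) `|ip u (fun x => g n * remainder n x)| <= C * (1 + ip u u).
Proof.
have [mo [M oM]] := osc_bdd V_bdd.
have [C1 C10 hC1] := corr_sum_le; have [C2 C20 hC2] := res_coef_bessel.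
exists (C2 + 2 * pi + C1 * (1 + M ^+ 2)).
  have p0 := ltW (@twopi_gt0 R).
  apply: addr_ge0; first exact: addr_ge0.
  by apply: mulr_ge0 => //; apply: addr_ge0 => //; exact: sqr_ge0.
move=> u N g hu hg.
have hW : L2 (fun x => (osc x)%:C * u x).
  by apply: L2M => //; exact: osc_cbdd.
have term n : n != 0 -> `|ip u (fun x => g n * remainder n x)| <=
    (nrm2 (res_coef n) + coef2 u (- n)) / 2 +
    `|ip (fun x => (osc x)%:C * u x) (fun x => g n * corr n x)|.
  move=> n0.
  have -> : ip u (fun x => g n * remainder n x) =
     ip u (fun x => (g n * res_coef n) * expi (- n) x) -
     ip (fun x => (osc x)%:C * u x) (fun x => g n * corr n x).
    have -> : ip (fun x => (osc x)%:C * u x) (fun x => g n * corr n x) =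
       ip u (fun x => (osc x)%:C * (g n * corr n x)).
      rewrite ipM; apply: eq_ip => // x _; congr (_ * _).
      by apply: complex_parts_eq; rewrite !ReImE /= ?oppr0.
    rewrite -ipBr//; last 2 first.
    - exact: L2_expi.
    - apply: L2_cbdd; apply: cbddM; first exact: osc_cbdd.
      by apply: cbddZ; exact: corr_cbdd.
    by apply: eq_ip => // x _; rewrite /remainder; ring.
  rewrite (le_trans (ler_normB _ _))// lerD2r.
  apply: ip_expi_sqr_le => //; rewrite nrm2M ler_piMl ?nrm2_ge0//.
apply: (@le_trans _ _ (\sum_(n <- nonzero_ints N)
   ((nrm2 (res_coef n) + coef2 u (- n)) / 2 +
    `|ip (fun x => (osc x)%:C * u x) (fun x => g n * corr n x)|))).
  by rewrite !big_seq; apply: ler_sum => n /nonzero_ints_neq0; exact: term.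
rewrite big_split /= -mulr_suml big_split /=.
have b1 := hC2 N; have b2 := hC1 _ N g hW hg.
have b3 := ip_mul_real_le (osc_bdd V_bdd) oM hu.
have b4 : \sum_(n <- nonzero_ints N) coef2 u (- n) <= 2 * pi * ip u u.
  rewrite -(big_map (fun n => - n) xpredT (coef2 _)).
  apply: bessel_seq => //; rewrite map_inj_uniq ?nonzero_ints_uniq//.
have p0 := pi_ge0 R; have u0 := ip_ge0 u; have M0 := sqr_ge0 M.
have h1 : 0 <= pi * ip u u by rewrite mulr_ge0.
have h2 : 0 <= C1 * (M ^+ 2) by rewrite mulr_ge0.
have h3 : 0 <= C1 * ip u u by rewrite mulr_ge0.
have h4 : 0 <= C2 * ip u u by rewrite mulr_ge0.
have b5 : C1 * (1 + ip (fun x => (osc x)%:C * u x) (fun x => (osc x)%:C * u x)) <=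
  C1 * (1 + M ^+ 2 * ip u u) by rewrite ler_wpM2l// lerD2l.
rewrite (le_trans (lerD (lexx _) (le_trans b2 b5)))//.
apply: (@le_trans _ _ ((C2 + 2 * pi * ip u u) / 2 + C1 * (1 + M ^+ 2 * ip u u))).
  by rewrite lerD2r ler_wpM2r// lerD.
rewrite -subr_ge0.
have -> : (C2 + 2 * pi + C1 * (1 + M ^+ 2)) * (1 + ip u u) -
  ((C2 + 2 * pi * ip u u) / 2 + C1 * (1 + M ^+ 2 * ip u u)) =
  C2 / 2 + 2 * pi + C1 * M ^+ 2 + C2 * ip u u + pi * ip u u + C1 * ip u u by field.
by rewrite !addr_ge0// ?divr_ge0// mulr_ge0.
Qed.

End QuasimodeBounds.

Section Group.
Context {R : realType}.
Implicit Types (u f g k : R -> R[i]) (n m : int) (z w : R[i]).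

Local Notation mu := (@lebesgue_measure R).
Local Notation D := (@itv2pi R).

Section Unitary.
Variable U : R -> (R -> R[i]) -> (R -> R[i]).
Hypothesis hU : unitary_group U.

Lemma ip_ugroup_norm t f : L2 f -> ip (U t f) (U t f) = ip f f.
Proof.
move=> hf; have := ugroup_isometry hU t hf.
by rewrite !L2sqnormE//; [case|exact: ugroup_L2].
Qed.

Lemma ip_ugroup_lin t z f g k : L2 f -> L2 g -> L2 k ->
  ip (U t (fun x => z * f x + g x)) k = ip (U t f) (fun x => z^*%C * k x) + ip (U t g) k.
Proof.
move=> hf hg hk.
have hUf := ugroup_L2 hU t hf; have hUg := ugroup_L2 hU t hg.
rewrite (ae_equal_ip _ _ hk (ugroup_linear hU t z hf hg)).
- by rewrite ipDl//; [rewrite ipM|exact: L2Z].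
- by apply: ugroup_L2 => //; apply: L2D => //; exact: L2Z.
- by apply: L2D => //; exact: L2Z.
Qed.

Lemma ip_ugroup t f g : L2 f -> L2 g -> ip (U t f) (U t g) = ip f g.
Proof.
move=> hf hg.
have hUf := ugroup_L2 hU t hf; have hUg := ugroup_L2 hU t hg.
have h1f : L2 (fun x => 1 * f x) by exact: L2Z.
have hS : L2 (fun x => 1 * f x + g x) by exact: L2D.
have E1 : ip (fun x => 1 * f x + g x) (fun x => 1 * f x + g x) =
    ip f f + 2 * ip f g + ip g g.
  rewrite (@eq_ip _ _ (fun x => f x + g x) _ (fun x => f x + g x)); last 2 first.
  - by move=> x _; rewrite mul1r.
  - by move=> x _; rewrite mul1r.
  by rewrite ipDl ?ipDr//; [rewrite (ipC g f); ring|exact: L2D].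
have c1 k' : ip k' (U t f) = ip k' (fun x => 1^*%C * U t f x).
  by apply: eq_ip => // x _; rewrite conjc1 mul1r.
have E2 : ip (U t (fun x => 1 * f x + g x)) (U t (fun x => 1 * f x + g x)) =
    ip (U t f) (U t f) + 2 * ip (U t f) (U t g) + ip (U t g) (U t g).
  have hUS := ugroup_L2 hU t hS.
  have cc h : L2 h -> ip h (U t (fun x => 1 * f x + g x)) = ip h (U t f) + ip h (U t g).
    move=> hh; rewrite ipC ip_ugroup_lin// (ipC h (U t f)) (ipC h (U t g)); congr (_ + _).
    by apply: eq_ip => // x _; rewrite conjc1 mul1r.
  set S := U t (fun x => 1 * f x + g x) in hUS cc *.
  rewrite cc// (ipC S (U t f)) (ipC S (U t g)) !cc// (ipC (U t g) (U t f)); ring.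
have := ip_ugroup_norm t hS; rewrite E1 E2 !ip_ugroup_norm//; lra.
Qed.

Lemma ip_ugroup_scale t z f g : L2 f -> L2 g ->
  ip (U t (fun x => z * f x)) g = ip (U t f) (fun x => z^*%C * g x).
Proof.
move=> hf hg; have h0 := @L2_0 R.
have U0 : ip (U t (fun=> 0)) g = 0.
  have := ip_ugroup_lin t 1 h0 h0 hg.
  have -> : (fun x : R => 1 * 0 + 0 : R[i]) = (fun=> 0).
    by apply/funext => x; rewrite mulr0 addr0.
  have -> : ip (U t (fun=> 0)) (fun x => 1^*%C * g x) = ip (U t (fun=> 0)) g.
    by apply: eq_ip => // x _; rewrite conjc1 mul1r.
  by lra.
have := ip_ugroup_lin t z hf h0 hg; rewrite U0 addr0 => <-; congr ip; congr (U t _).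
by apply/funext => x; rewrite addr0.
Qed.

Lemma ip_ugroup_adj t h f g : L2 f -> L2 g ->
  ip (U (h + t) f) g = ip (U t f) (U (- h) g).
Proof.
move=> hf hg; have hUf := ugroup_L2 hU t hf; have hUg := ugroup_L2 hU (- h) hg.
have hUUf := ugroup_L2 hU h hUf; have hUUg := ugroup_L2 hU h hUg.
have hUhf := ugroup_L2 hU (h + t) hf.
rewrite -(ip_ugroup h hUf hUg) (ae_equal_ip hUhf hUUf hg (ugroupD hU h t hf)).
have E : ae_equal (U h (U (- h) g)) g.
  have := ugroupD hU h (- h) hg; rewrite subrr => E1.
  have E0 := ugroup0 hU hg.
  by apply: filterS2 E1 E0 => x h1 h2 Dx; rewrite -h1// h2.
by rewrite [RHS]ipC (ae_equal_ip hUUg hg hUUf E) ipC.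
Qed.

End Unitary.

Section Generator.
Variables (V : R -> R) (U : R -> (R -> R[i]) -> (R -> R[i])).
Hypothesis hU : schrodinger_group V U.

Lemma is_derive_ip_ugroup (t : R) f g k : L2 f -> L2 g -> L2 k -> schrodinger_op V g k ->
  is_derive t 1 (fun s => ip (U s f) g) (ip (U t f) (fun x => 'i%C * k x)).
Proof.
move=> hf hg hk /(proj1 (proj2 hU g k hg hk)) lim0.
have UU := proj1 hU.
have hF := ugroup_L2 UU t hf; set F := U t f in hF *.
pose q (s : R) x : R[i] := 'i%C * (s^-1)%:C * (U s g x - g x) - k x.
have hq s : L2 (q s).
  by apply: L2B => //; apply: L2Z; apply: L2B => //; exact: ugroup_L2.
have quot (h : R) : h != 0 ->
    h^-1 * (ip (U (h + t) f) g - ip F g) = ip F (fun x => 'i%C * q (- h) x) +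
      ip F (fun x => 'i%C * k x).
  move=> h0; rewrite ip_ugroup_adj// -/F.
  have hUg := ugroup_L2 UU (- h) hg.
  rewrite -ipBr// -ip_cr//; last exact: L2B.
  rewrite -ipDr//; last 2 first.
  - exact: L2Z.
  - exact: L2Z.
  apply: eq_ip => // x _; rewrite /q invrN rmorphN /=.
  have -> : 'i%C * ('i%C * - (h^-1)%:C * (U (- h) g x - g x) - k x) + 'i%C * k x =
    - ('i%C * 'i%C) * ((h^-1)%:C * (U (- h) g x - g x)) by ring.
  by rewrite mul_ii opprK mul1r.
have small (e : R) : 0 < e -> exists2 d : R, 0 < d & forall s : R, s != 0 -> `|s| < d ->
    `|ip F (fun x => 'i%C * q s x)| <= e.
  move=> e0; pose c := e / (1 + ip F F).
  have F0 := ip_ge0 F; have c0 : 0 < c by rewrite divr_gt0// ltr_pwDl.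
  have ec0 : 0 < e * c by exact: mulr_gt0.
  have : (fun s => ip (q s) (q s)) @ 0^' --> 0.
    move: lim0; rewrite (_ : (fun s => L2sqnorm _) = (fun s => (ip (q s) (q s))%:E)).
      by move=> /fine_cvgP[].
    by apply/funext => s; exact: (L2sqnormE (hq s)).
  move=> /cvgrPdist_lt/(_ _ ec0); rewrite near_withinE => /nbhs_ballP[d /= d0 hd].
  exists d => // s s0 sd.
  have : ip (q s) (q s) < e * c.
    rewrite -[ltLHS]ger0_norm ?ip_ge0// -normrN -[- _]add0r; apply: hd => //.
    by rewrite /ball /= sub0r normrN.
  have hiq : L2 (fun x => 'i%C * q s x) by exact: L2Z.
  have := ip_le_scaled c0 hF hiq.
  have -> : ip (fun x => 'i%C * q s x) (fun x => 'i%C * q s x) = ip (q s) (q s).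
    by apply: eq_Rintegral => x _; rewrite !ReImE /=; ring.
  move=> /le_trans h1 h2; apply: h1; rewrite ler_pdivrMr//.
  have h3 : c^-1 * ip (q s) (q s) <= e.
    by rewrite mulrC ler_pdivrMr// ltW.
  have h4 : c * ip F F <= e.
    by rewrite /c mulrAC ler_pdivrMr ?ltr_pwDl// ler_pM2l// lerDr.
  by lra.
have main : (fun h => h^-1 *: ((fun s => ip (U s f) g) (h *: 1 + t) - (fun s => ip (U s f) g) t))
    @ 0^' --> ip F (fun x => 'i%C * k x).
  apply/cvgrPdist_le => e e0; have [d d0 hd] := small e e0.
  rewrite near_withinE; apply/nbhs_ballP; exists d => //= h.
  rewrite /ball /= sub0r normrN => hb h0.
  rewrite /GRing.scale /= mulr1 quot// distrC addrK; apply: hd; first by rewrite oppr_eq0.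
  by rewrite normrN.
apply: DeriveDef; first by apply/cvg_ex; exists (ip F (fun x => 'i%C * k x)).
exact/cvg_lim.
Qed.

Lemma is_derive_ip_rotating (t : R) f g r z (l : R) : L2 f -> L2 g -> L2 r ->
  schrodinger_op V g (fun x => l%:C * g x + r x) ->
  is_derive t 1 (fun s => ip (U s f) (fun x => z * cis (- (l * s)) * g x))
    (ip (U t f) (fun x => 'i%C * z * cis (- (l * t)) * r x)).
Proof.
move=> hf hg hr hop; have UU := proj1 hU.
have hk : L2 (fun x => l%:C * g x + r x) by apply: L2D => //; exact: L2Z.
have hzf (w : R[i]) : L2 (fun x => w * f x) by exact: L2Z.
have d1 := is_derive_ip_ugroup t (hzf z^*%C) hg hk hop.
have d2 := is_derive_ip_ugroup t (hzf ('i%C * z^*%C)) hg hk hop.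
have split_rot s (w : R[i]) h : L2 h -> ip (U s f) (fun x => w * cis (- (l * s)) * h x) =
    cos (l * s) * ip (U s (fun x => w^*%C * f x)) h +
    sin (l * s) * ip (U s (fun x => 'i%C * w^*%C * f x)) h.
  move=> hh; have hUf := ugroup_L2 UU s hf.
  rewrite !(ip_ugroup_scale UU)//.
  rewrite -!ip_cr//; [|exact: L2Z|exact: L2Z].
  rewrite -ipDr//; [|exact/L2Z/L2Z|exact/L2Z/L2Z].
  apply: eq_ip => // x _; rewrite /cis cosN sinN.
  by apply: complex_parts_eq; rewrite !ReImE /=; ring.
have -> : (fun s => ip (U s f) (fun x => z * cis (- (l * s)) * g x)) =
  (fun s => cos (l * s) * ip (U s (fun x => z^*%C * f x)) g +
    sin (l * s) * ip (U s (fun x => 'i%C * z^*%C * f x)) g).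
  by apply/funext => s; exact: split_rot.
have c1 := is_derive_cosM l t; have s1 := is_derive_sinM l t.
apply: is_derive_eq; rewrite /GRing.scale /=.
have hUf := ugroup_L2 UU t hf.
have hik : L2 (fun x => 'i%C * (l%:C * g x + r x)) by exact: L2Z.
rewrite !(ip_ugroup_scale UU)//.
have hzg w : L2 (fun x => w * g x) by exact: L2Z.
have hzr w : L2 (fun x => w * r x) by exact: L2Z.
have e1 : ip (U t f) (fun x => z^*%C^*%C * ('i%C * (l%:C * g x + r x))) =
    l * ip (U t f) (fun x => ('i%C * z) * g x) + ip (U t f) (fun x => ('i%C * z) * r x).
  rewrite -ip_cr// -ipDr//; last exact: L2Z.
  by apply: eq_ip => // x _; rewrite conjcK; ring.
have e2 : ip (U t f) (fun x => ('i%C * z^*%C)^*%C * ('i%C * (l%:C * g x + r x))) =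
    l * ip (U t f) (fun x => z * g x) + ip (U t f) (fun x => z * r x).
  rewrite -ip_cr// -ipDr//; last exact: L2Z.
  by apply: eq_ip => // x _; apply: complex_parts_eq; rewrite !ReImE /=; ring.
have e3 : ip (U t f) (fun x => z^*%C^*%C * g x) = ip (U t f) (fun x => z * g x).
  by apply: eq_ip => // x _; rewrite conjcK.
have e4 : ip (U t f) (fun x => ('i%C * z^*%C)^*%C * g x) =
    - ip (U t f) (fun x => ('i%C * z) * g x).
  rewrite -mulN1r -ip_cr//; apply: eq_ip => // x _.
  by apply: complex_parts_eq; rewrite !ReImE /=; ring.
have e5 : ip (U t f) (fun x => 'i%C * z * cis (- (l * t)) * r x) =
    cos (l * t) * ip (U t f) (fun x => ('i%C * z) * r x) +
    sin (l * t) * ip (U t f) (fun x => z * r x).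
  rewrite -!ip_cr// -ipDr//; [|exact: L2Z|exact: L2Z].
  apply: eq_ip => // x _; rewrite /cis cosN sinN.
  by apply: complex_parts_eq; rewrite !ReImE /=; ring.
by rewrite e1 e2 e3 e4 e5; ring.
Qed.

End Generator.

Lemma is_derive_sum_seq (s : seq int) (F dF : int -> R -> R) (t : R) :
  (forall n, n \in s -> is_derive t 1 (F n) (dF n t)) ->
  is_derive t 1 (fun x => \sum_(n <- s) F n x) (\sum_(n <- s) dF n t).
Proof.
elim: s => [|n s IH] h.
  rewrite big_nil (_ : (fun _ => _) = cst 0); first exact: is_derive_cst.
  by apply/funext => x; rewrite big_nil.
rewrite big_cons (_ : (fun _ => _) = F n \+ (fun x => \sum_(m <- s) F m x)); last first.
  by apply/funext => x; rewrite big_cons.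
apply: is_deriveD; first by apply: h; rewrite mem_head.
by apply: IH => m ms; apply: h; rewrite in_cons ms orbT.
Qed.

Lemma is_derive_bound (F dF : R -> R) (C t : R) : 0 <= t ->
  (forall s : R, is_derive s 1 F (dF s)) -> (forall s, `|dF s| <= C) ->
  `|F t - F 0| <= C * t.
Proof.
move=> t0 hF dC.
have cF : continuous F.
  by move=> y; apply: differentiable_continuous; apply/derivable1_diffP; have [] := hF y.
have [c _ ->] := MVT_segment t0 (fun x _ => hF x) (continuous_subspaceT cF).
by rewrite subr0 normrM (ger0_norm t0) ler_wpM2r.
Qed.

Section Smoothing.
Variables (V : R -> R) (U : R -> (R -> R[i]) -> (R -> R[i])).
Hypothesis V_bdd : bdd_measurable V.
Hypothesis hU : schrodinger_group V U.
Variables (f : R -> R[i]) (t0 : R).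
Hypothesis hf : L2 f.
Hypothesis t0_ge0 : 0 <= t0.

Let UU := proj1 hU.

(* The mean value inequality in t is applied to the whole sum over n, whose
   derivative only involves the remainders. *)
Lemma quasimode_flow_le : exists2 C : R, 0 <= C & forall N (g : int -> R[i]),
  (forall n, nrm2 (g n) <= 1) ->
  `|\sum_(n <- nonzero_ints N)
     (ip (U t0 f) (fun x => g n * cis (- (freq V n * t0)) * quasimode V n x) -
      ip f (fun x => g n * quasimode V n x))| <= C.
Proof.
have [C C0 hC] := remainder_sum_le V_bdd.
exists (C * (1 + ip f f) * t0).
  by rewrite !mulr_ge0// addr_ge0// ip_ge0.
move=> N g hg.
pose F n t := ip (U t f) (fun x => g n * cis (- (freq V n * t)) * quasimode V n x).
pose dF n t := ip (U t f) (fun x => 'i%C * g n * cis (- (freq V n * t)) * remainder V n x).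
have dFE (t : R) n : n \in nonzero_ints N -> is_derive t 1 (F n) (dF n t).
  move=> /nonzero_ints_neq0 n0.
  exact: (is_derive_ip_rotating hU t (g n) hf (L2_cbdd (quasimode_cbdd V_bdd n0))
    (L2_cbdd (remainder_cbdd V_bdd n0)) (quasimode_op V_bdd n0)).
have d t := is_derive_sum_seq (dFE t).
have bd t : `|\sum_(n <- nonzero_ints N) dF n t| <= C * (1 + ip f f).
  rewrite (le_trans (ler_norm_sum _ _ _))//.
  rewrite -(ip_ugroup_norm UU t hf).
  have /(_ N)h := hC _ _ (fun n => 'i%C * g n * cis (- (freq V n * t))) (ugroup_L2 UU t hf).
  by apply: h => n; rewrite !nrm2M nrm2_cis nrm2_i mulr1 mul1r.
have := is_derive_bound t0_ge0 d bd.
rewrite -sumrB; congr (`| _ | <= _).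
apply: eq_big_seq => n /nonzero_ints_neq0 n0; congr (_ - _); rewrite /F mulr0 oppr0 cis0.
have hgn : L2 (fun x => g n * 1 * quasimode V n x).
  exact/L2Z/L2_cbdd/quasimode_cbdd.
rewrite (ae_equal_ip (ugroup_L2 UU 0 hf) hf hgn (ugroup0 UU hf)).
by apply: eq_ip => // x _; rewrite mulr1.
Qed.

Lemma fourier_flow_le : exists2 C : R, 0 <= C & forall N (g : int -> R[i]),
  (forall n, nrm2 (g n) <= 1) ->
  `|\sum_(n <- nonzero_ints N)
     (ip (U t0 f) (fun x => g n * expi n x) -
      ip f (fun x => g n * cis (freq V n * t0) * expi n x))| <= C.
Proof.
have [C1 C10 h1] := quasimode_flow_le; have [C2 C20 h2] := corr_sum_le V_bdd.
exists (C1 + C2 * (1 + ip f f) + C2 * (1 + ip f f)).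
  by rewrite !addr_ge0// mulr_ge0// addr_ge0// ip_ge0.
move=> N g hg.
have hUf := ugroup_L2 UU t0 hf.
pose g' n := g n * cis (freq V n * t0).
have hg' n : nrm2 (g' n) <= 1 by rewrite nrm2M nrm2_cis mulr1.
have g'K n : g' n * cis (- (freq V n * t0)) = g n.
  by rewrite /g' -mulrA -cisD subrr cis0 mulr1.
have b1 := h1 N g' hg'; have b2 := h2 _ N g hUf hg; have b3 := h2 _ N g' hf hg'.
rewrite (ip_ugroup_norm UU t0 hf) in b2.
have -> : \sum_(n <- nonzero_ints N) (ip (U t0 f) (fun x => g n * expi n x) -
      ip f (fun x => g n * cis (freq V n * t0) * expi n x)) =
   \sum_(n <- nonzero_ints N) (ip (U t0 f) (fun x => g' n * cis (- (freq V n * t0)) * quasimode V n x) -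
      ip f (fun x => g' n * quasimode V n x)) +
   \sum_(n <- nonzero_ints N) ip (U t0 f) (fun x => g n * corr V n x) -
   \sum_(n <- nonzero_ints N) ip f (fun x => g' n * corr V n x).
  rewrite -big_split -sumrB /=; apply: eq_big_seq => n /nonzero_ints_neq0 n0.
  have hc : L2 (corr V n) by exact/L2_cbdd/corr_cbdd.
  have hq : L2 (quasimode V n) by exact/L2_cbdd/quasimode_cbdd.
  rewrite g'K.
  have sp h z : L2 h -> ip h (fun x => z * expi n x) =
      ip h (fun x => z * quasimode V n x) + ip h (fun x => z * corr V n x).
    move=> hh; rewrite -ipDr//; [|exact: L2Z|exact: L2Z].
    by apply: eq_ip => // x _; rewrite /quasimode; ring.
  by rewrite !sp// -/(g' n); ring.
have b2' := le_trans (ler_norm_sum _ _ _) b2; have b3' := le_trans (ler_norm_sum _ _ _) b3.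
rewrite (le_trans (ler_normB _ _))// lerD// (le_trans (ler_normD _ _))// lerD//.
Qed.

Lemma fourier_flow_sum_le : exists2 C : R, 0 <= C & forall N (g : int -> R[i]),
  (forall n, nrm2 (g n) <= 1) ->
  \sum_(n <- nonzero_ints N)
     `|ip (U t0 f) (fun x => g n * expi n x) -
      ip f (fun x => g n * cis (freq V n * t0) * expi n x)| <= C.
Proof.
have [C C0 hC] := fourier_flow_le; exists C => // N g hg.
have hUf := ugroup_L2 UU t0 hf.
pose d n := ip (U t0 f) (fun x => g n * expi n x) -
  ip f (fun x => g n * cis (freq V n * t0) * expi n x).
pose s n : R := Num.sg (d n).
have := hC N (fun n => (s n)%:C * g n); rewrite (eq_bigr (fun n => `|d n|)); last first.
  move=> n _; rewrite normrEsg -/(s n) /d mulrBr -!ip_cr//; [|exact: L2_expi|exact: L2_expi].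
  by congr (_ - _); apply: eq_ip => // x _; rewrite !mulrA.
move=> h; rewrite (le_trans (ler_norm _))//; apply: h => n.
rewrite nrm2M nrm2_real mulr_ile1 ?nrm2_ge0 ?sqr_ge0//.
by rewrite /s sqr_sg; case: (_ != 0).
Qed.

End Smoothing.
End Group.

Section Translation.
Context {R : realType}.
Implicit Types (f g : R -> R[i]) (n m : int) (a c x y : R).

Local Notation mu := (@lebesgue_measure R).
Local Notation D := (@itv2pi R).

Definition translation c (x : measurableTypeR R) : measurableTypeR R := (x : R) + c.

Lemma measurable_translation c : measurable_fun [set: measurableTypeR R] (translation c).
Proof. by apply: measurable_funD => //; exact: measurable_cst. Qed.

Let translated c : {measure set (measurableTypeR R) -> \bar R} :=
  measure_function_pushforward__canonical__measure_function_Measure mu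
    (measurable_translation c).

Lemma lebesgue_measure_translation c (A : set R) : measurable A ->
  mu A = translated c A.
Proof.
move=> mA; apply: (@lebesgue_measure_unique R (translated c)) => //.
move=> _ [[x y] _ <-]; rewrite /translated /= /pushforward /=.
have -> : translation c @^-1` `]x, y] = `]x - c, y - c]%classic.
  by apply/seteqP; split => z /=; rewrite !in_itv /= /translation ltrBlDr lerBrDr.
rewrite !lebesgue_measure_itv /= !lte_fin ltrD2r; case: ifP => // _.
by rewrite -EFinB -EFinB; congr (_%:E); ring.
Qed.

Lemma ge0_integral_translation c (A : set R) (G : R -> \bar R) : measurable A ->
  measurable_fun [set: R] G -> (forall x, (0 <= G x)%E) ->
  (\int[mu]_(y in A) G y = \int[mu]_(x in translation c @^-1` A) G (translation c x))%E.
Proof.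
move=> mA mG G0.
rewrite (@eq_measure_integral _ (measurableTypeR R) R A (translated c)); last first.
  by move=> B mB _; exact: lebesgue_measure_translation.
have mGA : measurable_fun A G by exact: measurable_funTS.
exact: (ge0_integral_pushforward (measurable_translation c) mu mA mGA).
Qed.

Lemma preimage_translation (b1 b2 : bool) x y c :
  translation c @^-1` [set` Interval (BSide b1 x) (BSide b2 y)] =
  [set` Interval (BSide b1 (x - c)) (BSide b2 (y - c))].
Proof.
apply/seteqP; split => z /=; rewrite !itv_boundlr /= /translation;
by case: b1; case: b2; rewrite !bnd_simp ?lerBlDr ?ltrBlDr ?lerBrDr ?ltrBrDr.
Qed.

Lemma ge0_integral_periodic a (G : R -> \bar R) : 0 <= a <= 2 * pi ->
  measurable_fun [set: R] G -> (forall x, (0 <= G x)%E) ->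
  (forall x, - (2 * pi) <= x < 0 -> G (x + 2 * pi)%R = G x) ->
  (\int[mu]_(x in `[0%R, (2 * pi)%R[) G (x - a)%R = \int[mu]_(x in `[0%R, (2 * pi)%R[) G x)%E.
Proof.
move=> /andP[a0 a2] mG G0 Gp.
have mGs A : measurable_fun A G by exact: measurable_funTS.
have mitv (i : interval R) : measurable [set` i] by exact: measurable_itv.
have -> : (\int[mu]_(x in `[0%R, (2 * pi)%R[) G (x - a)%R =
    \int[mu]_(x in `[(- a)%R, (2 * pi - a)%R[) G x)%E.
  rewrite [RHS](@ge0_integral_translation (- a))// preimage_translation.
  by rewrite opprK addNr subrK.
have splt (x y z : R) : x <= y -> y <= z ->
    (\int[mu]_(t in `[x, z[) G t = \int[mu]_(t in `[x, y[) G t + \int[mu]_(t in `[y, z[) G t)%E.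
  move=> xy yz.
  rewrite (@itv_bndbnd_setU _ _ _ (BLeft y)) ?bnd_simp// ge0_integral_setU//; first exact: mGs.
  apply/disj_setPS => t [/=]; rewrite !in_itv/= => /andP[_ ty] /andP[yt _].
  by move: ty; rewrite ltNge yt.
rewrite (splt _ 0) ?oppr_le0 ?subr_ge0// [RHS](splt _ (2 * pi - a)) ?subr_ge0//; last first.
  by rewrite gerBl.
rewrite addeC; congr (_ + _)%E.
rewrite [RHS](@ge0_integral_translation (2 * pi))// preimage_translation.
have -> : 2 * pi - a - 2 * pi = - a by ring.
rewrite subrr; apply: eq_integral => x; rewrite inE /= in_itv /= => /andP[xa x0].
by rewrite Gp// x0 andbT (le_trans _ xa)// lerN2.
Qed.

Lemma integral_periodic a (G : R -> R) : 0 <= a <= 2 * pi ->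
  measurable_fun [set: R] G ->
  (forall x, - (2 * pi) <= x < 0 -> G (x + 2 * pi) = G x) ->
  (\int[mu]_(x in `[0%R, (2 * pi)%R[) (G (x - a))%:E =
   \int[mu]_(x in `[0%R, (2 * pi)%R[) (G x)%:E)%E.
Proof.
move=> ha mG Gp.
have mE : measurable_fun [set: R] (EFin \o G) by exact/measurable_EFinP.
rewrite [LHS]integralE [RHS]integralE; congr (_ - _)%E.
  have h := @ge0_integral_periodic a (EFin \o G)^\+%E ha (measurable_funepos mE)
    (funepos_ge0 _).
  rewrite -h; last by move=> x hx; rewrite !funeposE /= Gp.
  by apply: eq_integral => x _; rewrite !funeposE.
have h := @ge0_integral_periodic a (EFin \o G)^\-%E ha (measurable_funeneg mE)
  (funeneg_ge0 _).
rewrite -h; last by move=> x hx; rewrite !funenegE /= Gp.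
by apply: eq_integral => x _; rewrite !funenegE.
Qed.

Definition cut f x : R[i] := if 0 <= x < 2 * pi then f x else 0.
(* On [-2pi, 2pi[ this is [periodic_ext f], without the floor function. *)
Definition wrap f x : R[i] := cut f x + cut f (x + 2 * pi).

Lemma wrapE f x : 0 <= x < 2 * pi -> wrap f x = f x.
Proof.
move=> /[dup] hx /andP[x0 x2]; rewrite /wrap /cut hx ifF ?addr0//.
by apply/negbTE; rewrite negb_and -!ltNge -leNgt lerDr x0 orbT.
Qed.

Lemma wrap_periodic f x : - (2 * pi) <= x < 0 -> wrap f (x + 2 * pi) = wrap f x.
Proof.
move=> /andP[x2 x0]; rewrite wrapE; last first.
  by rewrite -ltrBrDr subrr x0 -lerBlDr sub0r x2.
rewrite /wrap /cut ifF ?add0r; last first.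
  by apply/negbTE; rewrite negb_and -ltNge x0.
by rewrite ifT// -ltrBrDr subrr x0 -lerBlDr sub0r x2.
Qed.

Lemma periodic_ext_wrap f x : - (2 * pi) <= x < 2 * pi -> periodic_ext f x = wrap f x.
Proof.
move=> /andP[x1 x2]; have p0 := @twopi_gt0 R.
have [x0|x0] := leP 0 x.
  rewrite /periodic_ext (@floor_def _ _ 0) ?mulr0 ?subr0 ?wrapE ?x0//.
  by rewrite add0r divr_ge0 ?(ltW p0)//= ltr_pdivrMr// mul1r.
rewrite /periodic_ext (@floor_def _ _ (-1)) ?mulrN1 ?opprK.
  rewrite -wrap_periodic ?x1 ?x0// wrapE//.
  by rewrite -ltrBrDr subrr x0 -lerBlDr sub0r x1.
by rewrite addNr ler_pdivlMr// mulN1r x1 ltr_pdivrMr// mul0r.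
Qed.

Lemma measurable_cut f : L2 f ->
  measurable_fun [set: R] (fun x => complex.Re (cut f x)) /\
  measurable_fun [set: R] (fun x => complex.Im (cut f x)).
Proof.
move=> [mr mi _].
have sub : `[0, 2 * pi[%classic `<=` D by move=> x /=; rewrite in_itv/= => /andP[x0 x2]; apply/in_itv2pi; rewrite x0 ltW.
have mI : measurable (`[0, 2 * pi[%classic : set R) by exact: measurable_itv.
split.
  have /(measurable_restrictT _ mI) := measurable_funS measurable_itv2pi sub mr.
  apply: eq_measurable_fun => x _; rewrite /cut patchE.
    have -> : (x \in `[0, 2 * pi[%classic) = (0 <= x < 2 * pi).
    by apply/idP/idP; rewrite inE /= in_itv.
  by case: ifP.
have /(measurable_restrictT _ mI) := measurable_funS measurable_itv2pi sub mi.
apply: eq_measurable_fun => x _; rewrite /cut patchE.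
have -> : (x \in `[0, 2 * pi[%classic) = (0 <= x < 2 * pi).
  by apply/idP/idP; rewrite inE /= in_itv.
by case: ifP.
Qed.

Lemma measurable_wrap f : L2 f ->
  measurable_fun [set: R] (fun x => complex.Re (wrap f x)) /\
  measurable_fun [set: R] (fun x => complex.Im (wrap f x)).
Proof.
move=> /measurable_cut[mr mi].
have mt := @measurable_translation (2 * pi).
split.
  apply: (@eq_measurable_fun _ _ _ _ _ (fun x => complex.Re (cut f x) + complex.Re (cut f (x + 2 * pi)))).
    by move=> x _; rewrite Re_add.
  by apply: measurable_funD => //; exact: (measurableT_comp mr mt).
apply: (@eq_measurable_fun _ _ _ _ _ (fun x => complex.Im (cut f x) + complex.Im (cut f (x + 2 * pi)))).
  by move=> x _; rewrite Im_add.
by apply: measurable_funD => //; exact: (measurableT_comp mi mt).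
Qed.

Lemma ae_itv2pi_co (P : R -> Prop) : (forall x, 0 <= x < 2 * pi -> P x) ->
  {ae mu, forall x, D x -> P x}.
Proof.
move=> hP; exists [set 2 * pi]; split => //; first exact: lebesgue_measure_set1.
move=> x /= /not_implyP[/in_itv2pi/andP[x0 x2] nP].
apply/eqP; rewrite eq_le x2 /= leNgt; apply/negP => x2'; apply: nP; apply: hP.
by rewrite x0.
Qed.

Lemma integral_itv2pi_co (G : R -> R) : measurable_fun D G ->
  (\int[mu]_(x in D) (G x)%:E = \int[mu]_(x in `[0%R, (2 * pi)%R[) (G x)%:E)%E.
Proof.
move=> mG; rewrite /itv2pi -integral_itv_bndo_bndc//.
apply/measurable_EFinP; apply: measurable_funS mG => //.
by move=> x /=; rewrite in_itv/= => /andP[x0 x2]; apply/in_itv2pi; rewrite x0 ltW.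
Qed.

Definition shifted f a x : R[i] := wrap f (x - a).

Lemma shifted_measurable f a : L2 f ->
  measurable_fun D (fun x => complex.Re (shifted f a x)) /\
  measurable_fun D (fun x => complex.Im (shifted f a x)).
Proof.
move=> /measurable_wrap[mr mi]; have mt := @measurable_translation (- a).
by split; apply: measurable_funTS; [exact: (measurableT_comp mr mt)|exact: (measurableT_comp mi mt)].
Qed.

Lemma L2_shifted f a : 0 <= a <= 2 * pi -> L2 f -> L2 (shifted f a).
Proof.
move=> ha hf; have [mr mi] := shifted_measurable a hf; have [wr wi] := measurable_wrap hf.
split=> //.
have E h : L2sqnorm h = (\int[mu]_(x in D) (nrm2 (h x))%:E)%E.
  by apply: eq_integral => x _; rewrite sqr_normcE.
have mn : measurable_fun [set: R] (fun x => nrm2 (wrap f x)).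
  by apply: measurable_funD; exact: measurable_funX.
rewrite E integral_itv2pi_co; last first.
  by apply: measurable_funD; exact: measurable_funX.
rewrite /shifted (@integral_periodic a (fun x => nrm2 (wrap f x)))//; last first.
  by move=> x hx; rewrite wrap_periodic.
case: hf => fr fi; rewrite E integral_itv2pi_co; last first.
  by apply: measurable_funD; exact: measurable_funX.
congr (_ < _)%E; apply: eq_integral => x; rewrite inE /= in_itv/= => hx.
by rewrite wrapE.
Qed.

Lemma ip_shifted f a z n : 0 <= a <= 2 * pi -> L2 f ->
  ip (shifted f a) (fun x => z * expi n x) = ip f (fun x => (z * expi n a) * expi n x).
Proof.
move=> ha hf; have [wr wi] := measurable_wrap hf.
pose w x : R[i] := (z * expi n a) * expi n x.
pose G x := complex.Re (wrap f x) * complex.Re (w x) + complex.Im (wrap f x) * complex.Im (w x).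
have cw : measurable_fun [set: R] (fun x => complex.Re (w x)) /\ measurable_fun [set: R] (fun x => complex.Im (w x)).
  have [mc ms] : measurable_fun [set: R] (fun x => cos (n%:~R * x)) /\
      measurable_fun [set: R] (fun x => sin (n%:~R * x)).
    by split; apply: continuous_measurable_fun; [exact: continuous_cosM|exact: continuous_sinM].
  split.
    apply: (@eq_measurable_fun _ _ _ _ _ (fun x => complex.Re (z * expi n a) * cos (n%:~R * x) -
      complex.Im (z * expi n a) * sin (n%:~R * x))).
      by move=> x _; rewrite /w (Re_mul (z * _)).
    by apply: measurable_funB; apply: measurable_funM => //; exact: measurable_cst.
  apply: (@eq_measurable_fun _ _ _ _ _ (fun x => complex.Re (z * expi n a) * sin (n%:~R * x) +
      complex.Im (z * expi n a) * cos (n%:~R * x))).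
    by move=> x _; rewrite /w (Im_mul (z * _)).
  by apply: measurable_funD; apply: measurable_funM => //; exact: measurable_cst.
have mG : measurable_fun [set: R] G.
  by apply: measurable_funD; apply: measurable_funM => //; case: cw.
have Gp x : - (2 * pi) <= x < 0 -> G (x + 2 * pi) = G x.
  by move=> hx; rewrite /G wrap_periodic// /w expi_add expi_2pi mulr1.
rewrite /ip /Rintegral; congr fine.
have E1 : (\int[mu]_(x in D) (G (x - a))%:E = \int[mu]_(x in D) (G x)%:E)%E.
  rewrite !integral_itv2pi_co; [exact: integral_periodic|exact: measurable_funTS|].
  by apply: measurable_funTS; exact: (measurableT_comp mG (@measurable_translation (- a))).
transitivity (\int[mu]_(x in D) (G (x - a))%:E)%E.
  apply: eq_integral => x _; rewrite /G /shifted /w.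
  suff -> : z * expi n a * expi n (x - a) = z * expi n x by [].
  by rewrite -mulrA -expi_add addrC subrK.
rewrite E1.
apply: ae_eq_integral => //.
- by apply/measurable_EFinP; exact: measurable_funTS.
- by apply: (@measurable_int _ _ _ mu); exact: (ip_Dintegrable hf (L2_expi _ _)).
- by apply: ae_itv2pi_co => x hx; rewrite /G wrapE.
Qed.

End Translation.

Section GaussSum.
Context {R : realType}.
Implicit Types (f g : R -> R[i]) (n m j : int).

Lemma cis_neq1 (t : R) : 0 < t < 2 * pi -> cis t != 1.
Proof.
move=> /andP[t0 t2]; apply/eqP => -[ct st].
have [tp|tp|tp] := ltgtP t pi.
- by have := @sin_gt0_pi R t; rewrite t0 tp st ltxx => /(_ isT).
- have : 0 < sin (t - pi) by apply: sin_gt0_pi; rewrite subr_gt0 tp ltrBlDr -mulr2n -mulr_natl t2.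
  by rewrite sinB st cospi sinpi mul0r mulr0 subrr ltxx.
- by move: ct; rewrite tp cospi => /eqP; rewrite eqNr oner_eq0.
Qed.

Lemma cis_mulrn (t : R) k : cis (t * k%:R) = cis t ^+ k.
Proof.
elim: k => [|k IH]; first by rewrite mulr0 cis0 expr0.
by rewrite -natr1 mulrDr mulr1 cisD IH exprSr.
Qed.

Lemma sum_cis_roots r j : (0 < r)%N ->
  \sum_(k < r) cis (2 * pi * (j%:~R * k%:R / r%:R) : R) = if (r %| j)%Z then r%:R else 0.
Proof.
move=> r0; have rR : r%:R != 0 :> R by rewrite pnatr_eq0 -lt0n.
pose t : R := 2 * pi * (j%:~R / r%:R).
have -> : \sum_(k < r) cis (2 * pi * (j%:~R * k%:R / r%:R) : R) = \sum_(k < r) cis t ^+ k.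
  by apply: eq_bigr => k _; rewrite -cis_mulrn /t; congr cis; field.
have tj : cis t ^+ r = 1.
  by rewrite -cis_mulrn /t -(@cis_2pi_int R j); congr cis; field.
case: ifPn => [/dvdzP[l jE]|nd].
  have -> : cis t = 1.
    by rewrite -(@cis_2pi_int R l) /t jE intrM; congr cis; field.
  by under eq_bigr do rewrite expr1n; rewrite sumr_const card_ord.
have z1 : cis t - 1 != 0.
  rewrite subr_eq0.
  have := divz_eq j r; have := ltz_pmod j (d := r);
  have := modz_ge0 j (_ : r%:Z != 0); rewrite eqz_nat -lt0n => /(_ r0).
  have jn0 : (j %% r)%Z != 0 by apply/eqP => /dvdz_mod0P h; rewrite h in nd.
  case: (j %% r)%Z jn0 => // k; rewrite eqz_nat -lt0n => k0 _ /(_ r0) kr jE.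
  have -> : cis t = cis (2 * pi * (k%:R / r%:R)).
    rewrite -[RHS]mul1r -(@cis_2pi_int R (j %/ r)%Z) -cisD /t.
    by congr cis; rewrite {1}jE intrD intrM; field.
  apply: cis_neq1; rewrite mulr_gt0 ?twopi_gt0//=; last first.
    by rewrite divr_gt0// ltr0n.
  by rewrite gtr_pMr ?twopi_gt0// ltr_pdivrMr ?ltr0n// mul1r ltr_nat.
by apply: (mulfI z1); rewrite -subrX1 tj subrr mulr0.
Qed.

Lemma ip_sum_coef (I : Type) (s : seq I) (z : I -> R[i]) f g : L2 f -> L2 g ->
  \sum_(i <- s) ip f (fun x => z i * g x) = ip f (fun x => (\sum_(i <- s) z i) * g x).
Proof.
move=> hf hg; elim: s => [|i s IH].
  rewrite !big_nil -(mul0r (ip f g)) -ip_cr//.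
rewrite !big_cons IH -ipDr//; [|exact: L2Z|exact: L2Z].
by apply: eq_ip => // x _; rewrite mulrDl.
Qed.

Lemma ip_suml (I : Type) (s : seq I) (F : I -> R -> R[i]) g :
  (forall i, L2 (F i)) -> L2 g ->
  L2 (fun x => \sum_(i <- s) F i x) /\
  ip (fun x => \sum_(i <- s) F i x) g = \sum_(i <- s) ip (F i) g.
Proof.
move=> hF hg; elim: s => [|i s [h IH]].
  split; first by under eq_fun do rewrite big_nil; exact: L2_0.
  rewrite big_nil -(mul0r (ip g g)) -ip_cl//.
  by apply: eq_ip => // x _; rewrite big_nil mul0r.
split; first by under eq_fun do rewrite big_cons; exact: L2D.
rewrite big_cons -IH -ipDl//; apply: eq_ip => // x _; exact: big_cons.
Qed.

End GaussSum.

Section Revival.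
Context {R : realType}.
Variables (V : R -> R) (f : R -> R[i]) (q r : nat).
Hypothesis hf : L2 f.
Hypothesis r_gt0 : (0 < r)%N.

Local Notation mu := (@lebesgue_measure R).
Local Notation D := (@itv2pi R).

Let amp : R[i] := r%:R^-1 * cis (- (2 * pi * mean V * q%:R / r%:R)).
Let cf (k m : nat) : R[i] := cis (2 * pi * (m%:R * k%:R / r%:R - m%:R ^+ 2 * q%:R / r%:R)).
Let tau (k : nat) : R := 2 * pi * (k%:R / r%:R).

Definition revival_wrap x : R[i] :=
  amp * \sum_(k < r) \sum_(m < r) cf k m * shifted f (tau k) x.

Lemma tau_itv (k : 'I_r) : 0 <= tau k <= 2 * pi.
Proof.
have p0 := ltW (@twopi_gt0 R).
rewrite mulr_ge0 ?divr_ge0//= ler_piMr// ler_pdivrMr ?ltr0n// mul1r ler_nat.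
exact: ltnW.
Qed.

Lemma ae_revival_wrap : ae_equal (revival V f q r) revival_wrap.
Proof.
apply: ae_itv2pi_co => x /andP[x0 x2].
rewrite /revival /revival_wrap; congr (_ * _); apply: eq_bigr => k _; apply: eq_bigr => m _.
congr (_ * _); rewrite periodic_ext_wrap//.
have /andP[t0 t2] := tau_itv k; rewrite -/(tau k).
by rewrite lerBrDl (le_trans _ x0)/= ?subr_le0// ltrBlDr (lt_le_trans x2)// lerDl.
Qed.

Lemma L2_revival_wrap : L2 revival_wrap.
Proof.
apply: L2Z; apply: (proj1 (ip_suml _ _ L2_0)) => k.
apply: (proj1 (ip_suml _ _ L2_0)) => m.
by apply: L2Z; apply: L2_shifted => //; exact: tau_itv.
Qed.

Lemma ip_revival_wrap n (g : R[i]) :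
  ip revival_wrap (fun x => g * expi n x) =
  ip f (fun x => g * cis (freq V n * rational_time q r) * expi n x).
Proof.
have hsh (k : 'I_r) : L2 (shifted f (tau k)) by apply: L2_shifted => //; exact: tau_itv.
have hin (k : 'I_r) : L2 (fun x => \sum_(m < r) cf k m * shifted f (tau k) x).
  by apply: (proj1 (ip_suml _ _ L2_0)) => m; exact: L2Z.
rewrite /revival_wrap ipM.
have hg : L2 (fun x => amp^*%C * (g * expi n x)) by exact/L2Z/L2_expi.
rewrite (proj2 (ip_suml _ hin hg)).
pose z (k m : nat) : R[i] := ((cf k m)^*%C * amp^*%C * g) * expi n (tau k).
transitivity (\sum_(k < r) \sum_(m < r) ip f (fun x => z k m * expi n x)).
  apply: eq_bigr => k _.
  have hcs (m : 'I_r) : L2 (fun x => cf k m * shifted f (tau k) x) by exact: L2Z.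
  rewrite (proj2 (ip_suml _ hcs hg)); apply: eq_bigr => m _.
  rewrite ipM /z -ip_shifted//; last exact: tau_itv.
  by apply: eq_ip => // x _; rewrite !mulrA.
under eq_bigr do rewrite (ip_sum_coef _ _ hf (L2_cbdd (cbdd_expi _))).
rewrite (ip_sum_coef _ _ hf (L2_cbdd (cbdd_expi _))).
suff -> : \sum_(k < r) \sum_(m < r) z k m = g * cis (freq V n * rational_time q r) by [].
have rR : r%:R != 0 :> R by rewrite pnatr_eq0 -lt0n.
have rC : r%:R != 0 :> R[i] by rewrite pnatr_eq0 -lt0n.
rewrite exchange_big /=.
have inner (m : 'I_r) : \sum_(k < r) z k m = amp^*%C * g *
    cis (2 * pi * (m%:R ^+ 2 * q%:R / r%:R)) * (if (r %| n - (m : nat)%:Z)%Z then r%:R else 0).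
  rewrite -(@sum_cis_roots R)// mulr_sumr; apply: eq_bigr => k _.
  rewrite /z /cf -cisN.
  have -> : cis (- (2 * pi * (m%:R * k%:R / r%:R - m%:R ^+ 2 * q%:R / r%:R))) * amp^*%C * g * expi n (tau k) =
    amp^*%C * g * (cis (- (2 * pi * (m%:R * k%:R / r%:R - m%:R ^+ 2 * q%:R / r%:R))) * expi n (tau k)) by ring.
  rewrite -[RHS]mulrA; congr (_ * _); rewrite /expi -!cisD; congr cis.
  by rewrite /tau intrB; field.
under eq_bigr do rewrite inner.
have [m0 [l nE]] : exists m0 : 'I_r, exists l : int, n = l * r%:Z + (m0 : nat)%:Z.
  have := divz_eq n r; have := ltz_pmod n (d := r);
  have := modz_ge0 n (_ : r%:Z != 0); rewrite eqz_nat -lt0n => /(_ r_gt0).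
  case: (n %% r)%Z => // k _ /(_ r_gt0) kr nE.
  by exists (Ordinal kr), (n %/ r)%Z.
rewrite (bigD1 m0) //= big1 ?addr0; last first.
  move=> m mm0; rewrite ifF ?mulr0//; apply/negbTE/negP.
  rewrite -eqz_mod_dvd nE modzMDl => /eqP; rewrite !modz_small ?ltz_nat ?ltn_ord//.
  by move=> [] /val_inj e; rewrite e eqxx in mm0.
rewrite ifT; last by rewrite nE addrK dvdz_mull.
have -> : amp^*%C = r%:R^-1 * cis (2 * pi * mean V * q%:R / r%:R).
  by rewrite /amp rmorphM fmorphV rmorph_nat; congr (_ * _); rewrite cisN; exact: conjcK.
have -> : r%:R^-1 * cis (2 * pi * mean V * q%:R / r%:R) * g *
  cis (2 * pi * (m0%:R ^+ 2 * q%:R / r%:R)) * r%:R =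
  g * (cis (2 * pi * mean V * q%:R / r%:R) * cis (2 * pi * (m0%:R ^+ 2 * q%:R / r%:R))) :> R[i].
  by field.
congr (_ * _); rewrite -cisD.
rewrite -[LHS]mulr1 -(@cis_2pi_int R (q%:Z * (l * (l * r%:Z + (m0 : nat)%:Z + (m0 : nat)%:Z)))) -cisD; congr cis.
rewrite /freq /rational_time nE !(intrM, intrD) /=.
by field.
Qed.

End Revival.

Section Limits.
Context {R : realType}.
Implicit Types (a b g : R -> R).

Local Notation mu := (@lebesgue_measure R).
Local Notation D := (@itv2pi R).

Lemma cvg_Rintegral0 (F : nat -> R -> R) (G : R -> R) :
  (forall n, measurable_fun D (F n)) -> Dintegrable G ->
  (forall n x, D x -> `|F n x| <= G x) ->
  (forall x, D x -> F n x @[n --> \oo] --> 0) ->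
  \int[mu]_(x in D) F n x @[n --> \oo] --> 0.
Proof.
move=> mF iG FG F0.
have mD := @measurable_itv2pi R.
have [] := @dominated_convergence _ _ R mu D mD (fun n => EFin \o F n) (cst 0%E) (EFin \o G).
- by move=> n; apply/measurable_EFinP; exact: mF.
- exact: measurable_cst.
- by apply: aeW => x Dx; apply: cvg_EFin; [exact: nearW|exact: F0].
- exact: iG.
- by apply: aeW => x n Dx /=; rewrite lee_fin FG.
move=> _ _; rewrite integral0 => /fine_cvgP[_].
exact.
Qed.

Lemma bounded_series_cvg0 (u : R ^nat) (M : R) : (forall n, 0 <= u n) ->
  (forall n, \sum_(k <- iota 0 n) u k <= M) -> u @ \oo --> 0.
Proof.
move=> u0 uM; apply: cvg_series_cvg_0; apply: nondecreasing_is_cvgn.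
  by apply/nondecreasing_seqP => n; rewrite /series /= big_nat_recr//= lerDl.
by exists M => _ [n _ <-]; rewrite /series /= /index_iota subn0; exact: uM.
Qed.

Lemma coef2_cvg0 (f : R -> R[i]) : L2 f -> coef2 f n%:Z @[n --> \oo] --> 0.
Proof.
move=> hf; apply: (@bounded_series_cvg0 _ (2 * pi * ip f f)).
  by move=> n; exact: coef2_ge0.
move=> n; rewrite -(big_map (fun k : nat => k%:Z) xpredT (coef2 f)).
apply: bessel_seq => //; rewrite map_inj_uniq ?iota_uniq//.
by move=> i j [].
Qed.

End Limits.

Section RealFourier.
Context {R : realType}.
Implicit Types (a b g : R -> R).

Local Notation mu := (@lebesgue_measure R).
Local Notation D := (@itv2pi R).

Definition cosc a (n : nat) : R := \int[mu]_(y in D) (cos (n%:R * y) * a y).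
Definition sinc a (n : nat) : R := \int[mu]_(y in D) (sin (n%:R * y) * a y).
Definition weight (n : nat) : R := if n is 0%N then (2 * pi)^-1 else pi^-1.
Definition fourier_term a n x : R :=
  weight n * (cosc a n * cos (n%:R * x) + sinc a n * sin (n%:R * x)).
Definition fourier_sum a N x : R := \sum_(n < N) fourier_term a n x.
Definition dirichlet N (t : R) : R := \sum_(n < N) weight n * cos (n%:R * t).

Lemma bdd_cosM (c : R) : bdd_measurable (fun y => cos (c * y)).
Proof. by apply: bdd_continuous; exact: continuous_cosM. Qed.

Lemma bdd_sinM (c : R) : bdd_measurable (fun y => sin (c * y)).
Proof. by apply: bdd_continuous; exact: continuous_sinM. Qed.

Lemma dirichlet_sin N t : dirichlet N.+1 t * sin (t / 2) =
  (2 * pi)^-1 * sin ((N%:R + 2^-1) * t).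
Proof.
have p0 : pi != 0 :> R by rewrite gt_eqF// pi_gt0.
rewrite /dirichlet; elim: N => [|N IH].
  by rewrite big_ord1 /= mul0r cos0 mulr1 add0r [_ / 2]mulrC.
rewrite big_ord_recr /= mulrDl IH.
have -> : (N.+1%:R + 2^-1) * t = N.+1%:R * t + t / 2 by field.
have -> : (N%:R + 2^-1) * t = N.+1%:R * t - t / 2 by rewrite -natr1; field.
rewrite !sinD sinN cosN invfM; set c := pi^-1; field; exact: isT.
Qed.

Lemma dirichlet_bdd N x : bdd_measurable (fun y => dirichlet N (x - y)).
Proof.
elim: N => [|N IH].
  apply: (@eq_bdd_measurable _ (fun=> 0)); last exact: bdd_measurable_cst.
  by move=> y _; rewrite /dirichlet big_ord0.
apply: (@eq_bdd_measurable _ (fun y => dirichlet N (x - y) + weight N * cos (N%:R * (x - y)))).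
  by move=> y _; rewrite /dirichlet big_ord_recr.
apply: bdd_measurableD => //; apply: bdd_measurableM; first exact: bdd_measurable_cst.
apply: bdd_continuous => y.
apply: (@continuous_comp _ _ _ (fun y => x - y) (fun t => cos (N%:R * t))).
  by apply: cvgB; [exact: cvg_cst|exact: cvg_id].
exact: continuous_cosM.
Qed.

Lemma fourier_sum_kernel a N x : Dintegrable a ->
  fourier_sum a N x = \int[mu]_(y in D) (dirichlet N (x - y) * a y).
Proof.
move=> ia; rewrite /fourier_sum /dirichlet; elim: N => [|N IH].
  rewrite big_ord0 -[LHS](mul0r (fine (mu D))) -Rintegral_cst//.
  by apply: eq_Rintegral => y _; rewrite big_ord0 mul0r.
have ic c : Dintegrable (fun y => cos (c * y) * a y) by apply: DintegrableMbdd => //; exact: bdd_cosM.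
have is_ c : Dintegrable (fun y => sin (c * y) * a y) by apply: DintegrableMbdd => //; exact: bdd_sinM.
have hD := dirichlet_bdd N x.
rewrite big_ord_recr /= IH /fourier_term /cosc /sinc.
have -> : \int[mu]_(y in D) (cos (N%:R * y) * a y) * cos (N%:R * x) +
    \int[mu]_(y in D) (sin (N%:R * y) * a y) * sin (N%:R * x) =
    \int[mu]_(y in D) (cos (N%:R * (x - y)) * a y).
  rewrite mulrC [X in _ + X]mulrC -!RintegralZl//; [|exact: is_|exact: ic].
  rewrite -RintegralD//; [|exact: DintegrableZ|exact: DintegrableZ].
  by apply: eq_Rintegral => y _; rewrite mulrBr cosB; ring.
have iK : Dintegrable (fun y => cos (N%:R * (x - y)) * a y).
  have := DintegrableD (DintegrableZ (cos (N%:R * x)) (ic N%:R)) (DintegrableZ (sin (N%:R * x)) (is_ N%:R)).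
  by apply: eq_integrable => // y _ /=; rewrite mulrBr cosB; congr (_%:E); ring.
rewrite -RintegralZl// -RintegralD//; last 2 first.
- exact: DintegrableMbdd.
- exact: DintegrableZ.
by apply: eq_Rintegral => y _; rewrite big_ord_recr /=; ring.
Qed.

Lemma fourier_sum_cst c N x : fourier_sum (fun=> c) N.+1 x = c.
Proof.
have p0 := @twopi_gt0 R.
rewrite /fourier_sum big_ord_recl big1 ?addr0.
  rewrite /fourier_term /cosc /sinc /= !mul0r cos0 sin0 mulr0 addr0 mulr1.
  transitivity ((2 * pi)^-1 * \int[mu]_(y in D) c).
    by congr (_ * _); apply: eq_Rintegral => y _; rewrite mul0r cos0 mul1r.
  rewrite Rintegral_cst// [X in fine X]mu_itv2pi /=.
  by rewrite mulrC mulfK// gt_eqF.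
move=> n _; rewrite /fourier_term /cosc /sinc.
have n0 : (Posz (lift ord0 n)) != 0 by [].
have [c0 s0] : \int[mu]_(y in D) cos ((lift ord0 n)%:R * y) = 0 /\
  \int[mu]_(y in D) sin ((lift ord0 n)%:R * y) = 0 := @integral_expi R _ n0.
have ci (k : R) : Dintegrable (fun y => cos (k * y)).
  by apply: Dintegrable_bdd; exact: bdd_cosM.
have si (k : R) : Dintegrable (fun y => sin (k * y)).
  by apply: Dintegrable_bdd; exact: bdd_sinM.
have -> : \int[mu]_(y in D) (cos ((lift ord0 n)%:R * y) * c) = 0.
  rewrite RintegralZr//; last exact: ci.
  by transitivity (0 * c); [congr (_ * _); exact: c0|exact: mul0r].
have -> : \int[mu]_(y in D) (sin ((lift ord0 n)%:R * y) * c) = 0.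
  rewrite RintegralZr//; last exact: si.
  by transitivity (0 * c); [congr (_ * _); exact: s0|exact: mul0r].
by rewrite !mul0r addr0 mulr0.
Qed.

(* Lipschitz for the chord distance of the circle, so that the quotient of
   a x - a y by the denominator sin ((x - y) / 2) of the Dirichlet kernel is bounded. *)
Definition chord_lipschitz C a := forall x y, `|a x - a y| <= C * `|sin ((x - y) / 2)|.

Lemma chord_lipschitz_continuous C a : chord_lipschitz C a -> continuous a.
Proof.
move=> aC x; apply/cvgrPdist_le => e e0.
have sin0' : (fun y => C * `|sin ((x - y) / 2)|) @ x --> 0.
  have -> : 0 = C * `|sin ((x - x) / 2)| by rewrite subrr mul0r sin0 normr0 mulr0.
  apply: cvgM; first exact: cvg_cst.
  apply: cvg_norm.
  apply: (@continuous_comp _ _ _ (fun y : R => (x - y) / 2) sin); last exact: continuous_sin.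
  apply: cvgM; last exact: cvg_cst.
  by apply: cvgB; [exact: cvg_cst|exact: cvg_id].
move/cvgrPdist_le: sin0' => /(_ _ e0); apply: filterS => y; rewrite sub0r normrN => h.
by rewrite (le_trans (aC x y))// (le_trans _ h)// ler_norm.
Qed.

Section Pointwise.
Variables (C : R) (a : R -> R) (x : R).
Hypothesis aC : chord_lipschitz C a.

Let s y : R := sin ((x - y) / 2).
(* H = (a y - a x) / s y, with value 0 where s vanishes; [powR] is used because its
   measurability is available. *)
Let H y : R := (a y - a x) * s y * (s y ^+ 2) `^ (-1).

Let HE y : H y * s y = a y - a x.
Proof.
rewrite /H powR_inv1 ?sqr_ge0//.
have [s0|s0] := eqVneq (s y) 0; last by field.
rewrite s0 !mulr0; apply/esym/eqP; rewrite -normr_le0 distrC (le_trans (aC x y))//.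
by rewrite -/(s y) s0 normr0 mulr0.
Qed.

Let C_ge0 : 0 <= C.
Proof.
have := aC 0 pi; rewrite sub0r mulNr sinN normrN sin_pihalf normr1 mulr1.
exact: le_trans.
Qed.

Let H_le y : `|H y| <= C.
Proof.
have [s0|s0] := eqVneq (s y) 0; first by rewrite /H s0 mulr0 mul0r normr0.
have sp : 0 < `|s y| by rewrite normr_gt0.
by rewrite -(ler_pM2r sp) -normrM HE distrC aC.
Qed.

Let s_continuous : continuous s.
Proof.
move=> y; apply: (@continuous_comp _ _ _ (fun y : R => (x - y) / 2) sin); last exact: continuous_sin.
apply: cvgM; last exact: cvg_cst.
by apply: cvgB; [exact: cvg_cst|exact: cvg_id].
Qed.

Let H_bdd : bdd_measurable H.
Proof.
split; last by exists C => y _.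
have ms : measurable_fun D s by case: (bdd_continuous s_continuous).
apply: measurable_funM; first apply: measurable_funM => //.
  apply: measurable_funB; last exact: measurable_cst.
  by case: (bdd_continuous (chord_lipschitz_continuous aC)).
apply: (measurableT_comp (measurable_powR _)) => //.
exact: measurable_funX.
Qed.

Let half y : R[i] := cis ((x - y) / 2).
Let Hc y : R[i] := (H y)%:C * half y.

Let Hc_cbdd : cbdd Hc.
Proof.
apply: cbddM; first exact: cbdd_real H_bdd.
have := cbddM (cbdd_cst (cis (x / 2))) (@cbdd_cis R (- 2^-1)).
have -> // : (fun y => cis (x / 2) * cis (- 2^-1 * y)) = half.
by apply/funext => y; rewrite /half -cisD; congr cis; field.
Qed.

Let fourier_error N : fourier_sum a N.+1 x - a x =
  (2 * pi)^-1 * \int[mu]_(y in D) (sin ((N%:R + 2^-1) * (x - y)) * H y).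
Proof.
have ia : Dintegrable a by exact/Dintegrable_bdd/bdd_continuous/(chord_lipschitz_continuous aC).
have hs : bdd_measurable (fun y => sin ((N%:R + 2^-1) * (x - y))).
  apply: bdd_continuous => y.
  apply: (@continuous_comp _ _ _ (fun y => x - y) (fun t => sin ((N%:R + 2^-1) * t))).
    by apply: cvgB; [exact: cvg_cst|exact: cvg_id].
  exact: continuous_sinM.
have hD := dirichlet_bdd N.+1 x.
have ic : Dintegrable (fun=> a x) by exact/Dintegrable_bdd/bdd_measurable_cst.
rewrite -[X in _ - X](fourier_sum_cst (a x) N x) !fourier_sum_kernel//.
rewrite -RintegralB//; [|exact: DintegrableMbdd|exact: DintegrableMbdd].
rewrite -RintegralZl//; last by apply: DintegrableMbdd => //; exact: Dintegrable_bdd.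
apply: eq_Rintegral => y _.
rewrite -mulrBr -HE.
transitivity (dirichlet N.+1 (x - y) * s y * H y); first by ring.
by rewrite dirichlet_sin mulrA.
Qed.

Lemma fourier_sum_error_le N : `|fourier_sum a N.+1 x - a x| <= C.
Proof.
rewrite fourier_error normrM gtr0_norm ?invr_gt0 ?twopi_gt0//.
rewrite mulrC ler_pdivrMr ?twopi_gt0//; apply: Rintegral_bound.
  apply: bdd_measurableM => //; apply: bdd_continuous => y.
  apply: (@continuous_comp _ _ _ (fun y => x - y) (fun t => sin ((N%:R + 2^-1) * t))).
    by apply: cvgB; [exact: cvg_cst|exact: cvg_id].
  exact: continuous_sinM.
by move=> y _; rewrite normrM -[leRHS]mul1r ler_pM// sin_max.
Qed.

Lemma fourier_sum_cvg : fourier_sum a n.+1 x @[n --> \oo] --> a x.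
Proof.
have hHc : L2 Hc by exact: L2_cbdd.
apply/cvgrPdist_le => e e0.
have e2 : 0 < (2 * pi * e) ^+ 2 by rewrite exprn_gt0// mulr_gt0// twopi_gt0.
have /cvgrPdist_le/(_ _ e2) := coef2_cvg0 hHc; apply: filterS => N.
rewrite sub0r normrN ger0_norm ?coef2_ge0// => cN.
rewrite distrC fourier_error normrM gtr0_norm ?invr_gt0 ?twopi_gt0//.
rewrite ler_pdivrMl ?twopi_gt0//; apply: normr_le_sqr.
  by rewrite mulr_ge0 ?ltW// twopi_gt0.
apply: le_trans cN.
have -> : \int[mu]_(y in D) (sin ((N%:R + 2^-1) * (x - y)) * H y) =
   ip Hc (fun y => 'i%C * cis (- (N%:R * x)) * expi N%:Z y).
  apply: eq_Rintegral => y _.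
  have -> : sin ((N%:R + 2^-1) * (x - y)) = sin ((x - y) / 2 - (N%:R * y - N%:R * x)).
    by congr sin; field.
  have -> : 'i%C * cis (- (N%:R * x)) * expi N%:Z y = 'i%C * cis (N%:R * y - N%:R * x).
    by rewrite -mulrA -cisD addrC.
  by rewrite /Hc /half /cis !ReImE /= sinB; ring.
rewrite (le_trans (ip_expi_sqr _ _ hHc))// nrm2M nrm2_i nrm2_cis !mul1r.
exact: lexx.
Qed.

End Pointwise.

Lemma fourier_sum_sym a b N : Dintegrable a -> Dintegrable b ->
  \int[mu]_(x in D) (b x * fourier_sum a N x) = \int[mu]_(x in D) (a x * fourier_sum b N x).
Proof.
move=> ia ib.
have E (f g : R -> R) : Dintegrable f -> Dintegrable g ->
   \int[mu]_(x in D) (g x * fourier_sum f N x) =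
   \sum_(n < N) weight n * (cosc f n * cosc g n + sinc f n * sinc g n).
  move=> if_ ig; rewrite /fourier_sum; elim: N => [|M IH].
    rewrite big_ord0 -[RHS](mul0r (fine (mu D))) -Rintegral_cst//.
    by apply: eq_Rintegral => y _; rewrite big_ord0 mulr0.
  have ic c : Dintegrable (fun y => cos (c * y) * g y) by apply: DintegrableMbdd => //; exact: bdd_cosM.
  have is_ c : Dintegrable (fun y => sin (c * y) * g y) by apply: DintegrableMbdd => //; exact: bdd_sinM.
  have it n : bdd_measurable (fourier_term f n).
    apply: bdd_measurableM; first exact: bdd_measurable_cst.
    by apply: bdd_measurableD; apply: bdd_measurableM; do ?[exact: bdd_measurable_cst|exact: bdd_cosM|exact: bdd_sinM].
  have isum K : bdd_measurable (fun x => \sum_(n < K) fourier_term f n x).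
    elim: K => [|K IHK]; first by under eq_fun do rewrite big_ord0; exact: bdd_measurable_cst.
    by under eq_fun do rewrite big_ord_recr; exact: bdd_measurableD.
  transitivity (\int[mu]_(x in D) ((\sum_(n < M) fourier_term f n x) * g x + fourier_term f M x * g x)).
    by apply: eq_Rintegral => x _; rewrite big_ord_recr /=; ring.
  rewrite RintegralD//; [|exact: DintegrableMbdd|exact: DintegrableMbdd].
  rewrite big_ord_recr /= -IH; congr (_ + _).
    by apply: eq_Rintegral => x _; rewrite mulrC.
  rewrite [cosc g M]/cosc [sinc g M]/sinc -!RintegralZl//; [|exact: is_|exact: ic].
  rewrite -RintegralD//; [|exact: DintegrableZ|exact: DintegrableZ].
  rewrite -RintegralZl//; last by apply: DintegrableD; exact: DintegrableZ.
  by apply: eq_Rintegral => x _; rewrite /fourier_term; ring.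
rewrite !E//; apply: eq_bigr => n _; ring.
Qed.

End RealFourier.

Section NullFunction.
Context {R : realType}.
Implicit Types (a b g : R -> R).

Local Notation mu := (@lebesgue_measure R).
Local Notation D := (@itv2pi R).

(* Chord-Lipschitz functions increasing to the indicator of ]0, b[ as k grows. *)
Definition bump (b k : R) (x : R) : R :=
  Num.min 1 (k * Num.max 0 (cos (x - b / 2) - cos (b / 2))).

Lemma max0_lip (s t : R) : `|Num.max 0 s - Num.max 0 t| <= `|s - t|.
Proof.
have h (p q : R) : Num.max 0 p - Num.max 0 q <= `|p - q|.
  have [p0|p0] := leP 0 p; have [q0|q0] := leP 0 q.
  - exact: ler_norm.
  - by rewrite subr0 (le_trans _ (ler_norm _))// lerDl oppr_ge0 ltW.
  - by rewrite sub0r (le_trans _ (normr_ge0 _))// oppr_le0.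
  - by rewrite subrr.
by rewrite ler_norml lerNl opprB h distrC h.
Qed.

Lemma min1_lip (s t : R) : `|Num.min 1 s - Num.min 1 t| <= `|s - t|.
Proof.
have h (p q : R) : Num.min 1 p - Num.min 1 q <= `|p - q|.
  have [p0|p0] := leP 1 p; have [q0|q0] := leP 1 q.
  - by rewrite subrr.
  - by rewrite (le_trans _ (ler_norm _))// lerD2r.
  - by rewrite (le_trans _ (normr_ge0 _))// subr_le0 ltW.
  - exact: ler_norm.
by rewrite ler_norml lerNl opprB h distrC h.
Qed.

Lemma bump_chord_lipschitz (b k : R) : 0 <= k -> chord_lipschitz (2 * k) (bump b k).
Proof.
move=> k0 x y; rewrite (le_trans (min1_lip _ _))// -mulrBr normrM ger0_norm//.
rewrite [2 * k]mulrC -mulrA ler_wpM2l// (le_trans (max0_lip _ _))//.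
rewrite opprB addrA subrK.
have -> : x - b / 2 = ((x + y) / 2 - b / 2) + (x - y) / 2 by field.
have -> : y - b / 2 = ((x + y) / 2 - b / 2) - (x - y) / 2 by field.
move: ((x + y) / 2 - b / 2) ((x - y) / 2) => p d.
rewrite cosD cosB.
have -> : cos p * cos d - sin p * sin d - (cos p * cos d + sin p * sin d) = - (2 * sin p * sin d) by ring.
rewrite normrN !normrM ger0_norm//.
by rewrite -mulrA ler_pM2l// ler_piMl// sin_max.
Qed.

Lemma bump_ge0 (b k x : R) : 0 <= k -> 0 <= bump b k x.
Proof. by move=> k0; rewrite /bump le_min ler01 mulr_ge0// le_max lexx. Qed.

Lemma bump_le1 (b k x : R) : bump b k x <= 1.
Proof. by rewrite /bump ge_min lexx. Qed.

Lemma bump_out (b k x : R) : 0 <= b -> b <= x -> x <= 2 * pi -> bump b k x = 0.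
Proof.
move=> b0 bx x2; rewrite /bump.
have -> : Num.max 0 (cos (x - b / 2) - cos (b / 2)) = 0.
  apply/max_idPl; rewrite subr_le0.
  have [xp|xp] := leP (x - b / 2) pi.
    have i1 : b / 2 \in `[0, pi] by rewrite in_itv /=; apply/andP; split; lra.
    have i2 : x - b / 2 \in `[0, pi] by rewrite in_itv /=; apply/andP; split; lra.
    rewrite leNgt; apply/negP; rewrite ltr_cos// => h; lra.
  have -> : cos (x - b / 2) = cos (2 * pi - (x - b / 2)).
    by rewrite [RHS]cosB mulr_natl cos2pi sin2pi mul1r mul0r addr0.
  have i1 : b / 2 \in `[0, pi] by rewrite in_itv /=; apply/andP; split; lra.
  have i2 : 2 * pi - (x - b / 2) \in `[0, pi] by rewrite in_itv /=; apply/andP; split; lra.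
  rewrite leNgt; apply/negP; rewrite ltr_cos// => h; lra.
by rewrite mulr0; apply/min_idPr; rewrite ler01.
Qed.

Lemma bump_in (b x : R) : 0 < x -> x < b -> b <= 2 * pi ->
  bump b n%:R x @[n --> \oo] --> (1 : R).
Proof.
move=> x0 xb b2.
have c0 : 0 < cos (x - b / 2) - cos (b / 2).
  rewrite subr_gt0 -(cos_norm (x - b / 2)).
  have n1 : `|x - b / 2| < b / 2 by rewrite ltr_norml; apply/andP; split; lra.
  have n0 := normr_ge0 (x - b / 2).
  by rewrite ltr_cos// in_itv /=; apply/andP; split; lra.
have [m mP] : exists m : nat, 1 <= m%:R * (cos (x - b / 2) - cos (b / 2)).
  exists (Num.truncn (cos (x - b / 2) - cos (b / 2))^-1).+1.
  by rewrite -ler_pdivrMr// div1r ltW// Num.Theory.truncnS_gt.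
apply: cvg_near_cst; exists m => // n /= mn.
rewrite /bump (max_idPr (ltW c0)); apply/min_idPl.
by apply: (le_trans mP); apply: ler_wpM2r; [exact: ltW|rewrite ler_nat].
Qed.

Lemma bump_0 (b k : R) : bump b k 0 = 0.
Proof.
rewrite /bump sub0r cosN subrr maxxx mulr0; apply/min_idPr; exact: ler01.
Qed.

Lemma integral_prefix0 g : Dintegrable g ->
  (forall C chi, chord_lipschitz C chi -> \int[mu]_(x in D) (chi x * g x) = 0) ->
  forall b : R, 0 <= b -> b <= 2 * pi -> \int[mu]_(x in `[0, b]) g x = 0.
Proof.
move=> ig h b b0 b2.
have mg := Dintegrable_measurable ig.
pose ind : R -> R := \1_(`]0, b[%classic : set R).
have mind : measurable_fun D ind by apply: measurable_funTS; exact: measurable_indic.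
have ind_bdd : bdd_measurable ind.
  by split => //; exists 1 => x _; rewrite /ind indicE; case: (_ \in _); rewrite ?normr1 ?normr0.
have bump_b k : bdd_measurable (bump b k%:R).
  exact: bdd_continuous (chord_lipschitz_continuous (bump_chord_lipschitz b (ler0n _ k))).
have lim0 : \int[mu]_(x in D) ((bump b n%:R x - ind x) * g x) @[n --> \oo] --> 0.
  apply: (@cvg_Rintegral0 _ _ (fun x => `|g x|)).
  - move=> n; apply: measurable_funM => //; apply: measurable_funB => //.
    by case: (bump_b n).
  - exact: Dintegrable_norm.
  - move=> n x Dx; rewrite normrM ler_piMl//.
    have := bump_ge0 b x (ler0n _ n); have := bump_le1 b n%:R x.
    by rewrite /ind indicE ler_norml; case: (_ \in _) => /= ??; apply/andP; split; lra.
  - move=> x /in_itv2pi/andP[x0 x2].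
    rewrite -[X in _ --> X](mul0r (g x)); apply: cvgM; last exact: cvg_cst.
    rewrite /ind indicE; have [xI|xI] := boolP (x \in _).
      move: xI; rewrite inE /= in_itv /= => /andP[x0' xb].
      rewrite -(subrr 1); apply: cvgB; last exact: cvg_cst.
      exact: bump_in.
    have bz n : bump b n%:R x = 0.
      move: x0; rewrite le_eqVlt => /predU1P[<-|x0]; first exact: bump_0.
      apply: bump_out => //; rewrite leNgt; apply/negP => xb; move/negP: xI; apply.
      by rewrite inE /= in_itv /= x0 xb.
    by under eq_fun do rewrite bz; rewrite subr0; exact: cvg_cst.
have E n : \int[mu]_(x in D) ((bump b n%:R x - ind x) * g x) = - \int[mu]_(x in D) (ind x * g x).
  under eq_Rintegral do rewrite mulrBl.
  rewrite RintegralB//; [|exact: DintegrableMbdd|exact: DintegrableMbdd].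
  by rewrite (h _ _ (bump_chord_lipschitz b (ler0n _ n))) sub0r.
have I0 : \int[mu]_(x in D) (ind x * g x) = 0.
  apply/eqP; rewrite -oppr_eq0; apply/eqP.
  have lim1 : (fun _ : nat => - \int[mu]_(x in D) (ind x * g x)) @ \oo --> 0.
    by apply: cvg_trans lim0; apply: near_eq_cvg; apply: nearW => n; exact: E.
  by rewrite -(cvg_lim (@Rhausdorff R) lim1) lim_cst.
rewrite -[RHS]I0.
have i0b (b1 b2' : bool) : mu.-integrable [set` Interval (BSide b1 0) (BSide b2' b)] (EFin \o g).
  exact: integrable_sub_itv.
transitivity (\int[mu]_(x in `]0, b[) g x).
  by rewrite Rintegral_itv_bndo_bndc// Rintegral_itv_obnd_cbnd.
have -> : `]0, b[%classic = D `&` `]0, b[%classic.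
  by apply/esym/setIidr; exact: itv_sub2pi.
rewrite Rintegral_mkcondr; apply: eq_Rintegral => x _.
by rewrite /ind patchE indicE; case: (_ \in _); rewrite ?mul1r ?mul0r.
Qed.

Lemma ae_zero g : Dintegrable g ->
  (forall b : R, 0 <= b -> b <= 2 * pi -> \int[mu]_(x in `[0, b]) g x = 0) ->
  {ae mu, forall x, D x -> g x = 0}.
Proof.
move=> ig h; pose G : R -> R := g \_ D.
have iG : mu.-integrable setT (EFin \o G).
  have := (@integrable_mkcond _ _ R mu D (EFin \o g) (@measurable_itv2pi R)).1 ig.
  by apply: eq_integrable => // x _; rewrite /G /= !patchE; case: ifP.
have iGy (y : R) : mu.-integrable [set` Interval (BLeft 0) (BRight y)] (EFin \o G).
  by apply: integrableS iG.
have lG : locally_integrable [set: R] G by exact: integrable_locally ig.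
have Fz (x : R) : 0 < x < 2 * pi ->
    \forall y \near x, \int[mu]_(t in [set` Interval (BLeft 0) (BRight y)]) G t = cst 0 y.
  move=> /andP[x0 x2].
  have n0 : \forall y \near x, - y < 0 by apply: Nlt_nbhsl; rewrite oppr_lt0.
  have n2 := lt_nbhsl x2.
  apply: filterS2 n0 n2 => y; rewrite oppr_lt0 => y0 y2.
  rewrite -[RHS](h y (ltW y0) (ltW y2)); apply: eq_Rintegral => t; rewrite inE /= => ty.
  rewrite /G patchE mem_set//; apply: itv_sub2pi ty => //; exact: ltW.
have ae_neq (c : R) : {ae mu, forall x, x <> c}.
  exists [set c]; split => //; first exact: lebesgue_measure_set1.
  by move=> x /= /contrapT.
have FF := ae_filter_ringOfSetsType mu.
have := FTC1 iGy lG; apply: filterS3 (ae_neq 0) (ae_neq (2 * pi)) => x x0 x2 H Dx.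
have /andP[x0' x2'] := (in_itv2pi x).1 Dx.
have xI : 0 < x < 2 * pi.
  by rewrite !lt_neqAle x0' x2' !andbT eq_sym; apply/andP; split; exact/eqP.
have [|_] := H; first by rewrite lte_fin; case/andP: xI.
rewrite {2}/G patchE mem_set// => <-.
by rewrite derive1E (near_eq_derive _ (Fz x xI)) derive_cst.
Qed.

End NullFunction.

Section UniformLimit.
Context {R : realType}.
Implicit Types (a b : R -> R).

Local Notation mu := (@lebesgue_measure R).
Local Notation D := (@itv2pi R).

Lemma continuous_fourier_sum a N : continuous (fourier_sum a N).
Proof.
elim: N => [|N IH] x.
  rewrite (_ : fourier_sum a 0 = cst 0); first exact: cvg_cst.
  by apply/funext => y; rewrite /fourier_sum big_ord0.
rewrite (_ : fourier_sum a N.+1 = fourier_sum a N \+ fourier_term a N); last first.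
  by apply/funext => y; rewrite /fourier_sum big_ord_recr.
apply: cvgD; first exact: IH.
apply: cvgM; first exact: cvg_cst.
apply: cvgD; apply: cvgM; try exact: cvg_cst.
  exact: continuous_cosM.
exact: continuous_sinM.
Qed.

Lemma summable_fourier_limit a (M : R) :
  (forall N, \sum_(n < N) weight n * (`|cosc a n| + `|sinc a n|) <= M) ->
  exists w : R -> R, exists T : nat -> R, [/\ continuous w, T @ \oo --> 0 &
    forall N x, `|w x - fourier_sum a N x| <= T N].
Proof.
move=> aM; pose c n := weight n * (`|cosc a n| + `|sinc a n|).
have w0 n : 0 <= weight n :> R by rewrite /weight; case: n => [|n]; rewrite invr_ge0 ?pi_ge0// ltW ?twopi_gt0.
have c0 n : 0 <= c n by rewrite mulr_ge0// addr_ge0.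
have cS : cvgn (series c).
  apply: nondecreasing_is_cvgn.
    by apply/nondecreasing_seqP => n; rewrite /series /= big_nat_recr//= lerDl.
  by exists M => _ [n _ <-]; rewrite /series /= big_mkord.
have uc n x : `|fourier_term a n x| <= c n.
  rewrite /fourier_term normrM ger0_norm// ler_wpM2l//.
  rewrite (le_trans (ler_normD _ _))// lerD// normrM ler_piMr//.
    exact: cos_max.
  exact: sin_max.
have sumE N x : fourier_sum a N x = series (fun n => fourier_term a n x) N.
  by rewrite /series /= big_mkord.
have uS x : cvgn (series (fun n => fourier_term a n x)).
  apply: normed_cvg; apply: (series_le_cvg _ c0 _ cS) => n /=; [exact: normr_ge0|exact: uc].
have c_nd : nondecreasing_seq (series c).
  by apply/nondecreasing_seqP => n; rewrite /series /= big_nat_recr//= lerDl.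
pose w x := limn (series (fun n => fourier_term a n x)).
pose T N := limn (series c) - series c N.
have T0 : T @ \oo --> 0.
  by rewrite -(subrr (limn (series c))); apply: cvgB; [exact: cvg_cst|exact: cS].
have wT N x : `|w x - fourier_sum a N x| <= T N.
  have h : (fun m => `|series (fun n => fourier_term a n x) m - fourier_sum a N x|) @ \oo -->
      `|w x - fourier_sum a N x|.
    by apply: cvg_norm; apply: cvgB; [exact: uS|exact: cvg_cst].
  apply: (cvgr_to_le h); exists N => // m /= Nm.
  apply: (@le_trans _ _ (series c m - series c N)); last first.
    by rewrite lerD2r; exact: nondecreasing_cvgn_le.
  rewrite sumE !sub_series_geq//.
  by rewrite (le_trans (ler_norm_sum _ _ _))// ler_sum.
exists w, T; split => // x; apply/cvgrPdist_le => e e0.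
have e3 : 0 < e / 3 by rewrite divr_gt0.
have /cvgrPdist_le/(_ _ e3)[N _ /(_ N (leqnn N))] := T0.
rewrite sub0r normrN => /(le_trans (ler_norm _)) TN.
have /cvgrPdist_le/(_ _ e3) := @continuous_fourier_sum a N x.
apply: filterS => y h.
have -> : w x - w y = (w x - fourier_sum a N x) + (fourier_sum a N x - fourier_sum a N y) -
   (w y - fourier_sum a N y) by ring.
rewrite (le_trans (ler_normB _ _))// (le_trans (lerD (ler_normD _ _) (lexx _)))//.
have h1 := le_trans (wT N x) TN; have h2 := le_trans (wT N y) TN.
by rewrite (le_trans (lerD (lerD h1 h) h2))//; lra.
Qed.

Lemma bdd_fourier_sum a N : bdd_measurable (fourier_sum a N).
Proof. exact/bdd_continuous/continuous_fourier_sum. Qed.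

Lemma Rintegral_itv2piB a b : Dintegrable a -> Dintegrable b ->
  \int[mu]_(x in D) (a x - b x) = \int[mu]_(x in D) a x - \int[mu]_(x in D) b x.
Proof. exact: (@RintegralB _ _ R mu D a b (@measurable_itv2pi R)). Qed.

Lemma fourier_sum_split a b c N :
    Dintegrable a -> bdd_measurable b -> bdd_measurable c ->
  \int[mu]_(x in D) (a x * (b x - fourier_sum b N.+1 x)) +
  \int[mu]_(x in D) (b x * (fourier_sum a N.+1 x - c x)) =
  \int[mu]_(x in D) (b x * (a x - c x)).
Proof.
move=> ia hb hc.
have S := fourier_sum_sym N.+1 ia (Dintegrable_bdd hb).
have i1 : Dintegrable (fun x => b x * a x) by exact: DintegrableMbdd hb ia.
have i2 : Dintegrable (fun x => fourier_sum b N.+1 x * a x).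
  exact: DintegrableMbdd (bdd_fourier_sum b N.+1) ia.
have i3 : Dintegrable (fun x => b x * fourier_sum a N.+1 x).
  exact: DintegrableMbdd hb (Dintegrable_bdd (bdd_fourier_sum a N.+1)).
have i4 : Dintegrable (fun x => b x * c x).
  exact: DintegrableMbdd hb (Dintegrable_bdd hc).
have e1 : \int[mu]_(x in D) (a x * (b x - fourier_sum b N.+1 x)) =
    \int[mu]_(x in D) (b x * a x) - \int[mu]_(x in D) (fourier_sum b N.+1 x * a x).
  rewrite -[RHS](Rintegral_itv2piB i1 i2).
  by apply: eq_Rintegral => x _; ring.
have e2 : \int[mu]_(x in D) (b x * (fourier_sum a N.+1 x - c x)) =
    \int[mu]_(x in D) (b x * fourier_sum a N.+1 x) - \int[mu]_(x in D) (b x * c x).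
  rewrite -[RHS](Rintegral_itv2piB i3 i4).
  by apply: eq_Rintegral => x _; ring.
have e3 : \int[mu]_(x in D) (b x * (a x - c x)) =
    \int[mu]_(x in D) (b x * a x) - \int[mu]_(x in D) (b x * c x).
  rewrite -[RHS](Rintegral_itv2piB i1 i4).
  by apply: eq_Rintegral => x _; ring.
have e4 : \int[mu]_(x in D) (a x * fourier_sum b N.+1 x) =
    \int[mu]_(x in D) (fourier_sum b N.+1 x * a x).
  by apply: eq_Rintegral => x _; ring.
by rewrite e1 e2 e3 S e4 addrA subrK.
Qed.

Lemma ae_continuous_of_summable_fourier a (M : R) : Dintegrable a ->
  (forall N, \sum_(n < N) weight n * (`|cosc a n| + `|sinc a n|) <= M) ->
  exists2 w : R -> R, continuous w & {ae mu, forall x, D x -> a x = w x}.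
Proof.
move=> ia aM; have [w [T [cw T0 wT]]] := summable_fourier_limit aM.
exists w => //.
have hw := bdd_continuous cw; have iw := Dintegrable_bdd hw.
have iaw : Dintegrable (fun x => a x - w x) by exact: DintegrableB.
suff h : {ae mu, forall x, D x -> a x - w x = 0}.
  have FF := ae_filter_ringOfSetsType mu.
  by apply: filterS h => x h Dx; apply/eqP; rewrite -subr_eq0 h.
apply: ae_zero => //; apply: integral_prefix0 => // C chi chiC.
have cchi := chord_lipschitz_continuous chiC; have bchi := bdd_continuous cchi.
have ichi := Dintegrable_bdd bchi.
have Z1 : \int[mu]_(x in D) (a x * (chi x - fourier_sum chi n.+1 x)) @[n --> \oo] --> 0.
  apply: (@cvg_Rintegral0 _ _ (fun x => C * `|a x|)).
  - move=> n; apply: measurable_funM; first exact: Dintegrable_measurable.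
    by apply: measurable_funB; [case: bchi|case: (bdd_fourier_sum chi n.+1)].
  - exact/DintegrableZ/Dintegrable_norm.
  - move=> n x _; rewrite normrM mulrC ler_wpM2r// distrC.
    exact: fourier_sum_error_le.
  - move=> x _; rewrite -[X in _ --> X](mulr0 (a x)); apply: cvgM; first exact: cvg_cst.
    rewrite -(subrr (chi x)); apply: cvgB; first exact: cvg_cst.
    exact: fourier_sum_cvg chiC.
have [K chiK] := bchi.2.
have Z2 : \int[mu]_(x in D) (chi x * (fourier_sum a n.+1 x - w x)) @[n --> \oo] --> 0.
  apply/cvgrPdist_le => e e0.
  have K0 : 0 <= K by rewrite (le_trans _ (chiK _ itv2pi0)).
  have d0 : 0 < e / (2 * pi * (K + 1)).
    by rewrite divr_gt0// mulr_gt0 ?twopi_gt0// ltr_wpDl.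
  have /cvgrPdist_le/(_ _ d0)[N0 _ hN] := T0; exists N0 => // n /= Nn.
  have := hN n.+1 (leqW Nn); rewrite /= sub0r normrN => /(le_trans (ler_norm _)) TN.
  rewrite sub0r normrN (le_trans (Rintegral_bound (M := K * (e / (2 * pi * (K + 1)))) _ _))//.
  - by apply: bdd_measurableM => //; exact: bdd_measurableB (bdd_fourier_sum _ _) hw.
  - move=> x Dx; rewrite normrM ler_pM ?chiK// distrC.
    exact: le_trans (wT _ _) TN.
  - have p0 := @twopi_gt0 R; have K1 : 0 < K + 1 by rewrite ltr_wpDl.
    have -> : K * (e / (2 * pi * (K + 1))) * (2 * pi) = e * (K / (K + 1)).
      move: (2 * pi) p0 (K + 1) K1 => P P0 Q Q0.
      by field; rewrite !gt_eqF.
    by rewrite ler_piMr ?(ltW e0)// ler_pdivrMr// mul1r lerDl.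
have lim : (fun _ : nat => \int[mu]_(x in D) (chi x * (a x - w x))) @ \oo --> 0.
  rewrite -[X in _ --> X](addr0 0).
  apply: cvg_trans (cvgD Z1 Z2); apply: near_eq_cvg; apply: nearW => n /=.
  exact: fourier_sum_split.
by rewrite -(cvg_lim (@Rhausdorff R) lim) lim_cst.
Qed.

End UniformLimit.

Section Final.
Context {R : realType}.

Local Notation mu := (@lebesgue_measure R).
Local Notation D := (@itv2pi R).

Lemma ae_continuous_component (h : R -> R[i]) (z : R[i]) (C : R) : L2 h -> nrm2 z <= 1 ->
  (forall N (g : int -> R[i]), (forall n, nrm2 (g n) <= 1) ->
    \sum_(n <- nonzero_ints N) `|ip h (fun x => g n * expi n x)| <= C) ->
  exists2 w : R -> R, continuous w &
    {ae mu, forall x, D x -> complex.Re (h x * z^*%C) = w x}.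
Proof.
move=> hh z1 hC.
pose a x := complex.Re (h x * z^*%C).
have hz : L2 (fun x => z^*%C * h x) by exact: L2Z.
have ia : Dintegrable a.
  have := ip_Dintegrable hh (L2_cbdd (cbdd_cst z)).
  by apply: eq_integrable => // x _ /=; rewrite /a !ReImE; congr (_%:E); ring.
have cE (n : nat) : cosc a n = (ip h (fun x => z * expi n%:Z x) + ip h (fun x => z * expi (- n%:Z) x)) / 2.
  have L k : L2 (fun x => z * expi k x) by exact: L2_expi.
  rewrite -ipDr// mulrC -ip_cr//; last exact: L2D.
  apply: eq_Rintegral => x _; rewrite /a -expiN /expi /cis !ReImE /=.
  by rewrite -[n%:~R]/(n%:R); field.
have sE (n : nat) : sinc a n = (ip h (fun x => (- 'i%C * z) * expi n%:Z x) + ip h (fun x => ('i%C * z) * expi (- n%:Z) x)) / 2.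
  have L k y : L2 (fun x => y * expi k x) by exact: L2_expi.
  rewrite -ipDr// mulrC -ip_cr//; last exact: L2D.
  apply: eq_Rintegral => x _; rewrite /a -expiN /expi /cis !ReImE /=.
  by rewrite -[n%:~R]/(n%:R); field.
pose W n : R := `|cosc a n| + `|sinc a n|.
have bound N : \sum_(n < N) W n.+1 <= 2 * C.
  have h1 := hC N (fun=> z) (fun=> z1).
  have nz : forall n : int, nrm2 (if (0 <= n)%R then - 'i%C * z else 'i%C * z) <= 1.
    by move=> n; case: ifP => _; rewrite nrm2M ?nrm2N nrm2_i mul1r.
  have h2 := hC N (fun n : int => if (0 <= n)%R then - 'i%C * z else 'i%C * z) nz.
  move: h1 h2; rewrite /nonzero_ints !big_cat !big_map /=.
  have -> : \sum_(n < N) W n.+1 = \sum_(n <- iota 0 N) W n.+1.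
    by rewrite -(big_mkord xpredT (fun n => W n.+1)) /index_iota subn0.
  set A1 := \sum_(i <- _) _; set A2 := \sum_(i <- _) _.
  set B1 := \sum_(i <- _) _; set B2 := \sum_(i <- _) _ => h1 h2.
  apply: (@le_trans _ _ (A1 + A2 + (B1 + B2))); last by lra.
  rewrite /A1 /A2 /B1 /B2 -!big_split /=; apply: ler_sum => n _.
  rewrite /W cE sE -NegzE.
  set p := ip h _; set q := ip h _; set r := ip h _; set s := ip h _.
  have half (u v : R) : `|(u + v) / 2| <= `|u| + `|v|.
    rewrite normrM [`|2^-1|]ger0_norm// (le_trans (ler_wpM2r _ (ler_normD u v)))//.
    by rewrite ler_piMr ?addr_ge0//; lra.
  exact: lerD (half p q) (half r s).
apply: (@ae_continuous_of_summable_fourier R a ((2 * pi)^-1 * W 0%N + pi^-1 * (2 * C)) ia).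
move=> N; have W0 n : 0 <= W n by rewrite addr_ge0.
have C0 : 0 <= 2 * C.
  by apply: le_trans (bound 0%N); rewrite big_ord0.
case: N => [|N].
  rewrite big_ord0; apply: addr_ge0; apply: mulr_ge0 => //; rewrite invr_ge0 ?pi_ge0//.
  exact: ltW twopi_gt0.
rewrite big_ord_recl lerD2l /= -mulr_sumr ler_wpM2l ?invr_ge0 ?pi_ge0//.
exact: bound.
Qed.

Lemma piecewise_C2_bdd_measurable (V : R -> R) : piecewise_C2 V -> bdd_measurable V.
Proof.
move=> [[M VM] _ [N [p [p0 pN plt pC2 _]]]]; split; last by exists M.
have piece i : (i <= N)%N -> measurable_fun `]p i, p i.+1[ V.
  move=> iN; have [dV _ _] := pC2 i iN.
  apply: open_continuous_measurable_fun; first exact: interval_open.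
  move=> x; rewrite inE /= => xI; apply: differentiable_continuous.
  exact/derivable1_diffP/dV.
have pre i : (i <= N.+1)%N -> measurable_fun `[0, p i] V.
  elim: i => [_|i IH iN].
    by rewrite p0 set_itv1; exact: measurable_fun_set1.
  have p0i j : (j <= i)%N -> 0 <= p j.
    elim: j => [_|j IHj ji]; first by rewrite p0.
    rewrite (le_trans (IHj (ltnW ji)))// ltW// plt//.
    by rewrite (leq_trans (ltnW ji)).
  have -> : `[0, p i.+1]%classic = `[0, p i] `|` (`]p i, p i.+1[ `|` [set p i.+1]).
    have lt1 := plt i iN.
    apply/seteqP; split => x /=; rewrite !in_itv /=.
      move=> /andP[x0 x1]; have [xi|xi] := leP x (p i); first by left; rewrite x0.
      right; move: x1; rewrite le_eqVlt => /predU1P[->|x1]; first by right.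
      by left.
    move=> [/andP[x0 xi]|[/andP[xi x1]|->]].
    - by rewrite x0 (le_trans xi (ltW lt1)).
    - by rewrite (ltW x1) (le_trans (p0i i (leqnn i)) (ltW xi)).
    - by rewrite lexx (le_trans (p0i i (leqnn i)) (ltW lt1)).
  apply/measurable_funU => //; first exact: measurableU.
  split; first exact: IH (ltnW iN).
  apply/measurable_funU => //; split; [exact: piece|exact: measurable_fun_set1].
by rewrite /itv2pi -pN; exact: pre.
Qed.

End Final.

Theorem theorem1p3 (R : realType) (V : R -> R) (f : R -> R[i])
    (u : R -> R -> R[i]) (q r : nat)
    (hV : piecewise_C2 V) (hf : L2 f) (hu : mild_solution V f u)
    (hq : (0 < q)%N) (hr : (0 < r)%N) (hqr : coprime q r) :
  exists w : R -> R[i],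
    [/\ {within itv2pi, continuous (fun x => complex.Re (w x))},
        {within itv2pi, continuous (fun x => complex.Im (w x))}
      & ae_equal (u (rational_time q r)) (fun x => w x + revival V f q r x)].
Proof.
have [U hU uU] := hu; have V_bdd := piecewise_C2_bdd_measurable hV.
set t0 : R := rational_time q r.
have t0_ge0 : 0 <= t0 by rewrite /t0 /rational_time mulr_ge0 ?divr_ge0// ltW// twopi_gt0.
have [C C0 hC] := fourier_flow_sum_le V_bdd hU hf t0_ge0.
have hUf := ugroup_L2 (proj1 hU) t0 hf.
have hpsi := L2_revival_wrap V q hf hr.
pose h x := U t0 f x - revival_wrap V f q r x.
have hh : L2 h by exact: L2B.
have sum_h N (g : int -> R[i]) : (forall n, nrm2 (g n) <= 1) ->
    \sum_(n <- nonzero_ints N) `|ip h (fun x => g n * expi n x)| <= C.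
  move=> hg; apply: le_trans (hC N g hg); rewrite le_eqVlt; apply/orP; left; apply/eqP.
  apply: eq_bigr => n _; rewrite /h ipBl//; last exact: L2_expi.
  by rewrite ip_revival_wrap.
have nrm2_1 : nrm2 (1 : R[i]) <= 1 by rewrite (nrm2_int 1) expr1n.
have nrm2_i1 : nrm2 ('i%C : R[i]) <= 1 by rewrite nrm2_i.
have [w1 cw1 aw1] := @ae_continuous_component R h 1 C hh nrm2_1 sum_h.
have [w2 cw2 aw2] := @ae_continuous_component R h 'i%C C hh nrm2_i1 sum_h.
exists (fun x => w1 x +i* w2 x); split.
- exact: continuous_subspaceT.
- exact: continuous_subspaceT.
have FF := ae_filter_ringOfSetsType (@lebesgue_measure R).
have A := ae_revival_wrap V f q hr.
have B : {ae (@lebesgue_measure R), forall x, itv2pi x -> h x = w1 x +i* w2 x}.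
  apply: filterS2 aw1 aw2 => x h1 h2 Dx; apply: complex_parts_eq.
    by rewrite -[RHS]/(w1 x) -(h1 Dx) !ReImE /=; ring.
  by rewrite -[RHS]/(w2 x) -(h2 Dx) !ReImE /=; ring.
apply: filterS3 (uU t0) A B => x h1 h2 h3 Dx.
by rewrite h1// h2// -h3// /h subrK.
Qed.
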